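(* Let $(n_k)_{k\ge1}$ be a sequence of positive integers with $n_{k+1}/n_k\to\infty$ as $k\to\infty$. Then for every permutation $\sigma:\mathbb{N}\to\mathbb{N}$ and every measurable $f:\mathbb{R}\to\mathbb{R}$ with $f(x+1)=f(x)$, $\int_0^1f(x)\,dx=0$, $\operatorname{Var}_{[0,1]}f<\infty$, we have $$\limsup_{N\to\infty}\frac{\sum_{k=1}^N f(n_{\sigma(k)}x)}{\sqrt{2N\log\log N}}=\|f\|\quad\text{for a.e. }x\in(0,1),$$ and moreover $$\limsup_{N\to\infty}\frac{N D_N(n_{\sigma(k)}x)}{\sqrt{2N\log\log N}}=\frac12\quad\text{for a.e. }x\in(0,1).$$
   Context: $\|f\|$ is the $L^2(0,1)$ norm. $\operatorname{Var}_{[0,1]}f$ is the total variation on $[0,1]$. For reals $x_1,\dots,x_N$, $D_N(x_1,\dots,x_N)=\sup_{0\le a<b<1}\left|\frac1N\sum_{k=1}^N\mathbf 1_{[a,b)}(\{x_k\})-(b-a)\right|$ with $\{\cdot\}$ the fractional part; $D_N(n_{\sigma(k)}x)=D_N(n_{\sigma(1)}x,\dots,n_{\sigma(N)}x)$. *)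

(* Defs.v *)
From Stdlib Require Import Reals Lra Classical ClassicalEpsilon.
Open Scope R_scope.

Fixpoint sumN (N : nat) (g : nat -> R) : R :=
  match N with O => 0 | S m => sumN m g + g m end.

Definition Rsup (E : R -> Prop) : R :=
  epsilon (inhabits 0) (fun l => is_lub E l).

Definition RInt01 (g : R -> R) : R :=
  epsilon (inhabits 0)
    (fun v => exists pr : Riemann_integrable g 0 1, RiemannInt pr = v).

Definition L2norm (f : R -> R) : R := sqrt (RInt01 (fun x => f x * f x)).

Definition finite_variation01 (f : R -> R) : Prop :=
  exists M : R, forall (m : nat) (t : nat -> R),
    0 <= t O -> t m <= 1 -> (forall i, (i < m)%nat -> t i <= t (S i)) ->
    sumN m (fun i => Rabs (f (t (S i)) - f (t i))) <= M.

Definition ind (a b t : R) : R :=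
  if Rle_dec a t then (if Rlt_dec t b then 1 else 0) else 0.

Definition discrepancy (N : nat) (y : nat -> R) : R :=
  Rsup (fun v => exists a b, 0 <= a /\ a < b /\ b < 1 /\
        v = Rabs (sumN N (fun k => ind a b (frac_part (y k))) / INR N - (b - a))).

Definition limsup_eq (u : nat -> R) (L : R) : Prop :=
  (forall eps, eps > 0 -> exists N0, forall N, (N >= N0)%nat -> u N < L + eps) /\
  (forall eps, eps > 0 -> forall N0, exists N, (N >= N0)%nat /\ u N > L - eps).

Definition null_set (E : R -> Prop) : Prop :=
  forall eps, eps > 0 -> exists a b : nat -> R,
    (forall k, a k <= b k) /\
    (forall x, E x -> exists k, a k < x < b k) /\
    (forall m, sum_f_R0 (fun k => b k - a k) m <= eps).

Definition ae01 (P : R -> Prop) : Prop :=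
  null_set (fun x => 0 < x < 1 /\ ~ P x).

Definition bijective_nat (s : nat -> nat) : Prop :=
  (forall i j, s i = s j -> i = j) /\ (forall m, exists i, s i = m).

(* Main.v *)
(* The sums are compared with those of independent variables by treating the frequencies in increasing
   order, whatever the order of summation.

   Upper bound. For a step function with dyadic steps, [exp (lam * c (n_k x))] oscillates at scale
   [1 / n_k]. Integrating the product over the finest frequency first, a bound for the integrals over
   all intervals is passed from each frequency to the next coarser one, with a relative error
   [O(lam^2 n_k / n_(k+1))]. This gives moment generating functions, hence tails, for every finite set of
   large indices. Chaining over dyadic cells and dyadic blocks of summation indices controls the
   remaining times, the remaining intervals and, through the variation, all functions of bounded variation.

   Lower bound. For the blocks of summation indices between consecutive powers [2^(p i)] the tilts
   [prod (1 + lam * F_k)], with [F_k] the martingale differences of [c (n_k x)] in the order of the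
   frequencies, have mean 1 and are exactly uncorrelated for disjoint blocks. After truncation a second
   moment argument over the windows [J <= i < 2J] shows that one of the block sums is almost as
   large as possible, outside a set whose measure tends to 0. *)

Require Import Defs.
From Stdlib Require Import Reals Lra Classical ClassicalEpsilon.
From Stdlib Require Import Lia Psatz List ZArith RList.
From Coquelicot Require Import Coquelicot.
Open Scope R_scope.

(** * Finite sums and products *)

(** In the order of summation nothing is left of the lacunary structure: a block of times may use
    frequencies scattered anywhere, and the frequencies of different blocks interlace. Every
    estimate of a block sum is therefore made for an arbitrary finite set of frequencies. The gaps
    enter through errors of relative size 1/q in a quadratic exponent, and every q is available
    beyond some frequency; this is what makes the limit variance exactly that of f.

    No measure theory is built up. A step function of finitely many n_k x depends only on the
    position floor(Q x) for a common multiple Q, so integrals become averages over Q positions and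
    exceptional events are covered by finitely many intervals.

    The lower bound cannot use the products of 1 + lam c(n_k x) directly. Their relative errors add
    up over a block to a multiple of log J in the exponent, while the second moment argument needs
    correlations of 1 + o(1). Martingale differences make the correlations exact, at the price of
    comparing them with c(n_k x) afterwards. *)

Lemma sumN_ext n f g : (forall i, (i < n)%nat -> f i = g i) -> sumN n f = sumN n g.
Proof.
  induction n as [|n IH]; intros H; simpl; [reflexivity|].
  rewrite IH; [rewrite H by lia; reflexivity | intros; apply H; lia].
Qed.

Lemma sumN_plus n f g : sumN n (fun i => f i + g i) = sumN n f + sumN n g.
Proof. induction n; simpl; [lra|rewrite IHn; lra]. Qed.

Lemma sumN_minus n f g : sumN n (fun i => f i - g i) = sumN n f - sumN n g.
Proof. induction n; simpl; [lra|rewrite IHn; lra]. Qed.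

Lemma sumN_scal n c f : sumN n (fun i => c * f i) = c * sumN n f.
Proof. induction n; simpl; [lra|rewrite IHn; lra]. Qed.

Lemma sumN_scal_r n c f : sumN n (fun i => f i * c) = sumN n f * c.
Proof. induction n; simpl; [lra|rewrite IHn; lra]. Qed.

Lemma sumN_opp n f : sumN n (fun i => - f i) = - sumN n f.
Proof. induction n; simpl; [lra|rewrite IHn; lra]. Qed.

Lemma sumN_const n c : sumN n (fun _ => c) = INR n * c.
Proof. induction n; [simpl; lra|]. rewrite S_INR; simpl; rewrite IHn; lra. Qed.

Lemma sumN_zero n f : (forall i, (i < n)%nat -> f i = 0) -> sumN n f = 0.
Proof.
  intros H. rewrite (sumN_ext n f (fun _ => 0)) by assumption.
  rewrite sumN_const; lra.
Qed.

Lemma sumN_le n f g : (forall i, (i < n)%nat -> f i <= g i) -> sumN n f <= sumN n g.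
Proof.
  induction n as [|n IH]; intros H; simpl; [lra|].
  apply Rplus_le_compat; [apply IH; intros; apply H; lia | apply H; lia].
Qed.

Lemma sumN_nonneg n f : (forall i, (i < n)%nat -> 0 <= f i) -> 0 <= sumN n f.
Proof.
  intros H. replace 0 with (sumN n (fun _ => 0)) by (rewrite sumN_const; lra).
  now apply sumN_le.
Qed.

Lemma sumN_le_const n f c : (forall i, (i < n)%nat -> f i <= c) -> sumN n f <= INR n * c.
Proof. intros H. rewrite <- sumN_const. now apply sumN_le. Qed.

Lemma sumN_abs n f : Rabs (sumN n f) <= sumN n (fun i => Rabs (f i)).
Proof.
  induction n as [|n IH]; simpl; [rewrite Rabs_R0; lra|].
  eapply Rle_trans; [apply Rabs_triang|lra].
Qed.

Lemma sumN_add a b f : sumN (a + b) f = sumN a f + sumN b (fun i => f (a + i)%nat).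
Proof.
  induction b as [|b IH]; simpl; [rewrite Nat.add_0_r; lra|].
  rewrite Nat.add_succ_r; simpl; rewrite IH; lra.
Qed.

Lemma sumN_S_l n f : sumN (S n) f = f O + sumN n (fun i => f (S i)).
Proof. induction n as [|n IH]; [simpl; lra|]. simpl in *. rewrite IH. lra. Qed.

Lemma sumN_mono n m f : (forall i, 0 <= f i) -> (n <= m)%nat -> sumN n f <= sumN m f.
Proof.
  intros H Hnm. replace m with (n + (m - n))%nat by lia. rewrite sumN_add.
  assert (0 <= sumN (m - n) (fun i => f (n + i)%nat)) by (apply sumN_nonneg; auto). lra.
Qed.

Lemma sumN_term_le n f k : (forall i, (i < n)%nat -> 0 <= f i) -> (k < n)%nat -> f k <= sumN n f.
Proof.
  induction n as [|n IH]; intros H Hk; [lia|]. simpl.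
  assert (0 <= sumN n f) by (apply sumN_nonneg; intros; apply H; lia).
  destruct (Nat.eq_dec k n) as [->|Hn]; [lra|].
  assert (f k <= sumN n f) by (apply IH; [intros; apply H; lia|lia]).
  assert (0 <= f n) by (apply H; lia). lra.
Qed.

Lemma sumN_swap n m (f : nat -> nat -> R) :
  sumN n (fun i => sumN m (fun j => f i j)) = sumN m (fun j => sumN n (fun i => f i j)).
Proof.
  induction n as [|n IH]; simpl; [rewrite sumN_const; lra|].
  rewrite IH, sumN_plus. reflexivity.
Qed.

Lemma sumN_single n k (f : nat -> R) :
  sumN n (fun i => if Nat.eqb i k then f i else 0) = if Nat.ltb k n then f k else 0.
Proof.
  induction n as [|n IH]; [reflexivity|]. simpl sumN. rewrite IH.
  destruct (Nat.eqb_spec n k) as [->|Hn].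
  - rewrite Nat.ltb_irrefl. destruct (Nat.ltb_spec k (S k)); [lra|lia].
  - destruct (Nat.ltb_spec k n), (Nat.ltb_spec k (S n)); try lra; lia.
Qed.

Lemma sumN_mul K p f :
  sumN (K * p) f = sumN K (fun s => sumN p (fun r => f (s * p + r)%nat)).
Proof.
  induction K as [|K IH]; [reflexivity|].
  replace (S K * p)%nat with (K * p + p)%nat by lia. rewrite sumN_add, IH. reflexivity.
Qed.

(** Cauchy-Schwarz, read off from the nonnegativity of the empirical variance. *)
Lemma sumN_sqr_le n f : (sumN n f) ^ 2 <= INR n * sumN n (fun i => f i ^ 2).
Proof.
  destruct n as [|n]; [simpl; lra|].
  set (N := S n). set (m := sumN N f / INR N).
  assert (HN : 0 < INR N) by (apply lt_0_INR; unfold N; lia).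
  assert (H : 0 <= sumN N (fun i => (f i - m) ^ 2))
    by (apply sumN_nonneg; intros; apply pow2_ge_0).
  rewrite (sumN_ext N _ (fun i => f i ^ 2 - (2 * m) * f i + m ^ 2)) in H
    by (intros; ring).
  rewrite sumN_plus, sumN_minus, sumN_scal, sumN_const in H.
  replace (sumN N f) with (m * INR N) in * by (unfold m; field; lra).
  nra.
Qed.

Lemma sumN_sqr n f : (sumN n f) ^ 2 = sumN n (fun i => sumN n (fun j => f i * f j)).
Proof.
  rewrite (sumN_ext n (fun i => sumN n (fun j => f i * f j)) (fun i => f i * sumN n f))
    by (intros; apply sumN_scal).
  rewrite sumN_scal_r. ring.
Qed.

(** The recursion peels off the first factor, the coarsest scale in the induction on Riesz products;
    [prodf_S_r] peels off the finest one, as the martingale argument needs. *)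
Fixpoint prodf (r : nat) (G : nat -> R) : R :=
  match r with O => 1 | S r' => G O * prodf r' (fun k => G (S k)) end.

Lemma prodf_S_r r G : prodf (S r) G = prodf r G * G r.
Proof.
  revert G; induction r as [|r IH]; intros G; [simpl; ring|].
  change (prodf (S (S r)) G) with (G O * prodf (S r) (fun k => G (S k))).
  rewrite IH. simpl. ring.
Qed.

Lemma prodf_ext r F G : (forall k, (k < r)%nat -> F k = G k) -> prodf r F = prodf r G.
Proof.
  revert F G; induction r as [|r IH]; intros F G H; [reflexivity|]. simpl.
  rewrite (H O) by lia. f_equal. apply IH. intros; apply H; lia.
Qed.

Lemma prodf_nonneg r G : (forall k, (k < r)%nat -> 0 <= G k) -> 0 <= prodf r G.
Proof.
  revert G; induction r as [|r IH]; intros G H; simpl; [lra|].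
  apply Rmult_le_pos; [apply H; lia|apply IH; intros; apply H; lia].
Qed.

Lemma prodf_le r F G :
  (forall k, (k < r)%nat -> 0 <= F k <= G k) -> prodf r F <= prodf r G.
Proof.
  revert F G; induction r as [|r IH]; intros F G H; simpl; [lra|].
  apply Rmult_le_compat; try apply H; try lia.
  - apply prodf_nonneg; intros; apply H; lia.
  - apply IH; intros; apply H; lia.
Qed.

Lemma prodf_mult r F G : prodf r (fun k => F k * G k) = prodf r F * prodf r G.
Proof.
  revert F G; induction r as [|r IH]; intros F G; simpl; [ring|]. rewrite IH. ring.
Qed.

Lemma prodf_exp r a : prodf r (fun k => exp (a k)) = exp (sumN r a).
Proof.
  induction r as [|r IH]; [simpl; now rewrite exp_0|].
  rewrite prodf_S_r, IH. simpl. now rewrite exp_plus.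
Qed.

Lemma exp_le x y : x <= y -> exp x <= exp y.
Proof. intros [H| ->]; [left; now apply exp_increasing|lra]. Qed.

Lemma exp_ge_1x x : 1 + x <= exp x.
Proof.
  destruct (Req_dec x 0) as [->|H]; [rewrite exp_0; lra|].
  left. now apply exp_ineq1.
Qed.

(** * Elementary inequalities *)

Lemma incr_of_deriv (f f' : R -> R) a b :
  a <= b -> (forall c, a <= c <= b -> derivable_pt_lim f c (f' c)) ->
  (forall c, a <= c <= b -> 0 <= f' c) -> f a <= f b.
Proof.
  intros [Hab| ->] Hd Hp; [|lra].
  destruct (MVT_cor2 f f' a b Hab Hd) as [c [Hc Hc2]].
  assert (0 <= f' c) by (apply Hp; lra). nra.
Qed.

Lemma exp_le_cube u : Rabs u <= 1 -> exp u <= 1 + u + u ^ 2 / 2 + Rabs u ^ 3 / 2.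
Proof.
  intros Hu.
  destruct (Rle_dec 0 u) as [H0|H0].
  - rewrite Rabs_pos_eq in * by lra.
    (* Integrating [exp <= 3] three times gives 3/6 = 1/2 as coefficient of the cube. *)
    assert (H3 : forall v, 0 <= v <= 1 -> exp v <= 3).
    { intros v Hv. eapply Rle_trans; [apply exp_le; apply Hv|apply exp_le_3]. }
    assert (H1 : forall v, 0 <= v <= 1 -> exp v <= 1 + 3 * v).
    { intros v Hv.
      assert (1 + 3 * 0 - exp 0 <= 1 + 3 * v - exp v); [|rewrite exp_0 in *; lra].
      apply (incr_of_deriv (fun v => 1 + 3 * v - exp v) (fun v => 3 - exp v)); [lra| |].
      - intros c Hc. apply is_derive_Reals. auto_derive; [trivial|ring].
      - intros c Hc. specialize (H3 c ltac:(lra)). lra. }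
    assert (H2 : forall v, 0 <= v <= 1 -> exp v <= 1 + v + 3 / 2 * v ^ 2).
    { intros v Hv.
      assert (1 + 0 + 3 / 2 * 0 ^ 2 - exp 0 <= 1 + v + 3 / 2 * v ^ 2 - exp v);
        [|rewrite exp_0 in *; lra].
      apply (incr_of_deriv (fun v => 1 + v + 3 / 2 * v ^ 2 - exp v)
               (fun v => 1 + 3 * v - exp v)); [lra| |].
      - intros c Hc. apply is_derive_Reals. auto_derive; [trivial|field].
      - intros c Hc. specialize (H1 c ltac:(lra)). lra. }
    assert (1 + 0 + 0 ^ 2 / 2 + 0 ^ 3 / 2 - exp 0 <= 1 + u + u ^ 2 / 2 + u ^ 3 / 2 - exp u);
      [|rewrite exp_0 in *; lra].
    apply (incr_of_deriv (fun v => 1 + v + v ^ 2 / 2 + v ^ 3 / 2 - exp v)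
             (fun v => 1 + v + 3 / 2 * v ^ 2 - exp v)); [lra| |].
    + intros c Hc. apply is_derive_Reals. auto_derive; [trivial|field].
    + intros c Hc. specialize (H2 c ltac:(lra)). lra.
  - assert (exp u <= 1 + u + u ^ 2 / 2).
    { assert (exp 0 - (1 + 0 + 0 ^ 2 / 2) >= exp u - (1 + u + u ^ 2 / 2));
        [|rewrite exp_0 in *; lra].
      apply Rle_ge.
      apply (incr_of_deriv (fun v => exp v - (1 + v + v ^ 2 / 2)) (fun v => exp v - (1 + v)));
        [lra| |].
      - intros c Hc. apply is_derive_Reals. auto_derive; [trivial|field].
      - intros c Hc. assert (H := exp_ge_1x c). lra. }
    assert (0 <= Rabs u ^ 3) by (apply pow_le, Rabs_pos). lra.
Qed.

Lemma exp_le_sqr u : Rabs u <= 1 -> exp u <= 1 + u + u ^ 2.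
Proof.
  intros Hu. assert (H := exp_le_cube u Hu).
  assert (Rabs u ^ 3 <= u ^ 2).
  { replace (Rabs u ^ 3) with (Rabs u * (Rabs u ^ 2)) by ring.
    rewrite pow2_abs. assert (0 <= u ^ 2) by apply pow2_ge_0. nra. }
  lra.
Qed.

Lemma exp_le_double u : 0 <= u <= 1 -> exp u - 1 <= 2 * u.
Proof.
  intros Hu. assert (H := exp_le_sqr u). rewrite Rabs_pos_eq in H by lra.
  specialize (H ltac:(lra)). nra.
Qed.

Lemma exp_le_1 u : u <= 0 -> exp u <= 1.
Proof. intros H. rewrite <- exp_0. now apply exp_le. Qed.

(** The difference with the cubic Taylor polynomial has a derivative of size |u|^3 / (1 + u), so it
    is monotone on either side of 0. The looser remainder |u|^3 in place of u^3 / 3 serves both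
    signs. *)
Lemma ln_le_cube u : Rabs u <= 1 / 2 -> ln (1 + u) <= u - u ^ 2 / 2 + Rabs u ^ 3.
Proof.
  intros Hu. assert (Hu' : -(1/2) <= u <= 1/2) by (apply Rabs_le_between; exact Hu).
  assert (H : ln (1 + u) <= u - u ^ 2 / 2 + u ^ 3 / 3).
  { destruct (Rle_dec 0 u) as [H0|H0].
    - assert (0 - 0 ^ 2 / 2 + 0 ^ 3 / 3 - ln (1 + 0) <= u - u ^ 2 / 2 + u ^ 3 / 3 - ln (1 + u));
        [|rewrite Rplus_0_r, ln_1 in *; lra].
      apply (incr_of_deriv (fun u => u - u ^ 2 / 2 + u ^ 3 / 3 - ln (1 + u))
               (fun u => u ^ 3 / (1 + u))); [lra| |].
      + intros c Hc. apply is_derive_Reals. auto_derive; [lra|field; lra].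
      + intros c Hc. apply Rdiv_le_0_compat; [apply pow_le; lra|lra].
    - assert (ln (1 + u) - (u - u ^ 2 / 2 + u ^ 3 / 3) <= ln (1 + 0) - (0 - 0 ^ 2 / 2 + 0 ^ 3 / 3));
        [|rewrite Rplus_0_r, ln_1 in *; lra].
      apply (incr_of_deriv (fun u => ln (1 + u) - (u - u ^ 2 / 2 + u ^ 3 / 3))
               (fun u => (- u) ^ 3 / (1 + u))); [lra| |].
      + intros c Hc. apply is_derive_Reals. auto_derive; [lra|field; lra].
      + intros c Hc. apply Rdiv_le_0_compat; [apply pow_le; lra|lra]. }
  assert (u ^ 3 <= Rabs u ^ 3) by (rewrite RPow_abs; apply Rle_abs).
  assert (0 <= Rabs u ^ 3) by (apply pow_le, Rabs_pos). lra.
Qed.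

(** * Null sets *)

Definition total (l : list (R * R)) : R := fold_right (fun ab s => snd ab - fst ab + s) 0 l.

Definition covered (l : list (R * R)) (x : R) : Prop :=
  exists ab, In ab l /\ fst ab < x < snd ab.

(** Outer measure at most [p], witnessed by a finite cover. Finite covers suffice because each
    exceptional event at a fixed stage is contained in finitely many cells of length 1/Q. *)
Definition small (E : R -> Prop) (p : R) : Prop :=
  exists l, (forall ab, In ab l -> fst ab <= snd ab) /\
    (forall x, E x -> covered l x) /\ total l <= p.

Lemma total_app l1 l2 : total (l1 ++ l2) = total l1 + total l2.
Proof. induction l1 as [|a l1 IH]; simpl; [lra|rewrite IH; lra]. Qed.

Lemma total_sum l : total l = sumN (length l) (fun k => snd (nth k l (0, 0)) - fst (nth k l (0, 0))).
Proof.
  induction l as [|a l IH]; [reflexivity|].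
  change (length (a :: l)) with (S (length l)). rewrite sumN_S_l. simpl. rewrite IH. reflexivity.
Qed.

Lemma small_sub (E F : R -> Prop) p q :
  small F q -> (forall x, E x -> F x) -> q <= p -> small E p.
Proof.
  intros [l [H1 [H2 H3]]] HE Hp. exists l. repeat split; auto. lra.
Qed.

Lemma small_empty E p : (forall x, ~ E x) -> 0 <= p -> small E p.
Proof.
  intros H Hp. exists nil. split; [intros ab []|]. split; [intros x Hx; now destruct (H x)|].
  simpl; lra.
Qed.

Lemma small_or E F p q : small E p -> small F q -> small (fun x => E x \/ F x) (p + q).
Proof.
  intros [l [H1 [H2 H3]]] [l' [H1' [H2' H3']]]. exists (l ++ l'). repeat split.
  - intros ab H. apply in_app_or in H. destruct H; auto.
  - intros x [H|H].
    + destruct (H2 x H) as [ab [A B]]. exists ab. split; [apply in_or_app; now left|exact B].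
    + destruct (H2' x H) as [ab [A B]]. exists ab. split; [apply in_or_app; now right|exact B].
  - rewrite total_app. lra.
Qed.

Lemma small_bigor n (E : nat -> R -> Prop) p :
  (forall i, (i < n)%nat -> small (E i) (p i)) ->
  small (fun x => exists i, (i < n)%nat /\ E i x) (sumN n p).
Proof.
  induction n as [|n IH]; intros H.
  - apply small_empty; [intros x [i [Hi _]]; lia|simpl; lra].
  - eapply small_sub; [apply small_or; [apply IH; intros; apply H; lia|apply (H n); lia]| |simpl; lra].
    intros x [i [Hi Hx]]. destruct (Nat.eq_dec i n) as [->|Hn]; [now right|left; exists i; split; [lia|assumption]].
Qed.

Lemma small_bigor_const n (E : nat -> R -> Prop) p :
  (forall i, (i < n)%nat -> small (E i) p) ->
  small (fun x => exists i, (i < n)%nat /\ E i x) (INR n * p).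
Proof. intros H. rewrite <- sumN_const. now apply small_bigor. Qed.

Lemma null_of_lists (E : R -> Prop) :
  (forall eps, eps > 0 -> exists l : nat -> list (R * R),
     (forall j ab, In ab (l j) -> fst ab <= snd ab) /\
     (forall x, E x -> exists j, covered (l j) x) /\
     (forall J, sumN J (fun j => total (l j)) <= eps)) ->
  null_set E.
Proof.
  intros H eps Heps. destruct (H eps Heps) as [l [H1 [H2 H3]]].
  (* A degenerate interval in front of every list makes the k-th entry of the concatenation of
     the first J lists well defined as soon as k < J. *)
  set (cc := fix cc J := match J with O => nil | S J' => cc J' ++ ((0,0) :: l J') end).
  assert (Hlen : forall J, (J <= length (cc J))%nat).
  { induction J as [|J IH]; simpl; [lia|]. rewrite length_app. simpl. lia. }
  assert (Hpre : forall J d, exists r, cc (J + d)%nat = cc J ++ r).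
  { intros J d. induction d as [|d [r Hr]]; [exists nil; rewrite Nat.add_0_r, app_nil_r; reflexivity|].
    rewrite Nat.add_succ_r. simpl. rewrite Hr. eexists. rewrite <- app_assoc. reflexivity. }
  assert (Hnth : forall J k, (k < length (cc J))%nat -> nth k (cc J) (0,0) = nth k (cc (S k)) (0,0)).
  { intros J k Hk. destruct (le_lt_dec (S k) J) as [HJ|HJ].
    - destruct (Hpre (S k) (J - S k)%nat) as [r Hr].
      replace (S k + (J - S k))%nat with J in Hr by lia. rewrite Hr.
      apply app_nth1. specialize (Hlen (S k)). lia.
    - destruct (Hpre J (S k - J)%nat) as [r Hr].
      replace (J + (S k - J))%nat with (S k) in Hr by lia. rewrite Hr.
      symmetry. now apply app_nth1. }
  assert (Hval : forall J ab, In ab (cc J) -> fst ab <= snd ab).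
  { induction J as [|J IH]; simpl; [intros ab []|]. intros ab Hab.
    apply in_app_or in Hab. destruct Hab as [Hab|[Hab|Hab]]; [auto|subst; simpl; lra|eauto]. }
  assert (Htot : forall J, total (cc J) = sumN J (fun j => total (l j))).
  { induction J as [|J IH]; simpl; [reflexivity|]. rewrite total_app, IH. simpl. lra. }
  exists (fun k => fst (nth k (cc (S k)) (0,0))), (fun k => snd (nth k (cc (S k)) (0,0))).
  repeat split.
  - intros k. apply (Hval (S k)). apply nth_In. specialize (Hlen (S k)). lia.
  - intros x Hx. destruct (H2 x Hx) as [j [ab [Hin Hab]]].
    assert (Hin' : In ab (cc (S j))) by (simpl; apply in_or_app; right; now right).
    destruct (In_nth _ _ (0,0) Hin') as [k [Hk Hnk]]. exists k.
    rewrite <- (Hnth (S j) k Hk), Hnk. exact Hab.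
  - intros m.
    assert (Hs : forall n f, sum_f_R0 f n = sumN (S n) f).
    { induction n as [|n IH]; intros f; simpl; [lra|]. rewrite IH. reflexivity. }
    rewrite Hs.
    rewrite (sumN_ext (S m) _ (fun k => snd (nth k (cc (S m)) (0,0)) - fst (nth k (cc (S m)) (0,0)))).
    2:{ intros k Hk. rewrite (Hnth (S m) k); [reflexivity|]. specialize (Hlen (S m)). lia. }
    eapply Rle_trans; [|apply (H3 (S m))]. rewrite <- Htot, total_sum.
    replace (length (cc (S m))) with (S m + (length (cc (S m)) - S m))%nat
      by (specialize (Hlen (S m)); lia).
    rewrite sumN_add.
    assert (0 <= sumN (length (cc (S m)) - S m)
      (fun i => snd (nth (S m + i) (cc (S m)) (0, 0)) - fst (nth (S m + i) (cc (S m)) (0, 0)))); [|lra].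
    apply sumN_nonneg. intros i Hi.
    assert (fst (nth (S m + i) (cc (S m)) (0, 0)) <= snd (nth (S m + i) (cc (S m)) (0, 0))); [|lra].
    apply (Hval (S m)), nth_In. lia.
Qed.

Lemma null_sub (E F : R -> Prop) : null_set F -> (forall x, E x -> F x) -> null_set E.
Proof.
  intros H HE eps He. destruct (H eps He) as [a [b [H1 [H2 H3]]]].
  exists a, b. repeat split; auto.
Qed.

Lemma null_of_small (E : R -> Prop) :
  (forall eps, eps > 0 -> small E eps) -> null_set E.
Proof.
  intros H. apply null_of_lists. intros eps He. destruct (H eps He) as [l0 [H1 [H2 H3]]].
  exists (fun j => match j with O => l0 | _ => nil end). repeat split.
  - intros [|j] ab; [apply H1|intros []].
  - intros x Hx. exists O. auto.
  - intros [|J]; [simpl; lra|]. rewrite sumN_S_l. simpl. rewrite sumN_zero; [lra|auto].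
Qed.

(** The first Borel-Cantelli lemma. Convergence of the series is stated through its tails, since the
    tails are what gets covered. *)
Lemma null_limsup (E : nat -> R -> Prop) (p : nat -> R) :
  (forall eps, eps > 0 -> exists J, forall J', (J <= J')%nat ->
     forall M, sumN M (fun j => p (J' + j)%nat) <= eps) ->
  (exists j0, forall j, (j0 <= j)%nat -> small (E j) (p j)) ->
  null_set (fun x => forall J, exists j, (J <= j)%nat /\ E j x).
Proof.
  intros Hp [j0 Hs]. apply null_of_lists. intros eps He. destruct (Hp eps He) as [J HJ].
  set (J' := Nat.max J j0).
  assert (Hl : forall j, small (E (J' + j)%nat) (p (J' + j)%nat)) by (intros; apply Hs; lia).
  pose (l := fun j => proj1_sig (constructive_indefinite_description _ (Hl j))).
  assert (Hl' : forall j, (forall ab, In ab (l j) -> fst ab <= snd ab) /\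
    (forall x, E (J' + j)%nat x -> covered (l j) x) /\ total (l j) <= p (J' + j)%nat).
  { intros j. unfold l. destruct (constructive_indefinite_description _ (Hl j)) as [l' Hl'].
    exact Hl'. }
  exists l. repeat split.
  - intros j ab. apply (Hl' j).
  - intros x Hx. destruct (Hx J') as [j [Hj Ej]]. exists (j - J')%nat. apply (Hl' (j - J')%nat).
    now replace (J' + (j - J'))%nat with j by lia.
  - intros M. eapply Rle_trans; [apply sumN_le; intros; apply Hl'|]. apply HJ. lia.
Qed.

Lemma geom_sum_le (n : nat) : sumN n (fun r => (/ 2) ^ S r) <= 1.
Proof.
  assert (H : sumN n (fun r => (/ 2) ^ S r) = 1 - (/ 2) ^ n).
  { induction n as [|n IH]; [simpl; lra|]. simpl in *. rewrite IH. field. }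
  rewrite H. assert (0 < (/ 2) ^ n) by (apply pow_lt; lra). lra.
Qed.

Lemma null_union (E : nat -> R -> Prop) :
  (forall r, null_set (E r)) -> null_set (fun x => exists r, E r x).
Proof.
  intros H. apply null_of_lists. intros eps He.
  assert (Hr : forall r, exists ab : (nat -> R) * (nat -> R),
    (forall k, fst ab k <= snd ab k) /\
    (forall x, E r x -> exists k, fst ab k < x < snd ab k) /\
    (forall m, sum_f_R0 (fun k => snd ab k - fst ab k) m <= eps * (/ 2) ^ S r)).
  { intros r. assert (He' : eps * (/ 2) ^ S r > 0).
    { apply Rmult_gt_0_compat; [lra|apply pow_lt; lra]. }
    destruct (H r _ He') as [a [b Hab]]. exists (a, b). exact Hab. }
  pose (ab := fun r => proj1_sig (constructive_indefinite_description _ (Hr r))).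
  assert (Hab : forall r, (forall k, fst (ab r) k <= snd (ab r) k) /\
    (forall x, E r x -> exists k, fst (ab r) k < x < snd (ab r) k) /\
    (forall m, sum_f_R0 (fun k => snd (ab r) k - fst (ab r) k) m <= eps * (/ 2) ^ S r)).
  { intros r. unfold ab. destruct (constructive_indefinite_description _ (Hr r)) as [y Hy]. exact Hy. }
  clearbody ab.
  (* Cantor's diagonal order: the list of index [j] collects the intervals whose set and position
     add up to [j]. *)
  pose (l := fun j => map (fun r => (fst (ab r) (j - r)%nat, snd (ab r) (j - r)%nat)) (seq 0 (S j))).
  exists l. repeat split.
  - intros j p Hin. apply in_map_iff in Hin. destruct Hin as [r [<- _]]. apply Hab.
  - intros x [r Hx]. destruct (proj1 (proj2 (Hab r)) x Hx) as [k Hk].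
    exists (r + k)%nat. exists (fst (ab r) k, snd (ab r) k). split; [|exact Hk].
    apply in_map_iff. exists r. split; [now replace (r + k - r)%nat with k by lia|].
    apply in_seq. lia.
  - assert (Htot : forall j, total (l j) =
      sumN (S j) (fun r => snd (ab r) (j - r)%nat - fst (ab r) (j - r)%nat)).
    { intros j. unfold l.
      set (f := fun r => (fst (ab r) (j - r)%nat, snd (ab r) (j - r)%nat)).
      rewrite total_sum, length_map, length_seq. apply sumN_ext. intros r Hrj.
      rewrite (nth_indep _ (0, 0) (f O))
        by (rewrite length_map, length_seq; assumption).
      rewrite map_nth, seq_nth by assumption. reflexivity. }
    (* Both sides sum over the triangle r + k < J; taken by rows, every set contributes a partial
       sum of its own cover. *)
    assert (Hd : forall J (g : nat -> nat -> R), sumN J (fun j => sumN (S j) (fun r => g r (j - r)%nat))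
      = sumN J (fun r => sumN (J - r) (fun k => g r k))).
    { intros J g. induction J as [|J IH]; [reflexivity|].
      change (sumN (S J) (fun j => sumN (S j) (fun r => g r (j - r)%nat))) with
        (sumN J (fun j => sumN (S j) (fun r => g r (j - r)%nat)) + sumN (S J) (fun r => g r (J - r)%nat)).
      rewrite IH. simpl sumN at 2.
      change (sumN (S J) (fun r => sumN (S J - r) (fun k => g r k))) with
        (sumN J (fun r => sumN (S J - r) (fun k => g r k)) + sumN (S J - J) (fun k => g J k)).
      replace (S J - J)%nat with 1%nat by lia.
      rewrite (sumN_ext J (fun r => sumN (S J - r) (fun k => g r k))
        (fun r => sumN (J - r) (fun k => g r k) + g r (J - r)%nat)).
      2:{ intros r Hrj. replace (S J - r)%nat with (S (J - r)) by lia. reflexivity. }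
      rewrite sumN_plus. simpl. replace (J - J)%nat with O by lia. lra. }
    intros J. rewrite (sumN_ext J _ _ (fun j _ => Htot j)).
    rewrite (Hd J (fun r k => snd (ab r) k - fst (ab r) k)).
    eapply Rle_trans; [apply (sumN_le J _ (fun r => eps * (/ 2) ^ S r))|].
    + intros r Hrj. destruct (J - r)%nat as [|m] eqn:Hm; [lia|].
      assert (Hs : forall n f, sum_f_R0 f n = sumN (S n) f).
      { induction n as [|n IH]; intros f; simpl; [lra|]. rewrite IH. reflexivity. }
      rewrite <- Hs. apply Hab.
    + rewrite sumN_scal. assert (HH := geom_sum_le J). nra.
Qed.

Lemma null_or (E F : R -> Prop) : null_set E -> null_set F -> null_set (fun x => E x \/ F x).
Proof.
  intros HE HF.
  apply null_sub with (fun x => exists r, (match r with O => E | _ => F end) x).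
  - apply null_union. intros [|r]; assumption.
  - intros x [H|H]; [now exists O|now exists 1%nat].
Qed.

Lemma ae_and P Q : ae01 P -> ae01 Q -> ae01 (fun x => P x /\ Q x).
Proof.
  intros HP HQ. eapply null_sub; [apply (null_or _ _ HP HQ)|].
  intros x [Hx H]. apply not_and_or in H. tauto.
Qed.

Lemma ae_forall (P : nat -> R -> Prop) : (forall r, ae01 (P r)) -> ae01 (fun x => forall r, P r x).
Proof.
  intros H. eapply null_sub; [apply (null_union _ H)|].
  intros x [Hx Hn]. apply not_all_ex_not in Hn. destruct Hn as [r Hr]. now exists r.
Qed.

Lemma ae_impl (P Q : R -> Prop) : ae01 P -> (forall x, 0 < x < 1 -> P x -> Q x) -> ae01 Q.
Proof.
  intros H HPQ. eapply null_sub; [apply H|]. intros x [Hx Hn]. split; [exact Hx|].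
  intros Hp. apply Hn. now apply HPQ.
Qed.

Lemma ae_limsup (E : nat -> R -> Prop) (p : nat -> R) :
  (forall eps, eps > 0 -> exists J, forall J', (J <= J')%nat ->
     forall M, sumN M (fun j => p (J' + j)%nat) <= eps) ->
  (exists j0, forall j, (j0 <= j)%nat -> small (fun x => 0 < x < 1 /\ E j x) (p j)) ->
  ae01 (fun x => exists J, forall j, (J <= j)%nat -> ~ E j x).
Proof.
  intros Hp Hs. eapply null_sub; [apply (null_limsup _ _ Hp Hs)|].
  intros x [Hx Hn] J. apply NNPP. intros H. apply Hn. exists J. intros j Hj Ej. apply H.
  exists j. auto.
Qed.

(** * Integer positions and Markov's inequality *)

Definition nat_floor (y : R) : nat := Z.to_nat (Int_part y).

Lemma nat_floor_spec y : 0 <= y -> INR (nat_floor y) <= y < INR (nat_floor y) + 1.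
Proof.
  intros Hy. unfold nat_floor. destruct (base_Int_part y) as [H1 H2].
  assert (0 <= Int_part y)%Z.
  { apply le_IZR. destruct (Z_lt_le_dec (Int_part y) 0) as [H|H].
    - assert (Int_part y <= -1)%Z by lia. apply IZR_le in H0. lra.
    - now apply IZR_le. }
  rewrite INR_IZR_INZ, Z2Nat.id by assumption. lra.
Qed.

Lemma nat_floor_unique y m : INR m <= y < INR m + 1 -> nat_floor y = m.
Proof.
  intros H. assert (0 <= y) by (assert (0 <= INR m) by apply pos_INR; lra).
  assert (H' := nat_floor_spec y H0).
  assert (m < S (nat_floor y))%nat by (apply INR_lt; rewrite S_INR; lra).
  assert (nat_floor y < S m)%nat by (apply INR_lt; rewrite S_INR; lra). lia.
Qed.

Lemma nat_floor_div y (p : nat) : 0 <= y -> (0 < p)%nat -> nat_floor (y / INR p) = (nat_floor y / p)%nat.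
Proof.
  intros Hy Hp. assert (Hp' : 0 < INR p) by now apply lt_0_INR.
  apply nat_floor_unique. assert (H := nat_floor_spec y Hy).
  assert (Hd := Nat.div_mod_eq (nat_floor y) p). assert (Hm := Nat.mod_upper_bound (nat_floor y) p ltac:(lia)).
  set (q := (nat_floor y / p)%nat) in *. set (r := (nat_floor y mod p)%nat) in *.
  assert (E : INR (nat_floor y) = INR p * INR q + INR r) by (rewrite Hd, plus_INR, mult_INR; reflexivity).
  assert (INR r + 1 <= INR p) by (rewrite <- S_INR; apply le_INR; lia).
  assert (0 <= INR r) by apply pos_INR.
  split.
  - apply Rmult_le_reg_r with (INR p); [assumption|]. unfold Rdiv.
    rewrite Rmult_assoc, Rinv_l, Rmult_1_r by lra. nra.
  - apply Rmult_lt_reg_r with (INR p); [assumption|]. unfold Rdiv.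
    rewrite Rmult_assoc, Rinv_l, Rmult_1_r by lra. nra.
Qed.

(** Markov's inequality for an event seen through the position floor(Q x). The position cells are
    half-open and the cover must be open, so each cell is enlarged to twice its length, whence the
    factor 2. *)
Lemma small_of_markov (Q : nat) (phi : nat -> R) (E : R -> Prop) (p : R) :
  (0 < Q)%nat -> (forall i, 0 <= phi i) ->
  (forall x, 0 < x < 1 -> E x -> 1 <= phi (nat_floor (INR Q * x))) ->
  sumN Q phi <= p * INR Q ->
  small (fun x => 0 < x < 1 /\ E x) (2 * p).
Proof.
  intros HQ Hphi HE Hs. assert (HQ' : 0 < INR Q) by now apply lt_0_INR.
  pose (iv := fun i => (INR i / INR Q - / (2 * INR Q), INR i / INR Q + 3 / (2 * INR Q))).
  assert (Hiv : forall i, snd (iv i) - fst (iv i) = 2 / INR Q) by (intros; unfold iv; simpl; field; lra).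
  assert (HiQ : 0 < / INR Q) by now apply Rinv_0_lt_compat.
  pose (l := fix l n := match n with O => nil | S n' =>
     if Rle_dec 1 (phi n') then iv n' :: l n' else l n' end).
  assert (Hl : forall n, total (l n) <= 2 / INR Q * sumN n phi).
  { induction n as [|n IH]; [simpl; lra|]. simpl. specialize (Hphi n).
    destruct (Rle_dec 1 (phi n)) as [H1|H1].
    - change (total (iv n :: l n)) with (snd (iv n) - fst (iv n) + total (l n)). rewrite Hiv.
      unfold Rdiv in *. nra.
    - unfold Rdiv in *. nra. }
  assert (Hin : forall n i, (i < n)%nat -> 1 <= phi i -> In (iv i) (l n)).
  { induction n as [|n IH]; intros i Hi H1; [lia|]. simpl.
    destruct (Nat.eq_dec i n) as [->|Hn].
    - destruct (Rle_dec 1 (phi n)); [now left|contradiction].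
    - assert (In (iv i) (l n)) by (apply IH; [lia|assumption]).
      destruct (Rle_dec 1 (phi n)); [now right|assumption]. }
  exists (l Q). repeat split.
  - assert (Hg : forall n ab, In ab (l n) -> exists i, ab = iv i).
    { induction n as [|n IH]; simpl; [intros ab []|]. intros ab.
      destruct (Rle_dec 1 (phi n)); [|apply IH]. intros [<-|H]; [now exists n|auto]. }
    intros ab Hab. destruct (Hg _ _ Hab) as [i ->]. specialize (Hiv i).
    assert (0 < 2 / INR Q) by (apply Rdiv_lt_0_compat; lra). lra.
  - intros x [Hx Ex]. assert (Hy : 0 <= INR Q * x) by nra. assert (Hf := nat_floor_spec _ Hy).
    exists (iv (nat_floor (INR Q * x))). split.
    + apply Hin; [|now apply HE]. apply INR_lt. nra.
    + unfold iv; simpl. set (m := INR (nat_floor (INR Q * x))) in *.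
      replace x with (INR Q * x / INR Q) by (field; lra).
      replace (/ (2 * INR Q)) with (/ 2 * / INR Q) by (field; lra).
      replace (3 / (2 * INR Q)) with (3 / 2 * / INR Q) by (field; lra).
      unfold Rdiv. split; nra.
  - eapply Rle_trans; [apply Hl|].
    replace (2 * p) with (2 / INR Q * (p * INR Q)) by (field; lra).
    apply Rmult_le_compat_l; [|assumption]. apply Rlt_le, Rdiv_lt_0_compat; lra.
Qed.

(** * Products of functions oscillating on well separated scales *)

(** Density at most [m] on every window, up to the weight of [e] extra positions at its ends. All
    windows are required because the periods of different frequencies need not divide one
    another. *)
Definition interval_bound (w : nat -> R) (m e : R) : Prop :=
  forall a L, sumN L (fun i => w (a + i)%nat) <= m * (INR L + e).

(** The increment that leads out of the last position of the window is included, which makes the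
    variation additive over adjacent windows. *)
Definition total_var (g : nat -> R) (a L : nat) : R :=
  sumN L (fun i => Rabs (g (a + i + 1)%nat - g (a + i)%nat)).

Lemma total_var_nonneg g a L : 0 <= total_var g a L.
Proof. apply sumN_nonneg; intros; apply Rabs_pos. Qed.

Lemma total_var_add g a L1 L2 : total_var g a (L1 + L2) = total_var g a L1 + total_var g (a + L1) L2.
Proof.
  unfold total_var. rewrite sumN_add. f_equal. apply sumN_ext. intros i _. now rewrite !Nat.add_assoc.
Qed.

Lemma argmin_range (g : nat -> R) L : (0 < L)%nat ->
  exists i0, (i0 < L)%nat /\ forall i, (i < L)%nat -> g i0 <= g i.
Proof.
  induction L as [|L IH]; intros H; [lia|]. destruct L as [|L].
  - exists O. split; [lia|]. intros i Hi. replace i with O by lia. lra.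
  - destruct (IH ltac:(lia)) as [i0 [H0 H1]].
    destruct (Rle_dec (g i0) (g (S L))) as [Hc|Hc].
    + exists i0. split; [lia|]. intros i Hi. destruct (Nat.eq_dec i (S L)) as [->|]; [assumption|apply H1; lia].
    + exists (S L). split; [lia|]. intros i Hi.
      destruct (Nat.eq_dec i (S L)) as [->|]; [lra|]. specialize (H1 i ltac:(lia)). lra.
Qed.

(* Layer-cake: cutting at a minimum of [g] splits off a constant layer, and every layer of [g] on
   the window is a union of intervals whose number is controlled by the variation of [g]. Only
   upper bounds for the interval sums of [w] are available, which is why no Abel summation is used. *)
Lemma weighted_sum_le (w : nat -> R) (m e : R) :
  (forall i, 0 <= w i) -> 0 <= m -> 0 <= e -> interval_bound w m e ->
  forall L a (g : nat -> R), (0 < L)%nat -> (forall i, (i < L)%nat -> 0 <= g (a + i)%nat) ->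
  sumN L (fun i => g (a + i)%nat * w (a + i)%nat)
    <= m * (sumN L (fun i => g (a + i)%nat) + e * (g a + total_var g a L)).
Proof.
  intros Hw Hm He HI L. induction L as [L IH] using lt_wf_ind. intros a g HL Hg.
  destruct (argmin_range (fun i => g (a + i)%nat) L HL) as [i0 [Hi0 Hmin]].
  set (mu := g (a + i0)%nat) in *.
  assert (Hmu : 0 <= mu) by (apply Hg; assumption).
  set (g' := fun i => g i - mu).
  assert (HTV : forall b l, total_var g' b l = total_var g b l).
  { intros. unfold total_var, g'. apply sumN_ext. intros. f_equal. ring. }
  set (L2 := (L - i0 - 1)%nat). set (b := (a + (i0 + 1))%nat).
  assert (HLs : L = (i0 + (1 + L2))%nat) by (unfold L2; lia).
  assert (Hleft : sumN i0 (fun i => g' (a + i)%nat * w (a + i)%nat)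
     <= m * (sumN i0 (fun i => g' (a + i)%nat) + e * (g a - mu + total_var g a i0))).
  { destruct i0 as [|i0].
    - simpl. unfold total_var. simpl. unfold mu. rewrite Nat.add_0_r. nra.
    - rewrite <- HTV. apply (IH (S i0) ltac:(lia) a g'); [lia|].
      intros i Hi. unfold g'. specialize (Hmin i ltac:(lia)). simpl in Hmin. lra. }
  assert (Hright : sumN L2 (fun i => g' (b + i)%nat * w (b + i)%nat)
     <= m * (sumN L2 (fun i => g' (b + i)%nat) + e * (Rabs (g b - mu) + total_var g b L2))).
  { destruct L2 as [|l2] eqn:E2.
    - simpl. assert (0 <= Rabs (g b - mu)) by apply Rabs_pos. unfold total_var. simpl.
      assert (0 <= e * (Rabs (g b - mu) + 0)) by nra. nra.
    - eapply Rle_trans; [apply (IH (S l2) ltac:(lia) b g'); [lia|]|].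
      + intros i Hi. unfold g', b. rewrite <- Nat.add_assoc.
        specialize (Hmin (i0 + 1 + i)%nat ltac:(lia)). simpl in Hmin. lra.
      + rewrite HTV. apply Rmult_le_compat_l; [assumption|]. apply Rplus_le_compat_l.
        apply Rmult_le_compat_l; [assumption|]. apply Rplus_le_compat_r. apply Rle_abs. }
  (* Bookkeeping of the boundary terms: [mu] for the bottom layer, g a - mu on the left and the jump
     |g b - mu| on the right, together with the variations of both pieces, add up to exactly g a
     plus the variation. *)
  assert (HTVs : total_var g a L = total_var g a i0 + Rabs (g b - mu) + total_var g b L2).
  { rewrite HLs at 1. rewrite total_var_add. rewrite (total_var_add g (a + i0) 1 L2).
    replace (a + i0 + 1)%nat with b by (unfold b; lia).
    unfold total_var at 2. simpl. rewrite Nat.add_0_r.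
    replace (a + i0 + 1)%nat with b by (unfold b; lia). unfold mu. lra. }
  assert (Hsplit : forall h : nat -> R, sumN L (fun i => h (a + i)%nat)
     = sumN i0 (fun i => h (a + i)%nat) + h (a + i0)%nat + sumN L2 (fun i => h (b + i)%nat)).
  { intros h. rewrite HLs at 1. rewrite sumN_add, (sumN_add 1 L2). simpl. rewrite Nat.add_0_r.
    rewrite (sumN_ext L2 (fun i => h (a + (i0 + S i))%nat) (fun i => h (b + i)%nat))
      by (intros; f_equal; unfold b; lia). lra. }
  assert (HW := HI a L).
  assert (Hdec : forall h : nat -> R, sumN L (fun i => g (a + i)%nat * h (a + i)%nat) =
     mu * sumN L (fun i => h (a + i)%nat) + sumN L (fun i => g' (a + i)%nat * h (a + i)%nat)).
  { intros h. rewrite <- sumN_scal, <- sumN_plus. apply sumN_ext. intros. unfold g'. ring. }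
  rewrite (Hdec w).
  rewrite (Hsplit (fun i => g' i * w i)). cbv beta.
  assert (Hz : g' (a + i0)%nat = 0) by (unfold g', mu; ring). rewrite Hz.
  assert (Hs1 : sumN L (fun i => g (a + i)%nat) = mu * INR L
     + sumN i0 (fun i => g' (a + i)%nat) + sumN L2 (fun i => g' (b + i)%nat)).
  { assert (Hd1 := Hdec (fun _ => 1)). cbv beta in Hd1. rewrite sumN_const in Hd1.
    rewrite (sumN_ext L (fun i => g (a + i)%nat) (fun i => g (a + i)%nat * 1)) by (intros; ring).
    rewrite Hd1. rewrite (sumN_ext L (fun i => g' (a + i)%nat * 1) (fun i => g' (a + i)%nat)) by (intros; ring).
    rewrite (Hsplit g'), Hz. ring. }
  rewrite Hs1, HTVs.
  assert (mu * sumN L (fun i => w (a + i)%nat) <= mu * (m * (INR L + e)))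
    by (apply Rmult_le_compat_l; assumption).
  lra.
Qed.

(* What is needed of one factor [g], oscillating at scale [P], in order to multiply it into a product
   of finer factors: no term of order [L] other than [M * L] may appear in the window sums. *)
Definition tame (g : nat -> R) (P : nat) (M D V : R) : Prop :=
  (forall i, 0 <= g i <= 3 / 2) /\
  (forall a L, total_var g a L <= V * (INR L / INR P + 1)) /\
  (forall a L, sumN L (fun i => g (a + i)%nat) <= M * INR L + INR P * D).

(* The factors are ordered from the coarsest scale to the finest one; the scales need not divide one
   another. The relative error [4 * D * V k / q] is quadratic in the tilt, since [D] and [V] are
   both linear in it. *)
Lemma riesz_product_bound (q D : R) : 8 <= q -> 0 <= D ->
  forall (r : nat) (g : nat -> nat -> R) (P : nat -> nat) (M V : nat -> R),
  (forall k, (k < r)%nat -> (0 < P k)%nat /\ tame (g k) (P k) (M k) D (V k) /\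
     1 / 2 <= M k /\ 0 <= V k <= 1 / 4) ->
  (forall k, (S k < r)%nat -> q * INR (P (S k)) <= INR (P k)) ->
  interval_bound (fun i => prodf r (fun k => g k i)) (prodf r (fun k => M k + 4 * D * V k / q))
     (4 * D * INR (P O)).
Proof.
  intros Hq HD r. induction r as [|r IH]; intros g P M V Hg HP.
  - intros a L. simpl. rewrite sumN_const.
    assert (0 <= 4 * D * INR (P O)) by (apply Rmult_le_pos; [lra|apply pos_INR]). lra.
  - destruct (Hg O ltac:(lia)) as [HP0 [[Hg1 [Hg2 Hg3]] [HM HV]]].
    assert (HP0' : 0 < INR (P O)) by now apply lt_0_INR.
    set (w := fun i => prodf r (fun k => g (S k) i)).
    set (m := prodf r (fun k => M (S k) + 4 * D * V (S k) / q)).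
    assert (Hm : 0 <= m).
    { apply prodf_nonneg. intros k Hk. destruct (Hg (S k) ltac:(lia)) as [_ [_ [A B]]].
      assert (0 <= 4 * D * V (S k) / q) by (apply Rdiv_le_0_compat; nra). lra. }
    assert (Hw : forall i, 0 <= w i).
    { intros i. apply prodf_nonneg. intros k Hk. apply (Hg (S k) ltac:(lia)). }
    (* The product of the finer factors has a boundary cost smaller by the factor q than the one
       allowed at the present scale; if there is no finer factor it is exact. *)
    assert (HIB : exists e, 0 <= e /\ e * q <= 4 * D * INR (P O) /\ interval_bound w m e).
    { destruct r as [|r].
      - exists 0. repeat split; [lra|nra|]. intros a L. unfold w, m. simpl. rewrite sumN_const. lra.
      - exists (4 * D * INR (P 1%nat)). assert (0 <= INR (P 1%nat)) by apply pos_INR.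
        repeat split; [nra| |].
        + specialize (HP O ltac:(lia)). nra.
        + apply (IH (fun k => g (S k)) (fun k => P (S k)) (fun k => M (S k)) (fun k => V (S k))).
          * intros k Hk. apply Hg. lia.
          * intros k Hk. apply HP. lia. }
    destruct HIB as [e [He [Heq HI]]].
    intros a L. simpl prodf. fold w m.
    change (sumN L (fun i => g O (a + i)%nat * w (a + i)%nat) <=
      (M O + 4 * D * V O / q) * m * (INR L + 4 * D * INR (P O))).
    assert (H4 : 0 <= 4 * D * V O / q) by (apply Rdiv_le_0_compat; nra).
    destruct L as [|L].
    + simpl. apply Rmult_le_pos; [apply Rmult_le_pos; lra|]. assert (0 <= D * INR (P O)) by nra. lra.
    + set (L' := S L) in *.
      eapply Rle_trans; [apply (weighted_sum_le w m e Hw Hm He HI); [unfold L'; lia|intros; apply Hg1]|].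
      specialize (Hg2 a L'). specialize (Hg3 a L'). assert (Hga := proj2 (Hg1 a)).
      assert (HL : 0 <= INR L') by apply pos_INR.
      assert (Hx : 0 <= INR L' / INR (P O)) by (apply Rdiv_le_0_compat; assumption).
      rewrite (Rmult_comm _ m), Rmult_assoc. apply Rmult_le_compat_l; [assumption|].
      assert (HA : e * (V O * (INR L' / INR (P O))) <= 4 * D * V O / q * INR L').
      { replace (e * (V O * (INR L' / INR (P O)))) with ((e * q) * (V O * INR L' / (q * INR (P O))))
          by (field; lra).
        replace (4 * D * V O / q * INR L') with ((4 * D * INR (P O)) * (V O * INR L' / (q * INR (P O))))
          by (field; lra).
        apply Rmult_le_compat_r; [|assumption].
        apply Rdiv_le_0_compat; [nra|apply Rmult_lt_0_compat; lra]. }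
      assert (HB : e * (g O a + total_var (g O) a L') <= e * (2 + V O * (INR L' / INR (P O)))).
      { apply Rmult_le_compat_l; [assumption|]. lra. }
      (* Here q >= 8 enters. The window bound of [g O] costs D P and the boundary terms at most
         another D P, while M >= 1/2 makes half of the allowed 4 D P available. *)
      assert (HC : 2 * e <= D * INR (P O)).
      { assert (0 <= D * INR (P O)) by nra. nra. }
      assert (0 <= D * INR (P O)) by nra.
      assert ((M O + 4 * D * V O / q) * (4 * D * INR (P O)) >= 2 * D * INR (P O)) by nra.
      lra.
Qed.

(** * Periodic sequences and step functions of the phase *)

Definition periodic (P : nat) (g : nat -> R) : Prop := forall i, g (i + P)%nat = g i.

Lemma periodic_window P g a : periodic P g -> sumN P (fun i => g (a + i)%nat) = sumN P g.
Proof.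
  intros Hp. induction a as [|a IH]; [reflexivity|]. rewrite <- IH.
  destruct P as [|P]; [reflexivity|].
  rewrite (sumN_S_l P (fun i => g (a + i)%nat)). simpl.
  rewrite (sumN_ext P (fun i => g (S (a + i))) (fun i => g (a + S i)%nat))
    by (intros; f_equal; lia).
  rewrite Nat.add_0_r. replace (S (a + P)) with (a + S P)%nat by lia. rewrite Hp. lra.
Qed.

Lemma periodic_mul P g a K : periodic P g ->
  sumN (K * P) (fun i => g (a + i)%nat) = INR K * sumN P g.
Proof.
  intros Hp. rewrite sumN_mul.
  rewrite (sumN_ext K _ (fun _ => sumN P g)).
  - apply sumN_const.
  - intros s _. rewrite <- (periodic_window P g (a + s * P) Hp). apply sumN_ext.
    intros; f_equal; lia.
Qed.

Lemma periodic_sum_le P g a L : (0 < P)%nat -> periodic P g -> (forall i, 0 <= g i) ->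
  sumN L (fun i => g (a + i)%nat) <= (INR L / INR P + 1) * sumN P g.
Proof.
  intros HP Hp Hg. assert (HP' : 0 < INR P) by now apply lt_0_INR.
  assert (Hd := Nat.div_mod_eq L P). assert (Hm := Nat.mod_upper_bound L P ltac:(lia)).
  set (K := (L / P)%nat) in *.
  eapply Rle_trans; [apply (sumN_mono L (S K * P)); [intros; apply Hg|nia]|].
  rewrite periodic_mul, S_INR by assumption.
  apply Rmult_le_compat_r; [apply sumN_nonneg; intros; apply Hg|].
  apply Rplus_le_compat_r. apply Rmult_le_reg_r with (INR P); [assumption|].
  unfold Rdiv. rewrite Rmult_assoc, Rinv_l, Rmult_1_r, <- mult_INR by lra. apply le_INR. nia.
Qed.

(** Whole periods contribute at most the mean. The incomplete period at the end contributes at most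
    the excess over [M], so that [D] measures the positive part of g - M in L1 and not its
    maximum. *)
Lemma periodic_mean_le P g M D a L : (0 < P)%nat -> periodic P g ->
  sumN P g <= INR P * M -> sumN P (fun i => Rmax 0 (g i - M)) <= INR P * D ->
  sumN L (fun i => g (a + i)%nat) <= M * INR L + INR P * D.
Proof.
  intros HP Hp HM HD.
  assert (Hd := Nat.div_mod_eq L P). assert (Hm := Nat.mod_upper_bound L P ltac:(lia)).
  set (K := (L / P)%nat) in *. set (r := (L mod P)%nat) in *.
  replace L with (K * P + r)%nat by lia. rewrite sumN_add, periodic_mul by assumption.
  assert (H1 : INR K * sumN P g <= INR K * (INR P * M))
    by (apply Rmult_le_compat_l; [apply pos_INR|assumption]).
  assert (H2 : sumN r (fun i => g (a + (K * P + i))%nat) <= INR r * M + INR P * D).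
  { eapply Rle_trans; [apply (sumN_le r _ (fun i => M + Rmax 0 (g (a + K * P + i)%nat - M)))|].
    - intros i _. replace (a + (K * P + i))%nat with (a + K * P + i)%nat by lia.
      assert (g (a + K * P + i)%nat - M <= Rmax 0 (g (a + K * P + i)%nat - M)) by apply Rmax_r. lra.
    - rewrite sumN_plus, sumN_const. apply Rplus_le_compat_l.
      eapply Rle_trans; [apply (sumN_mono r P); [intros; apply Rmax_l|lia]|].
      rewrite (periodic_window P (fun i => Rmax 0 (g i - M)) (a + K * P)); [assumption|].
      intros i. now rewrite Hp. }
  rewrite plus_INR, mult_INR. lra.
Qed.

(** With p = Q / (2^h n) and K = 2^h this is, as a function of the position, the step function [gam]
    of the fractional part of n x. *)
Definition cellfun (gam : nat -> R) (p K : nat) (i : nat) : R := gam ((i / p) mod K).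

Lemma cellfun_periodic gam p K : (0 < p)%nat -> (0 < K)%nat -> periodic (p * K) (cellfun gam p K).
Proof.
  intros Hp HK i. unfold cellfun. rewrite (Nat.mul_comm p K), Nat.div_add by lia.
  f_equal. rewrite <- (Nat.Div0.add_mod_idemp_r (i / p) K K), Nat.Div0.mod_same, Nat.add_0_r. reflexivity.
Qed.

Lemma cellfun_at gam p K s r : (0 < K)%nat -> (r < p)%nat -> (s < K)%nat ->
  cellfun gam p K (s * p + r) = gam s.
Proof.
  intros HK Hr Hs. unfold cellfun. f_equal.
  rewrite Nat.add_comm, Nat.div_add, Nat.div_small, Nat.add_0_l by lia. now apply Nat.mod_small.
Qed.

Lemma cellfun_sum gam p K : (0 < K)%nat -> sumN (p * K) (cellfun gam p K) = INR p * sumN K gam.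
Proof.
  intros HK. rewrite (Nat.mul_comm p K), sumN_mul, <- sumN_scal. apply sumN_ext. intros s Hs.
  rewrite (sumN_ext p _ (fun _ => gam s)) by (intros; now apply cellfun_at).
  apply sumN_const.
Qed.

Lemma cellfun_total_var gam p K : (0 < p)%nat -> (0 < K)%nat ->
  sumN (p * K) (fun i => Rabs (cellfun gam p K (i + 1) - cellfun gam p K i))
  = sumN K (fun s => Rabs (gam ((s + 1) mod K) - gam s)).
Proof.
  intros Hp HK. rewrite (Nat.mul_comm p K), sumN_mul. apply sumN_ext. intros s Hs.
  destruct p as [|p]; [lia|]. simpl sumN. rewrite sumN_zero.
  - rewrite cellfun_at by lia.
    replace (s * S p + p + 1)%nat with ((s + 1) * S p)%nat by lia. unfold cellfun.
    rewrite Nat.div_mul by lia. lra.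
  - intros i Hi. rewrite <- Nat.add_assoc, !cellfun_at by lia.
    rewrite Rminus_diag. apply Rabs_R0.
Qed.

Lemma total_var_periodic_le P g a L V : (0 < P)%nat -> periodic P g ->
  sumN P (fun i => Rabs (g (i + 1)%nat - g i)) <= V -> total_var g a L <= V * (INR L / INR P + 1).
Proof.
  intros HP Hp HV. unfold total_var.
  eapply Rle_trans; [apply (periodic_sum_le P (fun i => Rabs (g (i + 1)%nat - g i)) a L HP)|].
  - intros i. replace (i + P + 1)%nat with (i + 1 + P)%nat by lia. now rewrite !Hp.
  - intros; apply Rabs_pos.
  - rewrite Rmult_comm. apply Rmult_le_compat_r; [|assumption].
    assert (0 <= INR L / INR P) by (apply Rdiv_le_0_compat; [apply pos_INR|now apply lt_0_INR]). lra.
Qed.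

Lemma tame_cellfun gam p K M D V : (0 < p)%nat -> (0 < K)%nat ->
  (forall s, (s < K)%nat -> 0 <= gam s <= 3 / 2) ->
  sumN K (fun s => Rabs (gam ((s + 1) mod K) - gam s)) <= V ->
  sumN K gam <= INR K * M ->
  sumN K (fun s => Rmax 0 (gam s - M)) <= INR K * D ->
  tame (cellfun gam p K) (p * K) M D V.
Proof.
  intros Hp HK H1 H2 H3 H4.
  assert (Hper := cellfun_periodic gam p K Hp HK).
  assert (HP : (0 < p * K)%nat) by nia.
  split; [|split].
  - intros i. apply H1. apply Nat.mod_upper_bound. lia.
  - intros a L. apply total_var_periodic_le; [assumption..|]. now rewrite cellfun_total_var.
  - intros a L. apply periodic_mean_le; [assumption..| |].
    + rewrite cellfun_sum, mult_INR by assumption.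
      assert (0 <= INR p) by apply pos_INR. nra.
    + change (fun i => Rmax 0 (cellfun gam p K i - M)) with
        (cellfun (fun s => Rmax 0 (gam s - M)) p K).
      rewrite cellfun_sum, mult_INR by assumption.
      assert (0 <= INR p) by apply pos_INR. nra.
Qed.

(** Covers the factor of a frequency that the weights do not select. *)
Lemma tame_const P M D V : 1 <= M -> 0 <= D -> 0 <= V -> tame (fun _ => 1) P M D V.
Proof.
  intros HM HD HV. split; [|split].
  - intros; lra.
  - intros a L. unfold total_var. rewrite sumN_zero; [|intros; rewrite Rminus_diag; apply Rabs_R0].
    destruct P as [|P].
    + apply Rmult_le_pos; [assumption|]. unfold Rdiv. simpl (INR 0). rewrite Rinv_0. lra.
    + apply Rmult_le_pos; [assumption|].
      assert (0 <= INR L / INR (S P)) by (apply Rdiv_le_0_compat; [apply pos_INR|apply lt_0_INR; lia]). lra.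
  - intros a L. rewrite sumN_const. assert (0 <= INR L) by apply pos_INR.
    assert (0 <= INR P) by apply pos_INR. nra.
Qed.

(** * Moment generating functions and tails *)

Lemma pow2_nat_pos h : (0 < 2 ^ h)%nat.
Proof. assert (2 ^ h <> 0)%nat by (apply Nat.pow_nonzero; lia). lia. Qed.

(* The dyadic cell of level [h] that contains the fractional part of [N * x]. If [2 ^ h * N] divides
   [Q], it depends only on the position [nat_floor (INR Q * x)], so that expectations over (0,1)
   become averages over the positions [i < Q]. *)
Definition cell_index (h N : nat) (x : R) : nat := (nat_floor (INR (2 ^ h * N) * x) mod 2 ^ h)%nat.

Lemma cell_index_lt h N x : (cell_index h N x < 2 ^ h)%nat.
Proof. apply Nat.mod_upper_bound. assert (H := pow2_nat_pos h). lia. Qed.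

Lemma cell_index_cellfun h N x Q (c : nat -> R) : 0 <= x -> (0 < Q)%nat -> (0 < N)%nat ->
  Nat.divide (2 ^ h * N) Q ->
  c (cell_index h N x) = cellfun c (Q / (2 ^ h * N)) (2 ^ h) (nat_floor (INR Q * x)).
Proof.
  intros Hx HQ HN [p Hp]. assert (H2 := pow2_nat_pos h).
  assert (Hd : (0 < 2 ^ h * N)%nat) by nia. assert (Hp0 : (0 < p)%nat) by nia.
  rewrite Hp, Nat.div_mul by lia. unfold cellfun, cell_index. do 2 f_equal.
  rewrite <- nat_floor_div; [|apply Rmult_le_pos; [apply pos_INR|assumption]|assumption].
  f_equal. rewrite (mult_INR p). field. assert (0 < INR p) by now apply lt_0_INR. lra.
Qed.

(** The weights select an arbitrary set of frequencies, as the permutation demands. The factor 2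
    absorbs the edge effect of the coarsest frequency. *)
Definition mgf_bound (N : nat -> nat) (h : nat) (c : nat -> R) (lam mu : R) : Prop :=
  forall r (a : nat -> R) Q, (forall k, a k = 0 \/ a k = 1) -> (0 < Q)%nat ->
    (forall k, (k < r)%nat -> Nat.divide (2 ^ h * N k) Q) ->
    sumN Q (fun i => exp (lam * sumN r (fun k => a k * cellfun c (Q / (2 ^ h * N k)) (2 ^ h) i)))
      <= 2 * exp (mu * sumN r a) * INR Q.

Lemma gap_periods (N : nat -> nat) q Q k : (0 < N k)%nat -> (0 < N (S k))%nat ->
  q * INR (N k) <= INR (N (S k)) -> Nat.divide (N k) Q -> Nat.divide (N (S k)) Q ->
  q * INR (Q / N (S k)) <= INR (Q / N k).
Proof.
  intros H0 H1 Hq [p Hp] [p' Hp']. rewrite Hp' at 1. rewrite Hp at 1.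
  rewrite !Nat.div_mul by lia.
  assert (E : INR p * INR (N k) = INR p' * INR (N (S k))) by (rewrite <- !mult_INR; congruence).
  assert (0 < INR (N k)) by now apply lt_0_INR.
  assert (0 <= INR p') by apply pos_INR.
  apply Rmult_le_reg_r with (INR (N k)); [assumption|]. rewrite E. nra.
Qed.

Lemma divide_cell_period h N Q : (0 < N)%nat -> (0 < Q)%nat -> Nat.divide (2 ^ h * N) Q ->
  (0 < Q / (2 ^ h * N))%nat /\ (Q / N = Q / (2 ^ h * N) * 2 ^ h)%nat /\ Nat.divide N Q.
Proof.
  intros HN HQ [p Hp]. assert (H2 := pow2_nat_pos h).
  assert (Hd : (0 < 2 ^ h * N)%nat) by nia.
  rewrite Hp at 1 2 3. rewrite Nat.div_mul by lia. split; [nia|]. split.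
  - rewrite Nat.mul_assoc, Nat.div_mul by lia. reflexivity.
  - exists (p * 2 ^ h)%nat. rewrite Hp. ring.
Qed.

(** Increasing frequencies have decreasing periods Q / N k, so the factors already come in the order
    that [riesz_product_bound] expects. The variation is multiplied by the weight, so that
    unselected factors produce no error. *)
Lemma mgf_general (N : nat -> nat) h c lam mu1 mu D V q :
  (forall k, (0 < N k)%nat) -> (forall k, q * INR (N k) <= INR (N (S k))) ->
  8 <= q -> 0 <= D <= 1 / 4 -> 0 <= V <= 1 / 4 -> 0 <= mu1 -> mu1 + 4 * D * V / q <= mu ->
  (forall s, (s < 2 ^ h)%nat -> exp (lam * c s) <= 3 / 2) ->
  sumN (2 ^ h) (fun s => Rabs (exp (lam * c ((s + 1) mod 2 ^ h)) - exp (lam * c s))) <= V ->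
  sumN (2 ^ h) (fun s => exp (lam * c s)) <= INR (2 ^ h) * (1 + mu1) ->
  sumN (2 ^ h) (fun s => Rmax 0 (exp (lam * c s) - (1 + mu1))) <= INR (2 ^ h) * D ->
  mgf_bound N h c lam mu.
Proof.
  intros HN Hgap Hq HD HV Hmu1 Hmu C1 C2 C3 C4 r a Q Ha HQ Hdiv.
  assert (H2 := pow2_nat_pos h).
  set (g := fun k i => exp (lam * (a k * cellfun c (Q / (2 ^ h * N k)) (2 ^ h) i))).
  assert (HIB := riesz_product_bound q D Hq (proj1 HD) r g (fun k => (Q / N k)%nat)
    (fun k => 1 + mu1 * a k) (fun k => V * a k)).
  assert (Hav : forall k, 0 <= a k <= 1) by (intros k; destruct (Ha k) as [-> | ->]; lra).
  assert (HIB' : interval_bound (fun i => prodf r (fun k => g k i))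
    (prodf r (fun k => 1 + mu1 * a k + 4 * D * (V * a k) / q)) (4 * D * INR (Q / N 0%nat))).
  { apply HIB.
    - intros k Hk. destruct (divide_cell_period h (N k) Q (HN k) HQ (Hdiv k Hk)) as [D1 [D2 D3]].
      split; [rewrite D2; nia|]. specialize (Hav k). split; [|split; [nra|nra]].
      unfold g. destruct (Ha k) as [E|E]; rewrite E.
      + assert (tame (fun _ => 1) (Q / N k) (1 + mu1 * 0) D (V * 0)) as [T1 [T2 T3]]
          by (apply tame_const; lra).
        assert (Eg : forall i, exp (lam * (0 * cellfun c (Q / (2 ^ h * N k)) (2 ^ h) i)) = 1)
          by (intros; rewrite Rmult_0_l, Rmult_0_r; apply exp_0).
        split; [|split].
        * intros i. rewrite Eg. lra.
        * intros b L. eapply Rle_trans; [|apply (T2 b L)]. apply sumN_le. intros. rewrite !Eg. lra.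
        * intros b L. eapply Rle_trans; [|apply (T3 b L)]. apply sumN_le. intros. rewrite !Eg. lra.
      + assert (T : tame (cellfun (fun s => exp (lam * c s)) (Q / (2 ^ h * N k)) (2 ^ h))
           (Q / (2 ^ h * N k) * 2 ^ h) (1 + mu1) D V).
        { apply tame_cellfun; try assumption.
          intros s Hs. split; [left; apply exp_pos|now apply C1]. }
        rewrite D2. rewrite !Rmult_1_r.
        destruct T as [T1 [T2 T3]]. unfold cellfun in *.
        split; [|split].
        * intros i. rewrite Rmult_1_l. apply T1.
        * intros b L. eapply Rle_trans; [|apply (T2 b L)]. apply sumN_le. intros. rewrite !Rmult_1_l. lra.
        * intros b L. eapply Rle_trans; [|apply (T3 b L)]. apply sumN_le. intros. rewrite !Rmult_1_l. lra.
    - intros k Hk. apply gap_periods; auto.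
      + apply (divide_cell_period h (N k) Q); auto. apply Hdiv. lia.
      + apply (divide_cell_period h (N (S k)) Q); auto. }
  specialize (HIB' O Q).
  rewrite (sumN_ext Q _ (fun i => prodf r (fun k => g k (0 + i)%nat))).
  2:{ intros i _. unfold g. rewrite prodf_exp. f_equal. rewrite <- sumN_scal. reflexivity. }
  eapply Rle_trans; [apply HIB'|].
  assert (HE : prodf r (fun k => 1 + mu1 * a k + 4 * D * (V * a k) / q) <= exp (mu * sumN r a)).
  { rewrite <- sumN_scal, <- prodf_exp. apply prodf_le. intros k Hk. specialize (Hav k).
    assert (H0 : 0 <= 4 * D * V / q) by (apply Rdiv_le_0_compat; nra).
    replace (4 * D * (V * a k) / q) with (4 * D * V / q * a k) by (field; lra).
    split; [nra|]. assert (HH := exp_ge_1x (mu * a k)). nra. }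
  assert (HE0 : 0 <= exp (mu * sumN r a)) by (left; apply exp_pos).
  (* The window is the whole range of positions, so the edge term is at most Q because D <= 1/4. *)
  assert (HQN : 0 <= INR (Q / N 0%nat) <= INR Q).
  { split; [apply pos_INR|]. apply le_INR. apply Nat.Div0.div_le_upper_bound.
    specialize (HN O). nia. }
  assert (0 < INR Q) by now apply lt_0_INR.
  assert (INR Q + 4 * D * INR (Q / N 0%nat) <= 2 * INR Q) by nra.
  assert (0 <= INR Q + 4 * D * INR (Q / N 0%nat)) by nra.
  eapply Rle_trans; [apply Rmult_le_compat_r; [assumption|apply HE]|]. nra.
Qed.

Lemma sum_shift_mod K (phi : nat -> R) : (0 < K)%nat ->
  sumN K (fun s => phi ((s + 1) mod K)) = sumN K phi.
Proof.
  intros HK.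
  assert (Hp : periodic K (fun i => phi (i mod K))).
  { intros i. rewrite <- (Nat.Div0.add_mod_idemp_r i K K), Nat.Div0.mod_same, Nat.add_0_r. reflexivity. }
  assert (H := periodic_window K _ 1 Hp). cbv beta in H.
  rewrite (sumN_ext K phi (fun i => phi (i mod K))).
  2:{ intros i Hi. now rewrite Nat.mod_small. }
  rewrite <- H. apply sumN_ext. intros i _. now rewrite Nat.add_comm.
Qed.

Definition centered_cell (K s0 : nat) (sgn : R) (s : nat) : R :=
  sgn * ((if Nat.eqb s s0 then 1 else 0) - / INR K).

Lemma sum_ind_cell K s0 : (s0 < K)%nat -> sumN K (fun s => if Nat.eqb s s0 then 1 else 0) = 1.
Proof.
  intros H. rewrite (sumN_single K s0 (fun _ => 1)). destruct (Nat.ltb_spec s0 K); [reflexivity|lia].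
Qed.

(** For the chaining over cells, the exponent must carry the probability v = 1 / 2^h of the cell and
    the gap ratio must not depend on h. Both come from measuring the excess in L1: D = 2 lam v, V =
    4 lam and q = 32 give 4 D V / q = lam^2 v. *)
Lemma mgf_cell (N : nat -> nat) h s0 sgn lam :
  (forall k, (0 < N k)%nat) -> (forall k, 32 * INR (N k) <= INR (N (S k))) ->
  (s0 < 2 ^ h)%nat -> sgn = 1 \/ sgn = -1 -> 0 < lam <= 1 / 32 ->
  mgf_bound N h (centered_cell (2 ^ h) s0 sgn) lam (2 * lam ^ 2 / INR (2 ^ h)).
Proof.
  intros HN Hgap Hs0 Hsg Hlam.
  assert (H2 := pow2_nat_pos h). set (K := (2 ^ h)%nat) in *.
  assert (HK : 1 <= INR K) by (apply (le_INR 1); lia).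
  set (v := / INR K).
  assert (Hv : 0 < v <= 1).
  { unfold v. split; [apply Rinv_0_lt_compat; lra|]. rewrite <- Rinv_1. apply Rinv_le_contravar; lra. }
  assert (HvK : v * INR K = 1) by (unfold v; field; lra).
  assert (Hs2 : sgn ^ 2 = 1) by (destruct Hsg as [-> | ->]; ring).
  assert (Hc : forall s, Rabs (centered_cell K s0 sgn s) <= 1).
  { intros s. unfold centered_cell. fold v. destruct Hsg as [-> | ->], (Nat.eqb s s0); apply Rabs_le; lra. }
  assert (Hlc : forall s, Rabs (lam * centered_cell K s0 sgn s) <= 1 / 32).
  { intros s. rewrite Rabs_mult, (Rabs_pos_eq lam) by lra. specialize (Hc s).
    assert (0 <= Rabs (centered_cell K s0 sgn s)) by apply Rabs_pos. nra. }
  apply (mgf_general N h (centered_cell K s0 sgn) lam (lam ^ 2 * v) (2 * lam ^ 2 / INR K)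
     (2 * lam * v) (4 * lam) 32); auto; fold K; try lra.
  - split; [nra|]. nra.
  - assert (0 <= lam ^ 2) by apply pow2_ge_0. nra.
  - unfold Rdiv. fold v. nra.
  - intros s _. specialize (Hlc s). apply Rabs_le_between in Hlc.
    assert (H := exp_le_sqr (lam * centered_cell K s0 sgn s)).
    assert (Rabs (lam * centered_cell K s0 sgn s) <= 1) by (apply Rabs_le; lra). nra.
  (* Only the steps into and out of the cell [s0] change the exponential, each by at most 2 lam. *)
  - set (I := fun s => if Nat.eqb s s0 then 1 else 0).
    assert (Hd : forall s t, Rabs (exp (lam * centered_cell K s0 sgn s) - exp (lam * centered_cell K s0 sgn t))
      <= 2 * lam * (I s + I t)).
    { assert (E1 : exp lam - 1 <= 2 * lam) by (apply exp_le_double; lra).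
      assert (E0 : 1 <= exp lam) by (assert (HH := exp_ge_1x lam); lra).
      assert (D : forall b, b <= 0 -> 0 <= exp (b + lam) - exp b <= 2 * lam).
      { intros b Hb. rewrite exp_plus. assert (exp b <= 1) by now apply exp_le_1.
        assert (0 < exp b) by apply exp_pos. nra. }
      assert (P1 : 0 <= lam * (1 - v)) by nra. assert (P2 : 0 <= lam * v) by nra.
      assert (D1 : 0 <= exp (lam * (1 * (1 - v))) - exp (lam * (1 * (0 - v))) <= 2 * lam).
      { replace (lam * (1 * (1 - v))) with (lam * (1 * (0 - v)) + lam) by ring. apply D. lra. }
      assert (D2 : 0 <= exp (lam * (-1 * (0 - v))) - exp (lam * (-1 * (1 - v))) <= 2 * lam).
      { replace (lam * (-1 * (0 - v))) with (lam * (-1 * (1 - v)) + lam) by ring. apply D. lra. }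
      intros s t. unfold centered_cell, I. fold v.
      destruct Hsg as [-> | ->], (Nat.eqb s s0), (Nat.eqb t s0); rewrite ?Rminus_diag, ?Rabs_R0; try lra;
        apply Rabs_le; lra. }
    eapply Rle_trans; [apply (sumN_le K _ (fun s => 2 * lam * (I ((s + 1) mod K) + I s))); intros; apply Hd|].
    rewrite sumN_scal, sumN_plus, (sum_shift_mod K I) by lia.
    replace (sumN K I) with 1 by (symmetry; apply sum_ind_cell; lia). lra.
  - eapply Rle_trans; [apply (sumN_le K _ (fun s => 1 + (lam * sgn) * ((if Nat.eqb s s0 then 1 else 0) - v)
       + lam ^ 2 * (if Nat.eqb s s0 then 1 else 0) + (lam ^ 2 * v ^ 2) - (2 * lam ^ 2 * v) * (if Nat.eqb s s0 then 1 else 0)))|].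
    + intros s _. assert (HH := exp_le_sqr (lam * centered_cell K s0 sgn s)). specialize (Hlc s).
      specialize (HH ltac:(lra)). eapply Rle_trans; [apply HH|]. unfold centered_cell. fold v.
      replace ((lam * (sgn * ((if s =? s0 then 1 else 0) - v))) ^ 2) with
        (lam ^ 2 * ((if s =? s0 then 1 else 0) - v) ^ 2 * sgn ^ 2) by ring. rewrite Hs2.
      destruct (Nat.eqb s s0); nra.
    + rewrite sumN_minus, !sumN_plus, !sumN_scal, sumN_minus, !sumN_const. rewrite (sum_ind_cell K s0) by lia.
      assert (0 <= lam ^ 2 * v) by (apply Rmult_le_pos; [apply pow2_ge_0|lra]). nra.
  - assert (P1 : 0 <= lam * (1 - v)) by nra. assert (P2 : 0 <= lam * v) by nra.
    assert (P3 : 0 <= lam ^ 2 * v) by (apply Rmult_le_pos; [apply pow2_ge_0|lra]).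
    assert (H1 : forall w, 0 <= w <= 1 -> exp (lam * w) - 1 <= 2 * (lam * w))
      by (intros w Hw; apply exp_le_double; nra).
    assert (H0 : forall w, w <= 0 -> exp (lam * w) <= 1) by (intros w Hw; apply exp_le_1; nra).
    destruct Hsg as [-> | ->].
    + eapply Rle_trans; [apply (sumN_le K _ (fun s => 2 * lam * (if Nat.eqb s s0 then 1 else 0)))|].
      * intros s _. unfold centered_cell. fold v. destruct (Nat.eqb s s0).
        -- apply Rmax_lub; [lra|]. specialize (H1 (1 * (1 - v)) ltac:(lra)). nra.
        -- apply Rmax_lub; [lra|]. specialize (H0 (1 * (0 - v)) ltac:(lra)). nra.
      * rewrite sumN_scal, sum_ind_cell by lia.
        replace (INR K * (2 * lam * v)) with (2 * lam * (v * INR K)) by ring. rewrite HvK. lra.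
    + apply sumN_le_const. intros s _. unfold centered_cell. fold v. destruct (Nat.eqb s s0).
      * apply Rmax_lub; [nra|]. specialize (H0 (-1 * (1 - v)) ltac:(lra)). nra.
      * apply Rmax_lub; [nra|]. specialize (H1 (-1 * (0 - v)) ltac:(lra)). nra.
Qed.

Lemma abs_exp_sub_1 u : Rabs u <= 1 -> Rabs (exp u - 1) <= 2 * Rabs u.
Proof.
  intros Hu. apply Rabs_le. assert (H1 := exp_ge_1x u). assert (H2 := exp_le_sqr u Hu).
  assert (H3 := Rle_abs u). assert (H4 := Rle_abs (- u)). rewrite Rabs_Ropp in H4.
  assert (0 <= Rabs u) by apply Rabs_pos. rewrite <- (pow2_abs u) in H2. nra.
Qed.

(** Here the variance is sharp up to [delta]. The price is a gap ratio depending on 2^h and [B],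
    which is affordable because the step function stays fixed while the number of summands grows. *)
Lemma mgf_step (N : nat -> nat) h c lam B sig2 delta q :
  (forall k, (0 < N k)%nat) -> (forall k, q * INR (N k) <= INR (N (S k))) ->
  0 < B -> 0 < delta ->
  (forall s, (s < 2 ^ h)%nat -> Rabs (c s) <= B) -> sumN (2 ^ h) c = 0 ->
  sumN (2 ^ h) (fun s => c s ^ 2) <= INR (2 ^ h) * sig2 ->
  8 <= q -> 0 < lam -> lam * (B * INR (2 ^ h)) <= 1 / 16 -> lam * B ^ 3 <= delta / 2 ->
  128 * B ^ 2 * INR (2 ^ h) <= delta * q ->
  mgf_bound N h c lam (lam ^ 2 * (sig2 + delta) / 2).
Proof.
  intros HN Hgap HB Hd Hc Hsum Hvar Hq Hl Hl1 Hl2 Hl3.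
  assert (H2 := pow2_nat_pos h). set (K := (2 ^ h)%nat) in *.
  assert (HK : 1 <= INR K) by (apply (le_INR 1); lia).
  assert (HlB : lam * B <= 1 / 16) by nra. assert (HlB0 : 0 < lam * B) by nra.
  assert (Hsig : 0 <= sig2).
  { assert (0 <= sumN K (fun s => c s ^ 2)) by (apply sumN_nonneg; intros; apply pow2_ge_0). nra. }
  assert (Hlc : forall s, (s < K)%nat -> Rabs (lam * c s) <= lam * B).
  { intros s Hs. rewrite Rabs_mult, (Rabs_pos_eq lam) by lra. specialize (Hc s Hs). nra. }
  assert (Habs : forall s, (s < K)%nat -> Rabs (exp (lam * c s) - 1) <= 2 * (lam * B)).
  { intros s Hs. specialize (Hlc s Hs). eapply Rle_trans; [apply abs_exp_sub_1; lra|lra]. }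
  assert (Hmu : 0 <= lam ^ 2 * sig2 / 2 + lam ^ 3 * B ^ 3 / 2).
  { assert (0 <= lam ^ 2 * sig2) by (apply Rmult_le_pos; [apply pow2_ge_0|lra]).
    assert (0 <= lam ^ 3 * B ^ 3) by (apply Rmult_le_pos; apply pow_le; lra). lra. }
  apply (mgf_general N h c lam (lam ^ 2 * sig2 / 2 + lam ^ 3 * B ^ 3 / 2) _
     (2 * (lam * B)) (4 * (lam * B) * INR K) q); auto; fold K; try lra.
  - nra.
  - apply Rplus_le_reg_l with (- (lam ^ 2 * sig2 / 2)).
    assert (E1 : lam ^ 3 * B ^ 3 / 2 <= lam ^ 2 * (delta / 4)).
    { replace (lam ^ 3 * B ^ 3 / 2) with (lam ^ 2 * (lam * B ^ 3 / 2)) by field.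
      apply Rmult_le_compat_l; [apply pow2_ge_0|lra]. }
    assert (E2 : 4 * (2 * (lam * B)) * (4 * (lam * B) * INR K) / q <= lam ^ 2 * (delta / 4)).
    { replace (4 * (2 * (lam * B)) * (4 * (lam * B) * INR K) / q) with
        (lam ^ 2 * (128 * B ^ 2 * INR K / q / 4)) by (field; lra).
      apply Rmult_le_compat_l; [apply pow2_ge_0|].
      apply Rmult_le_compat_r; [lra|]. apply Rle_div_l; lra. }
    lra.
  - intros s Hs. specialize (Habs s Hs). apply Rabs_le_between in Habs. lra.
  - eapply Rle_trans; [apply (sumN_le_const K _ (4 * (lam * B)))|lra].
    intros s Hs. assert (A1 := Habs s Hs).
    assert (A2 := Habs ((s + 1) mod K)%nat ltac:(apply Nat.mod_upper_bound; lia)).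
    apply Rabs_le_between in A1, A2. apply Rabs_le. lra.
  - eapply Rle_trans; [apply (sumN_le K _ (fun s => 1 + lam * c s + lam ^ 2 / 2 * c s ^ 2 + lam ^ 3 * B ^ 3 / 2))|].
    + intros s Hs. specialize (Hlc s Hs). eapply Rle_trans; [apply exp_le_cube; lra|].
      assert (Rabs (lam * c s) ^ 3 <= (lam * B) ^ 3) by (apply pow_incr; split; [apply Rabs_pos|assumption]).
      replace (lam ^ 3 * B ^ 3) with ((lam * B) ^ 3) by ring. lra.
    + rewrite !sumN_plus, !sumN_scal, !sumN_const, Hsum.
      assert (0 <= lam ^ 2 / 2) by (assert (0 <= lam ^ 2) by apply pow2_ge_0; lra). nra.
  - apply sumN_le_const. intros s Hs. specialize (Habs s Hs). apply Rabs_le_between in Habs.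
    apply Rmax_lub; lra.
Qed.

Lemma common_multiple (d : nat -> nat) r : (forall k, (0 < d k)%nat) ->
  exists Q, (0 < Q)%nat /\ forall k, (k < r)%nat -> Nat.divide (d k) Q.
Proof.
  intros Hd. induction r as [|r [Q [H1 H2]]].
  - exists 1%nat. split; [lia|intros; lia].
  - exists (Q * d r)%nat. split; [specialize (Hd r); nia|]. intros k Hk.
    destruct (Nat.eq_dec k r) as [->|Hn]; [apply Nat.divide_factor_r|].
    apply Nat.divide_mul_l. apply H2. lia.
Qed.

(* The indicator of the set of frequencies sigma(u), ..., sigma(u + v - 1). It turns a sum in the
   permuted order into a weighted sum in increasing order of the frequencies. *)
Definition block_weight (sigma : nat -> nat) (u v k : nat) : R :=
  sumN v (fun j => if Nat.eqb (sigma (u + j)%nat) k then 1 else 0).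

Lemma block_weight_01 sigma u v k : (forall i j, sigma i = sigma j -> i = j) ->
  block_weight sigma u v k = 0 \/ block_weight sigma u v k = 1.
Proof.
  intros Hinj. unfold block_weight.
  destruct (classic (exists j, (j < v)%nat /\ sigma (u + j)%nat = k)) as [[j [Hj Hk]]|Hn].
  - right. rewrite (sumN_ext v _ (fun i => if Nat.eqb i j then 1 else 0)).
    + apply sum_ind_cell. assumption.
    + intros i Hi. destruct (Nat.eqb_spec (sigma (u + i)%nat) k) as [E|E], (Nat.eqb_spec i j) as [E'|E']; try reflexivity.
      * exfalso. apply E'. assert (u + i = u + j)%nat by (apply Hinj; congruence). lia.
      * exfalso. apply E. now subst.
  - left. apply sumN_zero. intros j Hj. destruct (Nat.eqb_spec (sigma (u + j)%nat) k); [|reflexivity].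
    exfalso. apply Hn. now exists j.
Qed.

Lemma reorder sigma u v R0 (H : nat -> R) :
  (forall j, (j < v)%nat -> (sigma (u + j) < R0)%nat) ->
  sumN v (fun j => H (sigma (u + j)%nat)) = sumN R0 (fun k => block_weight sigma u v k * H k).
Proof.
  intros Hb. unfold block_weight.
  rewrite (sumN_ext R0 _ (fun k => sumN v (fun j => if Nat.eqb k (sigma (u + j)%nat) then H k else 0))).
  2:{ intros k _. rewrite <- sumN_scal_r. apply sumN_ext. intros j _.
      rewrite (Nat.eqb_sym k). destruct (Nat.eqb (sigma (u + j)%nat) k); ring. }
  rewrite <- sumN_swap. apply sumN_ext. intros j Hj. rewrite sumN_single.
  specialize (Hb j Hj). destruct (Nat.ltb_spec (sigma (u + j)%nat) R0); [reflexivity|lia].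
Qed.

Lemma range_bound (sigma : nat -> nat) u v : exists R0, forall j, (j < v)%nat -> (sigma (u + j) < R0)%nat.
Proof.
  induction v as [|v [R0 H]]; [exists O; intros; lia|].
  exists (R0 + sigma (u + v) + 1)%nat. intros j Hj.
  destruct (Nat.eq_dec j v) as [->|]; [lia|]. specialize (H j ltac:(lia)). lia.
Qed.

Definition cell_sum (n sigma : nat -> nat) (h : nat) (c : nat -> R) (u v : nat) (x : R) : R :=
  sumN v (fun j => c (cell_index h (n (sigma (u + j)%nat)) x)).

(** Chernoff's bound. Each of the first K0 frequencies, where the gaps may still be small, occurs at
    most once in the sum and shifts the level by at most B. The factor 4 is the 2 of [mgf_bound]
    times the 2 of [small_of_markov]. *)
Lemma tail_bound (n sigma : nat -> nat) h c B lam mu K0 :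
  (forall k, (0 < n k)%nat) -> (forall i j, sigma i = sigma j -> i = j) ->
  (forall s, (s < 2 ^ h)%nat -> Rabs (c s) <= B) -> 0 < lam -> 0 <= mu ->
  mgf_bound (fun k => n (K0 + k)%nat) h c lam mu ->
  forall u v t, small (fun x => 0 < x < 1 /\ t + INR K0 * B <= cell_sum n sigma h c u v x)
    (4 * exp (mu * INR v - lam * t)).
Proof.
  intros Hn Hinj HB Hlam Hmu Hmgf u v t.
  destruct (range_bound sigma u v) as [R0 HR0].
  assert (H2 := pow2_nat_pos h).
  destruct (common_multiple (fun k => (2 ^ h * n (K0 + k))%nat) R0) as [Q [HQ Hdiv]].
  { intros k. specialize (Hn (K0 + k)%nat). nia. }
  set (a := fun k => block_weight sigma u v (K0 + k)).
  set (phi := fun i => exp (- (lam * t)) * exp (lam * sumN R0 (fun k => a k *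
      cellfun c (Q / (2 ^ h * n (K0 + k)%nat)) (2 ^ h) i))).
  assert (Ha : forall k, a k = 0 \/ a k = 1) by (intros; now apply block_weight_01).
  assert (Hsa : sumN R0 a <= INR v).
  { assert (E := reorder sigma u v (K0 + R0) (fun _ => 1)).
    cbv beta in E. rewrite sumN_const, Rmult_1_r, sumN_add in E.
    rewrite E by (intros j Hj; specialize (HR0 j Hj); lia).
    assert (0 <= sumN K0 (fun k => block_weight sigma u v k * 1)).
    { apply sumN_nonneg. intros k _. destruct (block_weight_01 sigma u v k Hinj) as [-> | ->]; lra. }
    assert (sumN R0 a = sumN R0 (fun i => block_weight sigma u v (K0 + i) * 1))
      by (apply sumN_ext; intros; unfold a; ring). lra. }
  replace (4 * exp (mu * INR v - lam * t)) with (2 * (2 * exp (mu * INR v - lam * t))) by ring.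
  apply (small_of_markov Q phi).
  - assumption.
  - intros i. unfold phi. left. apply Rmult_lt_0_compat; apply exp_pos.
  - intros x Hx Hbig. unfold phi. rewrite <- exp_plus.
    rewrite (sumN_ext R0 _ (fun k => block_weight sigma u v (K0 + k) * c (cell_index h (n (K0 + k)%nat) x))).
    2:{ intros k Hk. unfold a. rewrite <- cell_index_cellfun; auto. lra. }
    assert (E := reorder sigma u v (K0 + R0) (fun k => c (cell_index h (n k) x))).
    cbv beta in E. fold (cell_sum n sigma h c u v x) in E. rewrite E in Hbig
      by (intros j Hj; specialize (HR0 j Hj); lia).
    rewrite sumN_add in Hbig.
    assert (sumN K0 (fun k => block_weight sigma u v k * c (cell_index h (n k) x)) <= INR K0 * B).
    { apply sumN_le_const. intros k _. specialize (HB _ (cell_index_lt h (n k) x)). apply Rabs_le_between in HB.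
      destruct (block_weight_01 sigma u v k Hinj) as [-> | ->]; lra. }
    assert (HH := exp_ge_1x (- (lam * t) +
      lam * sumN R0 (fun k => block_weight sigma u v (K0 + k) * c (cell_index h (n (K0 + k)%nat) x)))).
    assert (t <= sumN R0 (fun k => block_weight sigma u v (K0 + k) * c (cell_index h (n (K0 + k)%nat) x))) by lra. nra.
  - unfold phi. rewrite sumN_scal. specialize (Hmgf R0 a Q Ha HQ Hdiv).
    replace (2 * exp (mu * INR v - lam * t) * INR Q) with
      (exp (- (lam * t)) * (2 * exp (mu * INR v) * INR Q)).
    2:{ unfold Rminus. rewrite exp_plus. ring. }
    apply Rmult_le_compat_l; [left; apply exp_pos|].
    eapply Rle_trans; [apply Hmgf|]. apply Rmult_le_compat_r; [apply pos_INR|].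
    apply Rmult_le_compat_l; [lra|]. apply exp_le. nra.
Qed.

(** * Simultaneous bounds on dyadic cells and dyadic blocks *)

Definition summable (p : nat -> R) : Prop :=
  forall eps, eps > 0 -> exists J, forall J', (J <= J')%nat ->
    forall M, sumN M (fun j => p (J' + j)%nat) <= eps.

Lemma summable_scal p C : 0 < C -> summable p -> summable (fun j => C * p j).
Proof.
  intros HC Hp eps He. destruct (Hp (eps / C)) as [J HJ]; [apply Rdiv_lt_0_compat; lra|].
  exists J. intros J' HJ' M. rewrite sumN_scal. specialize (HJ J' HJ' M).
  replace eps with (C * (eps / C)) by (field; lra). nra.
Qed.

Lemma nat_above (A : R) : exists J, forall j, (J <= j)%nat -> A < INR j.
Proof.
  destruct (INR_unbounded A) as [J HJ]. exists J. intros j Hj. apply le_INR in Hj. lra.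
Qed.

Lemma ln_INR_unbounded (A : R) : exists J, forall j, (J <= j)%nat -> A < ln (INR j).
Proof.
  destruct (nat_above (exp A)) as [J HJ]. exists J. intros j Hj. specialize (HJ j Hj).
  rewrite <- (ln_exp A). apply ln_increasing; [apply exp_pos|assumption].
Qed.

(** The series of j^(-1-kappa), compared with the telescoping differences of (j-1)^(-kappa) and
    j^(-kappa). *)
Lemma summable_pow kappa : 0 < kappa -> summable (fun j => exp (- (1 + kappa) * ln (INR j))).
Proof.
  intros Hk.
  assert (Hstep : forall j, (2 <= j)%nat -> kappa * exp (- (1 + kappa) * ln (INR j)) <=
     exp (- kappa * ln (INR j - 1)) - exp (- kappa * ln (INR j))).
  { intros j Hj. apply le_INR in Hj. simpl in Hj. set (x := INR j) in *.
    replace (exp (- kappa * ln (x - 1))) with (exp (- kappa * ln x) * exp (- kappa * (ln (x - 1) - ln x)))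
      by (rewrite <- exp_plus; f_equal; ring).
    replace (exp (- (1 + kappa) * ln x)) with (exp (- kappa * ln x) * / x).
    2:{ replace (- (1 + kappa) * ln x) with (- kappa * ln x + - ln x) by ring.
        rewrite exp_plus, (exp_Ropp (ln x)), exp_ln by lra. reflexivity. }
    assert (Hl : ln (x - 1) - ln x <= - / x).
    { replace (x - 1) with (x * (1 + - / x)) by (field; lra).
      assert (0 < / x <= / 2) by (split; [apply Rinv_0_lt_compat|apply Rinv_le_contravar]; lra).
      rewrite ln_mult by lra.
      assert (ln (1 + - / x) <= - / x); [|lra].
      rewrite <- (ln_exp (- / x)) at 2. apply ln_le; [lra|apply exp_ge_1x]. }
    assert (He := exp_ge_1x (- kappa * (ln (x - 1) - ln x))).
    assert (0 < exp (- kappa * ln x)) by apply exp_pos.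
    assert (kappa * / x <= exp (- kappa * (ln (x - 1) - ln x)) - 1) by nra. nra. }
  intros eps He.
  destruct (ln_INR_unbounded (- ln (kappa * eps) / kappa)) as [J HJ].
  exists (J + 2)%nat. intros J' HJ' M.
  assert (Htel : kappa * sumN M (fun j => exp (- (1 + kappa) * ln (INR (J' + j)))) <=
     exp (- kappa * ln (INR J' - 1)) - exp (- kappa * ln (INR (J' + M) - 1))).
  { induction M as [|M IH].
    - simpl. rewrite Nat.add_0_r. lra.
    - simpl. rewrite Rmult_plus_distr_l. specialize (Hstep (J' + M)%nat ltac:(lia)).
      replace (INR (J' + S M) - 1) with (INR (J' + M)) by (rewrite Nat.add_succ_r, S_INR; ring). lra. }
  assert (exp (- kappa * ln (INR (J' + M) - 1)) > 0) by apply exp_pos.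
  assert (exp (- kappa * ln (INR J' - 1)) <= kappa * eps).
  { rewrite <- (exp_ln (kappa * eps)) by nra. apply exp_le.
    specialize (HJ (J' - 1)%nat ltac:(lia)). rewrite minus_INR in HJ by lia. simpl in HJ.
    apply Rmult_lt_compat_r with (r := kappa) in HJ; [|assumption].
    unfold Rdiv in HJ. rewrite Rmult_assoc, Rinv_l, Rmult_1_r in HJ by lra. lra. }
  nra.
Qed.

Lemma INR_pow2 h : INR (2 ^ h) = 2 ^ h.
Proof. rewrite pow_INR. reflexivity. Qed.

Lemma exp_pow_nat k x : exp x ^ k = exp (INR k * x).
Proof.
  induction k as [|k IH]; [simpl; now rewrite Rmult_0_l, exp_0|].
  simpl pow. rewrite IH, <- exp_plus, S_INR. f_equal. ring.
Qed.

(** Amounts to e^5 <= 3^5 = 243 < 256 = 2^8. The fraction 5/8 is also the slope of [depth]. *)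
Lemma ln2_lower : 5 / 8 < ln 2.
Proof.
  rewrite <- (ln_exp (5 / 8)). apply ln_increasing; [apply exp_pos|].
  destruct (Rlt_dec (exp (5 / 8)) 2) as [H|H]; [assumption|exfalso].
  assert (E : exp (5 / 8) ^ 8 = exp 1 ^ 5).
  { rewrite !exp_pow_nat. f_equal. simpl. field. }
  assert (A : 2 ^ 8 <= exp (5 / 8) ^ 8) by (apply pow_incr; lra).
  assert (B : exp 1 ^ 5 <= 3 ^ 5).
  { apply pow_incr. split; [left; apply exp_pos|apply exp_le_3]. }
  rewrite E in A. simpl in A, B. lra.
Qed.

Lemma pow2_exp j : 2 ^ j = exp (INR j * ln 2).
Proof. rewrite <- Rpower_pow by lra. reflexivity. Qed.

Lemma exp_ge_sqr y : 0 <= y -> y ^ 2 / 4 <= exp y.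
Proof.
  intros Hy. replace y with (y / 2 + y / 2) at 2 by field. rewrite exp_plus.
  assert (H := exp_ge_1x (y / 2)). nra.
Qed.

Lemma ln_le_self j : (1 <= j)%nat -> 0 <= ln (INR j) <= INR j.
Proof.
  intros Hj. apply le_INR in Hj. simpl in Hj. split.
  - rewrite <- ln_1. apply ln_le; lra.
  - rewrite <- (ln_exp (INR j)) at 2. apply ln_le; [lra|]. assert (H := exp_ge_1x (INR j)). lra.
Qed.

Lemma ln_ge_1 j : (3 <= j)%nat -> 1 <= ln (INR j).
Proof.
  intros Hj. apply le_INR in Hj. simpl in Hj. rewrite <- (ln_exp 1) at 1.
  apply ln_le; [apply exp_pos|]. assert (H := exp_le_3). lra.
Qed.

(* Scales below 2^(-depth j) are left unresolved: they contribute about 2^(3j/8), which is negligible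
   against 2^(j/2), while the tilts used at the finest scales still tend to 0 since exp(5/8) < 2. *)
Definition depth (j : nat) : nat := (5 * j / 8)%nat.

(** For N between 2^j and 2^(j+1) this has the order of the square root of N log log N, with ln j in
    place of log log N. *)
Definition lil_scale (j : nat) : R := sqrt (2 ^ j * ln (INR j)).

(** The argument [r] is the level of the cell plus the level of the block of times, so that the sum
    in question has variance of order 2^(j-r). The decay exp(-r/8) is slow enough for a union bound
    and still summable over the levels. *)
Definition threshold (j r : nat) : R := 12 * lil_scale j * exp (- (INR r / 8)).

(** Growth like exp(r/4) keeps the variance term at most 2 ln j, because exp(1/2) < 2, while tilt
    times threshold is 12 ln j exp(r/8), enough to pay for about 2^r pairs of cells and blocks. *)
Definition tilt (j r : nat) : R := exp (INR r / 4) * sqrt (ln (INR j) / 2 ^ j).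

Lemma tilt_small : exists j0, forall j r, (j0 <= j)%nat -> (r <= 2 * depth j)%nat -> tilt j r <= 1 / 32.
Proof.
  (* The rate at which (exp(5/8) / 2)^j decays; a quadratic lower bound for exp(c j) beats the
     factor ln j <= j. *)
  set (c := ln 2 - 5 / 8). assert (Hc : 0 < c) by (unfold c; assert (H := ln2_lower); lra).
  destruct (nat_above (4096 / c ^ 2)) as [J HJ]. exists (J + 1)%nat.
  intros j r Hj1 Hr. specialize (HJ j ltac:(lia)).
  assert (Hjp : 1 <= INR j) by (apply (le_INR 1); lia).
  destruct (ln_le_self j ltac:(lia)) as [L0 L1].
  unfold tilt. replace (1 / 32) with (sqrt (1 / 1024)).
  2:{ replace (1 / 1024) with ((1 / 32) * (1 / 32)) by field. apply sqrt_square. lra. }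
  replace (exp (INR r / 4)) with (sqrt (exp (INR r / 2))).
  2:{ replace (INR r / 2) with (INR r / 4 + INR r / 4) by field. rewrite exp_plus.
      apply sqrt_square. left; apply exp_pos. }
  assert (H2 : 0 < 2 ^ j) by (apply pow_lt; lra).
  rewrite <- sqrt_mult; [|left; apply exp_pos|apply Rdiv_le_0_compat; lra].
  apply sqrt_le_1_alt.
  assert (Hr2 : INR r <= 5 / 4 * INR j).
  { apply le_INR in Hr. rewrite mult_INR in Hr. simpl (INR 2) in Hr. unfold depth in Hr.
    assert (8 * (5 * j / 8) <= 5 * j)%nat by (apply Nat.Div0.mul_div_le).
    apply le_INR in H. rewrite !mult_INR in H. simpl (INR 8) in H. simpl (INR 5) in H. lra. }
  assert (E1 : exp (INR r / 2) <= exp (5 / 8 * INR j)) by (apply exp_le; lra).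
  assert (E2 : exp (5 / 8 * INR j) * exp (c * INR j) = 2 ^ j).
  { rewrite <- exp_plus, pow2_exp. f_equal. unfold c. ring. }
  assert (E3 : (c * INR j) ^ 2 / 4 <= exp (c * INR j)) by (apply exp_ge_sqr; nra).
  assert (E4 : 1024 * INR j <= exp (c * INR j)).
  { apply Rlt_div_l in HJ; [|apply pow_lt; assumption].
    assert (0 <= INR j * (INR j * c ^ 2 - 4096)) by (apply Rmult_le_pos; lra). nra. }
  unfold Rdiv at 2. rewrite <- Rmult_assoc. apply Rle_div_l; [assumption|].
  rewrite <- E2. assert (0 < exp (INR r / 2)) by apply exp_pos.
  assert (0 < exp (5 / 8 * INR j)) by apply exp_pos.
  apply Rle_trans with (exp (5 / 8 * INR j) * INR j); [apply Rmult_le_compat; lra|]. nra.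
Qed.

Lemma exp_half_pow_le r : exp (INR r / 2) <= 2 ^ r.
Proof.
  rewrite pow2_exp. apply exp_le. assert (H := ln2_lower). assert (0 <= INR r) by apply pos_INR. nra.
Qed.

(** The range of [i] lets the blocks of level [l] fill the times below 2^(j+1). The summand [K0]
    allows for the frequencies without large gaps. *)
Definition dyadic_bounded (n sigma : nat -> nat) (K0 j : nat) (x : R) : Prop :=
  forall h l s i, (h <= depth j)%nat -> (l <= depth j)%nat -> (s < 2 ^ h)%nat -> (i < 2 ^ (l + 1))%nat ->
    Rabs (cell_sum n sigma h (centered_cell (2 ^ h) s 1) (i * 2 ^ (j - l)) (2 ^ (j - l)) x)
      <= threshold j (h + l) + INR K0.

Lemma centered_cell_abs K s0 sgn s : (0 < K)%nat -> sgn = 1 \/ sgn = -1 -> Rabs (centered_cell K s0 sgn s) <= 1.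
Proof.
  intros HK Hs. unfold centered_cell. assert (1 <= INR K) by (apply (le_INR 1); lia).
  assert (0 < / INR K <= 1).
  { split; [apply Rinv_0_lt_compat; lra|]. rewrite <- Rinv_1. apply Rinv_le_contravar; lra. }
  destruct Hs as [-> | ->], (Nat.eqb s s0); apply Rabs_le; lra.
Qed.

Lemma cell_sum_opp_cell n sigma h K s u v x :
  cell_sum n sigma h (centered_cell K s (-1)) u v x = - cell_sum n sigma h (centered_cell K s 1) u v x.
Proof.
  unfold cell_sum. rewrite <- sumN_opp. apply sumN_ext. intros. unfold centered_cell. ring.
Qed.

Lemma depth_le j : (depth j <= j)%nat.
Proof. unfold depth. apply Nat.Div0.div_le_upper_bound. lia. Qed.

(** With L = ln j the exponent is at most 2 L - 12 L (1 + r/8). The constant part leaves -10 L, and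
    (3/2) L r >= r ln 2 yields the factor 2^(-r) that offsets the number of cells and blocks. *)
Lemma block_tail_prob j h l : (3 <= j)%nat -> (l <= j)%nat ->
  4 * exp (2 * tilt j (h + l) ^ 2 / INR (2 ^ h) * INR (2 ^ (j - l)) - tilt j (h + l) * threshold j (h + l))
  <= 4 * exp (- (10 * ln (INR j))) * (/ 2) ^ (h + l).
Proof.
  intros Hj3 Hl. set (r := (h + l)%nat). set (L := ln (INR j)).
  assert (HL : 1 <= L) by now apply ln_ge_1.
  assert (H2 : 0 < 2 ^ j) by (apply pow_lt; lra).
  assert (Hq : 0 <= L / 2 ^ j) by (apply Rdiv_le_0_compat; lra).
  assert (E1 : 2 * tilt j r ^ 2 / INR (2 ^ h) * INR (2 ^ (j - l)) = 2 * L * (exp (INR r / 2) / 2 ^ r)).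
  { unfold tilt. fold L. rewrite Rpow_mult_distr, pow2_sqrt by assumption.
    replace (exp (INR r / 4) ^ 2) with (exp (INR r / 2)).
    2:{ simpl. rewrite Rmult_1_r, <- exp_plus. f_equal. field. }
    rewrite !INR_pow2. unfold r. rewrite pow_add.
    replace (2 ^ j) with (2 ^ l * 2 ^ (j - l)) by (rewrite <- pow_add; f_equal; lia).
    field. repeat split; apply pow_nonzero; lra. }
  assert (E2 : tilt j r * threshold j r = 12 * L * exp (INR r / 8)).
  { unfold tilt, threshold, lil_scale. fold L.
    replace (exp (INR r / 4) * sqrt (L / 2 ^ j) * (12 * sqrt (2 ^ j * L) * exp (- (INR r / 8)))) with
      (12 * (sqrt (L / 2 ^ j) * sqrt (2 ^ j * L)) * (exp (INR r / 4) * exp (- (INR r / 8)))) by ring.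
    rewrite <- sqrt_mult by (try assumption; nra). rewrite <- exp_plus.
    replace (L / 2 ^ j * (2 ^ j * L)) with (L * L) by (field; lra).
    rewrite sqrt_square by lra. do 2 f_equal. field. }
  rewrite E1, E2, (Rmult_assoc 4 _ ((/ 2) ^ r)). apply Rmult_le_compat_l; [lra|].
  assert (E3 : exp (INR r / 2) / 2 ^ r <= 1).
  { apply Rle_div_l; [apply pow_lt; lra|]. rewrite Rmult_1_l. apply exp_half_pow_le. }
  assert (E4 := exp_ge_1x (INR r / 8)). assert (Hr : 0 <= INR r) by apply pos_INR.
  assert (E5 : (/ 2) ^ r = exp (- (INR r * ln 2))).
  { rewrite pow_inv, pow2_exp, exp_Ropp. reflexivity. }
  rewrite E5, <- exp_plus. apply exp_le.
  assert (ln 2 <= 1). { rewrite <- (ln_exp 1). apply ln_le; [lra|]. assert (H := exp_ge_1x 1). lra. }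
  assert (0 <= exp (INR r / 2) / 2 ^ r) by (apply Rdiv_le_0_compat; [left; apply exp_pos|apply pow_lt; lra]).
  assert (2 * L * (exp (INR r / 2) / 2 ^ r) <= 2 * L) by nra.
  assert (12 * L * (1 + INR r / 8) <= 12 * L * exp (INR r / 8)) by (apply Rmult_le_compat_l; lra).
  assert (INR r <= L * INR r) by nra. assert (INR r * ln 2 <= INR r) by nra. nra.
Qed.

Lemma dyadic_bounded_ae (n sigma : nat -> nat) (K0 : nat) :
  (forall k, (0 < n k)%nat) -> (forall i j, sigma i = sigma j -> i = j) ->
  (forall k, (K0 <= k)%nat -> 32 * INR (n k) <= INR (n (S k))) ->
  ae01 (fun x => exists J, forall j, (J <= j)%nat -> dyadic_bounded n sigma K0 j x).
Proof.
  intros Hn Hinj Hgap.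
  set (bad := fun j x => exists h, (h < S (depth j))%nat /\ exists l, (l < S (depth j))%nat /\
    exists s, (s < 2 ^ h)%nat /\ exists i, (i < 2 ^ (l + 1))%nat /\
     (threshold j (h + l) + INR K0 * 1 <= cell_sum n sigma h (centered_cell (2 ^ h) s 1) (i * 2 ^ (j - l)) (2 ^ (j - l)) x \/
      threshold j (h + l) + INR K0 * 1 <= cell_sum n sigma h (centered_cell (2 ^ h) s (-1)) (i * 2 ^ (j - l)) (2 ^ (j - l)) x)).
  apply ae_impl with (fun x => exists J, forall j, (J <= j)%nat -> ~ bad j x).
  - apply (ae_limsup bad (fun j => 16 * exp (- (1 + 1) * ln (INR j)))).
    + apply (summable_scal (fun j => exp (- (1 + 1) * ln (INR j))) 16); [lra|]. apply summable_pow. lra.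
    + destruct tilt_small as [j0 Hj0]. exists (j0 + 3)%nat. intros j Hjj.
      set (e10 := exp (- (10 * ln (INR j)))).
      assert (He : 0 < e10) by apply exp_pos.
      apply small_sub with (fun x => exists h, (h < S (depth j))%nat /\ (exists l, (l < S (depth j))%nat /\
        (exists s, (s < 2 ^ h)%nat /\ (exists i, (i < 2 ^ (l + 1))%nat /\
        ((0 < x < 1 /\ threshold j (h + l) + INR K0 * 1 <= cell_sum n sigma h (centered_cell (2 ^ h) s 1) (i * 2 ^ (j - l)) (2 ^ (j - l)) x) \/
        (0 < x < 1 /\ threshold j (h + l) + INR K0 * 1 <= cell_sum n sigma h (centered_cell (2 ^ h) s (-1)) (i * 2 ^ (j - l)) (2 ^ (j - l)) x))))))
        (INR (S (depth j)) * (INR (S (depth j)) * (16 * e10))).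
      * apply small_bigor_const. intros h Hh. apply small_bigor_const. intros l Hl.
        (* There are 2^h cells, 2^(l+1) blocks and two signs. The powers of 2 cancel, and only the
           number of pairs (h, l), at most j^2, is left to pay for. *)
        replace (16 * e10) with (INR (2 ^ h) * (INR (2 ^ (l + 1)) *
          (4 * e10 * (/ 2) ^ (h + l) + 4 * e10 * (/ 2) ^ (h + l)))).
        2:{ rewrite !INR_pow2, !pow_add, !pow_inv. simpl. field. split; apply pow_nonzero; lra. }
        apply small_bigor_const. intros s Hs. apply small_bigor_const. intros i Hi.
        assert (Hlam : 0 < tilt j (h + l) <= 1 / 32).
        { split; [|apply Hj0; lia]. unfold tilt. apply Rmult_lt_0_compat; [apply exp_pos|].
          apply sqrt_lt_R0. apply Rdiv_lt_0_compat; [|apply pow_lt; lra].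
          assert (H := ln_ge_1 j ltac:(lia)). lra. }
        assert (Ht : forall sgn, sgn = 1 \/ sgn = -1 -> small (fun x => 0 < x < 1 /\
           threshold j (h + l) + INR K0 * 1 <= cell_sum n sigma h (centered_cell (2 ^ h) s sgn) (i * 2 ^ (j - l)) (2 ^ (j - l)) x)
           (4 * e10 * (/ 2) ^ (h + l))).
        { intros sgn Hsg. eapply small_sub; [|intros x Hx; exact Hx|
            apply (block_tail_prob j h l); [lia|assert (HH := depth_le j); lia]].
          apply (tail_bound n sigma h (centered_cell (2 ^ h) s sgn) 1 (tilt j (h + l))); try assumption; try lra.
          - intros s' _. apply centered_cell_abs; [apply pow2_nat_pos|assumption].
          - apply Rdiv_le_0_compat; [|apply lt_0_INR, pow2_nat_pos].
            assert (0 <= tilt j (h + l) ^ 2) by apply pow2_ge_0. lra.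
          - apply mgf_cell; auto. intros k. rewrite Nat.add_succ_r. apply Hgap. lia. }
        apply small_or; apply Ht; auto.
      * intros x [Hx [h [Hh [l [Hl [s [Hs [i [Hi H]]]]]]]]].
        exists h. split; [assumption|]. exists l. split; [assumption|]. exists s. split; [assumption|].
        exists i. split; [assumption|]. destruct H; [left|right]; auto.
      * assert (HS : INR (S (depth j)) <= INR j).
        { apply le_INR. unfold depth. assert (5 * j / 8 < j)%nat; [|lia].
          apply Nat.Div0.div_lt_upper_bound. lia. }
        assert (H0 : 0 <= INR (S (depth j))) by apply pos_INR.
        assert (Hjp : 3 <= INR j) by (replace 3 with (INR 3) by (simpl; ring); apply le_INR; lia).
        assert (HE : INR j ^ 2 = exp (2 * ln (INR j))).
        { replace (2 * ln (INR j)) with (ln (INR j) + ln (INR j)) by ring.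
          rewrite exp_plus, exp_ln by lra. ring. }
        apply Rle_trans with (INR j ^ 2 * (16 * e10)).
        { rewrite <- Rmult_assoc. apply Rmult_le_compat_r; [lra|].
          simpl pow. rewrite Rmult_1_r. apply Rmult_le_compat; assumption. }
        rewrite HE. unfold e10.
        replace (exp (2 * ln (INR j)) * (16 * exp (- (10 * ln (INR j))))) with
          (16 * (exp (2 * ln (INR j)) * exp (- (10 * ln (INR j))))) by ring.
        rewrite <- exp_plus. apply Rmult_le_compat_l; [lra|]. apply exp_le.
        assert (H := ln_ge_1 j ltac:(lia)). lra.
  - intros x Hx [J H]. exists J. intros j Hjj h l s i Hh Hl Hs Hi.
    apply Rnot_lt_le. intros Hlt. apply (H j Hjj). exists h. split; [lia|]. exists l. split; [lia|].
    exists s. split; [assumption|]. exists i. split; [assumption|].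
    rewrite cell_sum_opp_cell. unfold Rabs in Hlt.
    destruct (Rcase_abs (cell_sum n sigma h (centered_cell (2 ^ h) s 1) (i * 2 ^ (j - l)) (2 ^ (j - l)) x)); [right|left]; lra.
Qed.

Lemma cell_sum_add n sigma h c u a b x :
  cell_sum n sigma h c u (a + b) x = cell_sum n sigma h c u a x + cell_sum n sigma h c (u + a) b x.
Proof.
  unfold cell_sum. rewrite sumN_add. f_equal. apply sumN_ext. intros. now rewrite Nat.add_assoc.
Qed.

Lemma cell_sum_abs_le n sigma h c u v x B : (forall s, (s < 2 ^ h)%nat -> Rabs (c s) <= B) ->
  Rabs (cell_sum n sigma h c u v x) <= INR v * B.
Proof.
  intros H. unfold cell_sum. eapply Rle_trans; [apply sumN_abs|]. apply sumN_le_const.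
  intros. apply H, cell_index_lt.
Qed.

(** What the chaining over times cannot improve: one [K0] for every block used, and the final
    stretch, at most as long as the finest block. *)
Definition residue (K0 j : nat) : R := (INR j + 1) * INR K0 + 2 ^ (j - depth j).

(** The binary expansion of [N] truncated after the digit of weight 2^(j-l). *)
Definition cut (j N l : nat) : nat := (N / 2 ^ (j - l) * 2 ^ (j - l))%nat.

Lemma cut_step j N l : (S l <= j)%nat ->
  exists b, (b = 0 \/ b = 1)%nat /\ (cut j N (S l) = cut j N l + b * 2 ^ (j - S l))%nat /\
    (cut j N l = 2 * (N / 2 ^ (j - l)) * 2 ^ (j - S l))%nat.
Proof.
  intros Hl. unfold cut. replace (j - l)%nat with (S (j - S l)) by lia.
  set (d := (j - S l)%nat). assert (H2 := pow2_nat_pos d).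
  change (2 ^ S d)%nat with (2 * 2 ^ d)%nat.
  replace (N / (2 * 2 ^ d))%nat with (N / 2 ^ d / 2)%nat
    by (rewrite Nat.Div0.div_div; f_equal; lia).
  assert (Hd := Nat.div_mod_eq (N / 2 ^ d) 2).
  assert (Hm := Nat.mod_upper_bound (N / 2 ^ d) 2 ltac:(lia)).
  set (q := (N / 2 ^ d)%nat) in *. set (b := (q mod 2)%nat) in *. exists b.
  split; [lia|]. split; nia.
Qed.

(** Since exp(1/8) >= 9/8, the ratio is at most 8/9 and the series at most 8. Hence 96 = 8 * 12 and
    864 = 8 * 108 below. *)
Lemma geom_tail_sum M : sumN M (fun i => exp (- (INR (S i) / 8))) <= 8.
Proof.
  assert (H : sumN M (fun i => exp (- (INR (S i) / 8))) <= 8 * (1 - exp (- (INR M / 8)))).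
  { induction M as [|M IH]; [simpl; rewrite Rdiv_0_l, Ropp_0, exp_0; lra|].
    cbn [sumN]. rewrite S_INR. replace (- ((INR M + 1) / 8)) with (- (INR M / 8) + - (1 / 8)) by field.
    rewrite exp_plus. assert (0 < exp (- (INR M / 8))) by apply exp_pos.
    assert (exp (- (1 / 8)) <= 8 / 9).
    { rewrite exp_Ropp. replace (8 / 9) with (/ (9 / 8)) by field. apply Rinv_le_contravar; [lra|].
      assert (HH := exp_ge_1x (1 / 8)). lra. }
    set (a := exp (- (INR M / 8))) in *. set (b := exp (- (1 / 8))) in *.
    assert (a * b <= a * (8 / 9)) by (apply Rmult_le_compat_l; lra). lra. }
  assert (0 < exp (- (INR M / 8))) by apply exp_pos. lra.
Qed.

Lemma lil_scale_nonneg j : 0 <= lil_scale j.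
Proof. apply sqrt_pos. Qed.

(** Chaining along the binary digits of [N]: beyond the cut at level p each nonzero digit
    contributes one dyadic block of its level, and after [depth j] digits at most 2^(j - depth j)
    times remain. *)
Lemma cell_sum_after_cut n sigma K0 j x h s N p : dyadic_bounded n sigma K0 j x ->
  (h <= depth j)%nat -> (s < 2 ^ h)%nat -> (N < 2 ^ (j + 1))%nat -> (p <= depth j)%nat ->
  Rabs (cell_sum n sigma h (centered_cell (2 ^ h) s 1) (cut j N p) (N - cut j N p) x)
    <= 96 * lil_scale j * exp (- (INR (h + p) / 8)) + (INR j * INR K0 + 2 ^ (j - depth j)).
Proof.
  intros Hg Hh Hs HN Hp. assert (HHj := depth_le j).
  set (c := centered_cell (2 ^ h) s 1).
  assert (Hpart : forall d, (p + d <= depth j)%nat -> (cut j N p <= cut j N (p + d))%nat /\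
    Rabs (cell_sum n sigma h c (cut j N p) (cut j N (p + d) - cut j N p) x)
      <= sumN d (fun i => threshold j (h + p + S i) + INR K0)).
  { induction d as [|d IH]; intros Hd.
    - rewrite Nat.add_0_r, Nat.sub_diag. split; [lia|]. unfold cell_sum. simpl. rewrite Rabs_R0. lra.
    - destruct (IH ltac:(lia)) as [I1 I2].
      destruct (cut_step j N (p + d) ltac:(lia)) as [b [Hb [E1 E2]]].
      rewrite Nat.add_succ_r. split; [lia|].
      replace (cut j N (S (p + d)) - cut j N p)%nat with
        ((cut j N (p + d) - cut j N p) + b * 2 ^ (j - S (p + d)))%nat by lia.
      rewrite cell_sum_add.
      replace (cut j N p + (cut j N (p + d) - cut j N p))%nat with (cut j N (p + d)) by lia.
      cbn [sumN]. eapply Rle_trans; [apply Rabs_triang|]. apply Rplus_le_compat; [assumption|].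
      assert (H0 : 0 <= threshold j (h + p + S d) + INR K0).
      { unfold threshold. assert (0 <= lil_scale j) by apply lil_scale_nonneg.
        assert (0 < exp (- (INR (h + p + S d) / 8))) by apply exp_pos.
        assert (0 <= INR K0) by apply pos_INR. nra. }
      destruct Hb as [-> | ->].
      + unfold cell_sum. simpl. rewrite Rabs_R0. assumption.
      + rewrite Nat.mul_1_l, E2.
        replace (h + p + S d)%nat with (h + S (p + d))%nat by lia.
        apply Hg; try lia. assert (H2 := pow2_nat_pos (j - (p + d))).
        assert (N / 2 ^ (j - (p + d)) < 2 ^ (p + d + 1))%nat.
        { apply Nat.Div0.div_lt_upper_bound. rewrite <- Nat.pow_add_r.
          replace (j - (p + d) + (p + d + 1))%nat with (j + 1)%nat by lia. assumption. }
        replace (S (p + d) + 1)%nat with (S (p + d + 1)) by lia. simpl. lia. }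
  destruct (Hpart (depth j - p)%nat ltac:(lia)) as [P1 P2].
  replace (p + (depth j - p))%nat with (depth j) in * by lia.
  assert (HcN : (cut j N (depth j) <= N)%nat /\ (N - cut j N (depth j) <= 2 ^ (j - depth j))%nat).
  { unfold cut. assert (Hd := Nat.div_mod_eq N (2 ^ (j - depth j))).
    assert (Hm := Nat.mod_upper_bound N (2 ^ (j - depth j)) ltac:(assert (H := pow2_nat_pos (j - depth j)); lia)).
    split; nia. }
  replace (N - cut j N p)%nat with ((cut j N (depth j) - cut j N p) + (N - cut j N (depth j)))%nat by lia.
  rewrite cell_sum_add. replace (cut j N p + (cut j N (depth j) - cut j N p))%nat with (cut j N (depth j)) by lia.
  eapply Rle_trans; [apply Rabs_triang|].
  assert (Q1 : Rabs (cell_sum n sigma h c (cut j N (depth j)) (N - cut j N (depth j)) x) <= 2 ^ (j - depth j)).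
  { eapply Rle_trans; [apply (cell_sum_abs_le _ _ _ _ _ _ _ 1)|].
    - intros. apply centered_cell_abs; [apply pow2_nat_pos|now left].
    - rewrite Rmult_1_r, <- INR_pow2. apply le_INR. lia. }
  assert (Q2 : sumN (depth j - p) (fun i => threshold j (h + p + S i) + INR K0) <=
     96 * lil_scale j * exp (- (INR (h + p) / 8)) + INR j * INR K0).
  { rewrite sumN_plus, sumN_const.
    rewrite (sumN_ext _ _ (fun i => (12 * lil_scale j * exp (- (INR (h + p) / 8))) * exp (- (INR (S i) / 8)))).
    2:{ intros i _. unfold threshold. rewrite plus_INR.
        replace (- ((INR (h + p) + INR (S i)) / 8)) with (- (INR (h + p) / 8) + - (INR (S i) / 8)) by field.
        rewrite exp_plus. ring. }
    rewrite sumN_scal. assert (G := geom_tail_sum (depth j - p)).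
    assert (0 <= 12 * lil_scale j * exp (- (INR (h + p) / 8))).
    { assert (0 <= lil_scale j) by apply lil_scale_nonneg. assert (0 < exp (- (INR (h + p) / 8))) by apply exp_pos. nra. }
    assert (INR (depth j - p) <= INR j) by (apply le_INR; lia).
    assert (0 <= INR K0) by apply pos_INR. nra. }
  lra.
Qed.

(** The times below 2^j form the block of level 0 and the rest starts at [cut j N 0], whence 108 =
    12 + 96. *)
Lemma cell_sum_initial n sigma K0 j x h s N : dyadic_bounded n sigma K0 j x ->
  (h <= depth j)%nat -> (s < 2 ^ h)%nat -> (2 ^ j <= N < 2 ^ (j + 1))%nat ->
  Rabs (cell_sum n sigma h (centered_cell (2 ^ h) s 1) 0 N x)
    <= 108 * lil_scale j * exp (- (INR h / 8)) + residue K0 j.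
Proof.
  intros Hg Hh Hs HN.
  assert (E : cut j N 0 = (2 ^ j)%nat).
  { unfold cut. rewrite Nat.sub_0_r. replace (N / 2 ^ j)%nat with 1%nat; [lia|].
    apply (Nat.div_unique N (2 ^ j) 1 (N - 2 ^ j)); rewrite Nat.pow_add_r in HN; simpl in HN; lia. }
  replace N with (2 ^ j + (N - 2 ^ j))%nat by lia. rewrite cell_sum_add, Nat.add_0_l.
  eapply Rle_trans; [apply Rabs_triang|].
  assert (H1 := cell_sum_after_cut n sigma K0 j x h s N O Hg Hh Hs ltac:(lia) ltac:(lia)).
  rewrite E, Nat.add_0_r in H1.
  assert (H2 : Rabs (cell_sum n sigma h (centered_cell (2 ^ h) s 1) 0 (2 ^ j) x) <= threshold j h + INR K0).
  { assert (HH := Hg h O s O Hh ltac:(lia) Hs ltac:(simpl; lia)).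
    rewrite Nat.mul_0_l, Nat.sub_0_r, Nat.add_0_r in HH. exact HH. }
  unfold threshold in H2. unfold residue. lra.
Qed.

Lemma residue_small (C eta : R) (K0 : nat) : 0 <= C -> 0 < eta ->
  exists j0, forall j, (j0 <= j)%nat -> C * INR j * (residue K0 j + 2 ^ (j - depth j + 1)) <= eta * lil_scale j.
Proof.
  intros HC He. set (K := INR K0). assert (HK : 0 <= K) by apply pos_INR.
  (* The residue is about 2^(3j/8) and [lil_scale j] at least 2^(j/2). The spare factor 2^(j/8) is
     the fourth power of exp(c j), which beats the polynomial in j. *)
  set (c := ln 2 / 32). assert (Hc : 0 < c) by (unfold c; assert (H := ln2_lower); lra).
  set (D := C * (K + 6) * 2).
  assert (HD : 0 <= D) by (unfold D; apply Rmult_le_pos; [nra|lra]).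
  destruct (nat_above (D / (eta * c ^ 4))) as [J HJ]. exists (J + 3)%nat. intros j Hj3.
  specialize (HJ j ltac:(lia)).
  assert (Hc4 : 0 < c ^ 4) by (apply pow_lt; assumption).
  apply Rlt_div_l in HJ; [|nra].
  assert (Hjp : 3 <= INR j) by (replace 3 with (INR 3) by (simpl; ring); apply le_INR; lia).
  set (x := INR j) in *.
  assert (E1 : 2 ^ (j - depth j) <= 2 * exp (3 / 8 * x * ln 2)).
  { rewrite pow2_exp. replace 2 with (exp (ln 2)) at 2 by (apply exp_ln; lra).
    rewrite <- exp_plus. apply exp_le. rewrite minus_INR by apply depth_le. fold x.
    assert (5 * j < 8 * S (5 * j / 8))%nat by (apply Nat.mul_succ_div_gt; lia).
    fold (depth j) in H. apply lt_INR in H. rewrite !mult_INR, (S_INR (depth j)) in H. fold x in H.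
    simpl (INR 5) in H. simpl (INR 8) in H. assert (H2 := ln2_lower).
    apply Rle_trans with ((1 + 3 / 8 * x) * ln 2); [apply Rmult_le_compat_r; lra|lra]. }
  assert (E2 : exp (1 / 2 * x * ln 2) <= lil_scale j).
  { unfold lil_scale. rewrite <- (sqrt_square (exp (1 / 2 * x * ln 2))) by (left; apply exp_pos).
    apply sqrt_le_1_alt. rewrite <- exp_plus. rewrite pow2_exp. fold x.
    replace (1 / 2 * x * ln 2 + 1 / 2 * x * ln 2) with (x * ln 2) by field.
    assert (H := ln_ge_1 j ltac:(lia)). fold x in H. assert (0 < exp (x * ln 2)) by apply exp_pos. nra. }
  assert (E3 : exp (1 / 2 * x * ln 2) = exp (3 / 8 * x * ln 2) * exp (c * x) ^ 4).
  { rewrite exp_pow_nat, <- exp_plus. f_equal. unfold c. simpl. field. }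
  assert (E4 : (c * x) ^ 4 <= exp (c * x) ^ 4).
  { apply pow_incr. split; [nra|]. assert (H := exp_ge_1x (c * x)). lra. }
  set (e3 := exp (3 / 8 * x * ln 2)) in *.
  assert (He3 : 1 <= e3).
  { unfold e3. rewrite <- exp_0. apply exp_le. assert (H := ln2_lower). nra. }
  assert (Hrem : residue K0 j + 2 ^ (j - depth j + 1) <= (K + 6) * (2 * x) * e3).
  { unfold residue. fold K x. rewrite pow_add. simpl (2 ^ 1).
    assert ((x + 1) * K <= 2 * x * K * e3).
    { apply Rle_trans with (2 * x * K); [nra|]. assert (0 <= x * K) by nra.
      assert (x * K * 1 <= x * K * e3) by (apply Rmult_le_compat_l; lra). lra. }
    assert (6 * e3 <= 12 * x * e3) by nra. nra. }
  apply Rle_trans with (C * x * ((K + 6) * (2 * x) * e3)).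
  { apply Rmult_le_compat_l; [nra|assumption]. }
  apply Rle_trans with (eta * (e3 * (c * x) ^ 4)).
  - replace (C * x * ((K + 6) * (2 * x) * e3)) with (e3 * (D * x ^ 2)) by (unfold D; ring).
    replace (eta * (e3 * (c * x) ^ 4)) with (e3 * (x ^ 2 * (x * (x * (eta * c ^ 4))))) by ring.
    apply Rmult_le_compat_l; [lra|]. rewrite (Rmult_comm D). apply Rmult_le_compat_l; [apply pow2_ge_0|].
    nra.
  - apply Rmult_le_compat_l; [lra|]. rewrite E3 in E2. nra.
Qed.

(** * Sampling a function of bounded variation on dyadic grids *)

Definition var_le (f : R -> R) (V : R) : Prop :=
  forall (m : nat) (t : nat -> R),
    0 <= t O -> t m <= 1 -> (forall i, (i < m)%nat -> t i <= t (S i)) ->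
    sumN m (fun i => Rabs (f (t (S i)) - f (t i))) <= V.

Lemma var_le_nonneg f V : var_le f V -> 0 <= V.
Proof. intros H. apply (H O (fun _ => 0)); try lra. intros; lia. Qed.

Lemma sumN_double K g : sumN (2 * K) g = sumN K (fun s => g (2 * s)%nat) + sumN K (fun s => g (2 * s + 1)%nat).
Proof.
  induction K as [|K IH]; [simpl; lra|].
  replace (2 * S K)%nat with (S (S (2 * K))) by lia. cbn [sumN]. rewrite IH.
  replace (2 * K + 1)%nat with (S (2 * K)) by lia. lra.
Qed.

(* Among the increments of the partition 0, z_0, 1/K, z_1, 2/K, ... every other one is dropped. *)
Lemma var_pick f V K (z : nat -> R) : var_le f V -> (0 < K)%nat ->
  (forall s, (s < K)%nat -> INR s / INR K <= z s <= INR (S s) / INR K) ->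
  sumN K (fun s => Rabs (f (z s) - f (INR s / INR K))) <= V.
Proof.
  intros HV HK Hz. assert (HK' : 0 < INR K) by now apply lt_0_INR.
  set (t := fun i => if Nat.even i then INR (i / 2) / INR K else z (i / 2)%nat).
  assert (T0 : forall s, t (2 * s)%nat = INR s / INR K).
  { intros s. unfold t. rewrite Nat.even_mul. simpl orb. cbv iota. do 2 f_equal.
    rewrite Nat.mul_comm. apply Nat.div_mul. lia. }
  assert (T1 : forall s, t (2 * s + 1)%nat = z s).
  { intros s. unfold t. rewrite Nat.even_add, Nat.even_mul. simpl. f_equal.
    symmetry. apply (Nat.div_unique _ 2 s 1); lia. }
  assert (H := HV (2 * K)%nat t).
  assert (B : sumN (2 * K) (fun i => Rabs (f (t (S i)) - f (t i))) <= V).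
  { apply H.
    - replace O with (2 * 0)%nat by lia. rewrite T0. simpl. rewrite Rdiv_0_l. lra.
    - rewrite T0. apply Rle_div_l; lra.
    - intros i Hi. destruct (Nat.Even_or_Odd i) as [[s ->]|[s ->]].
      + replace (S (2 * s)) with (2 * s + 1)%nat by lia. rewrite T0, T1. apply Hz. lia.
      + replace (S (2 * s + 1)) with (2 * (S s))%nat by lia. rewrite T0, T1. apply Hz. lia. }
  rewrite sumN_double in B.
  assert (0 <= sumN K (fun s => Rabs (f (t (S (2 * s + 1))) - f (t (2 * s + 1)%nat))))
    by (apply sumN_nonneg; intros; apply Rabs_pos).
  rewrite (sumN_ext K _ (fun s => Rabs (f (t (S (2 * s))) - f (t (2 * s)%nat)))).
  2:{ intros s _. replace (S (2 * s)) with (2 * s + 1)%nat by lia. now rewrite T0, T1. }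
  lra.
Qed.

(** The oscillation is a supremum that need not be attained. A point reaching half of it is chosen
    in every cell, and [var_pick] is applied to these points, whence 2 V. *)
Lemma osc_exists f V K : var_le f V -> (0 < K)%nat ->
  exists om : nat -> R, (forall s, 0 <= om s) /\
    (forall s y, (s < K)%nat -> INR s / INR K <= y <= INR (S s) / INR K ->
       Rabs (f y - f (INR s / INR K)) <= om s) /\
    sumN K om <= 2 * V.
Proof.
  intros HV HK. assert (HK' : 0 < INR K) by now apply lt_0_INR.
  assert (Hin : forall s, (s < K)%nat -> 0 <= INR s / INR K /\ INR s / INR K <= INR (S s) / INR K /\
     INR (S s) / INR K <= 1).
  { intros s Hs. repeat split.
    - apply Rdiv_le_0_compat; [apply pos_INR|assumption].
    - apply Rmult_le_compat_r; [left; now apply Rinv_0_lt_compat|]. rewrite S_INR; lra.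
    - apply Rle_div_l; [assumption|]. rewrite Rmult_1_l. apply le_INR. lia. }
  assert (Hz : forall s, exists z, (s < K)%nat -> INR s / INR K <= z <= INR (S s) / INR K /\
     forall y, INR s / INR K <= y <= INR (S s) / INR K ->
       Rabs (f y - f (INR s / INR K)) <= 2 * Rabs (f z - f (INR s / INR K))).
  { intros s. destruct (lt_dec s K) as [Hs|Hs]; [|exists 0; intros; lia].
    set (a := INR s / INR K) in *. set (b := INR (S s) / INR K) in *.
    destruct (Hin s Hs) as [I1 [I2 I3]]. fold a b in I1, I2, I3.
    set (E := fun v => exists y, a <= y <= b /\ v = Rabs (f y - f a)).
    assert (HE : forall y, a <= y <= b -> Rabs (f y - f a) <= V).
    { intros y Hy. assert (H := HV 1%nat (fun i => match i with O => a | _ => y end)).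
      simpl in H. rewrite Rplus_0_l in H. apply H; try lra. intros [|i]; [lra|lia]. }
    destruct (completeness E) as [m [Hm1 Hm2]].
    - exists V. intros v [y [Hy ->]]. auto.
    - exists (Rabs (f a - f a)), a. split; [lra|reflexivity].
    - assert (Hm0 : 0 <= m).
      { rewrite <- Rabs_R0, <- (Rminus_diag (f a)). apply Hm1. exists a. split; [lra|reflexivity]. }
      (* If the supremum is 0, no point strictly exceeds half of it, and the left endpoint serves
         instead. *)
      destruct (Req_dec m 0) as [E0|E0].
      + exists a. intros _. split; [lra|]. intros y Hy.
        assert (Rabs (f y - f a) <= m) by (apply Hm1; now exists y).
        assert (0 <= Rabs (f a - f a)) by apply Rabs_pos. lra.
      + assert (exists y, a <= y <= b /\ m / 2 < Rabs (f y - f a)) as [z [Hz1 Hz2]].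
        { apply NNPP. intros Hn. assert (m <= m / 2); [|lra]. apply Hm2.
          intros v [y [Hy ->]]. apply Rnot_lt_le. intros Hlt. apply Hn. now exists y. }
        exists z. intros _. split; [assumption|]. intros y Hy.
        assert (Rabs (f y - f a) <= m) by (apply Hm1; now exists y). lra. }
  pose (z := fun s => proj1_sig (constructive_indefinite_description _ (Hz s))).
  assert (Hz' : forall s, (s < K)%nat -> INR s / INR K <= z s <= INR (S s) / INR K /\
     forall y, INR s / INR K <= y <= INR (S s) / INR K ->
       Rabs (f y - f (INR s / INR K)) <= 2 * Rabs (f (z s) - f (INR s / INR K))).
  { intros s. unfold z. destruct (constructive_indefinite_description _ (Hz s)) as [z' Hz']. exact Hz'. }
  exists (fun s => 2 * Rabs (f (z s) - f (INR s / INR K))). repeat split.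
  - intros s. assert (H := Rabs_pos (f (z s) - f (INR s / INR K))). lra.
  - intros s y Hs Hy. now apply Hz'.
  - rewrite sumN_scal. assert (H := var_pick f V K z HV HK ltac:(intros; now apply Hz')). lra.
Qed.

Lemma Rabs_sum_mul_le K (d e : nat -> R) E V :
  (forall s, (s < K)%nat -> Rabs (e s) <= E) -> 0 <= E ->
  sumN K (fun s => Rabs (d s)) <= V -> Rabs (sumN K (fun s => d s * e s)) <= V * E.
Proof.
  intros He HE Hd. eapply Rle_trans; [apply sumN_abs|].
  apply Rle_trans with (sumN K (fun s => Rabs (d s) * E)).
  - apply sumN_le. intros s Hs. rewrite Rabs_mult. apply Rmult_le_compat_l; [apply Rabs_pos|auto].
  - rewrite sumN_scal_r. now apply Rmult_le_compat_r.
Qed.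

Definition grid (f : R -> R) (h s : nat) : R := f (INR s / INR (2 ^ h)).

Definition mean (K : nat) (c : nat -> R) : R := sumN K c / INR K.

Lemma grid_double f h s : grid f (S h) (2 * s) = grid f h s.
Proof.
  unfold grid. f_equal. rewrite Nat.pow_succ_r', !mult_INR. simpl (INR 2).
  assert (0 < INR (2 ^ h)) by apply lt_0_INR, pow2_nat_pos. field. lra.
Qed.

(* Passing from level [h] to level [h + 1] changes the step function only on the right halves of the
   cells, by increments of [f] whose absolute values add up to at most [V]. *)
Lemma dyadic_sum_bv f V N (y : nat -> R) (d : nat -> nat -> nat) (E : nat -> R) (m e : nat) I :
  var_le f V -> (forall h j, (d h j < 2 ^ h)%nat) -> (forall h j, (d (S h) j / 2 = d h j)%nat) ->
  (forall h j, INR (d h j) / INR (2 ^ h) <= y j <= INR (S (d h j)) / INR (2 ^ h)) ->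
  (forall h, 0 <= E h) ->
  (forall h s, (h <= m + e)%nat -> (s < 2 ^ h)%nat ->
     Rabs (sumN N (fun j => (if Nat.eqb (d h j) s then 1 else 0) - / INR (2 ^ h))) <= E h) ->
  Rabs (I - mean (2 ^ (m + e)) (grid f (m + e))) <= 2 * V * / INR (2 ^ (m + e)) ->
  Rabs (sumN N (fun j => f (y j)) - sumN N (fun j => grid f m (d m j))
        - INR N * (I - mean (2 ^ m) (grid f m)))
    <= V * (sumN e (fun i => E (m + S i)%nat) + 2 * E (m + e)%nat + 4 * INR N * / INR (2 ^ (m + e))).
Proof.
  intros HV Hd Hdd Hy HE Hdev HI. assert (HV0 := var_le_nonneg f V HV).
  assert (Hcell : forall h (phi : nat -> R), sumN N (fun j => phi (d h j)) =
     sumN (2 ^ h) (fun s => phi s * sumN N (fun j => if Nat.eqb (d h j) s then 1 else 0))).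
  { intros h phi.
    rewrite (sumN_ext (2 ^ h) _ (fun s => sumN N (fun j => if Nat.eqb s (d h j) then phi s else 0))).
    2:{ intros s _. rewrite <- sumN_scal. apply sumN_ext. intros j _. rewrite (Nat.eqb_sym s).
        destruct (Nat.eqb (d h j) s); ring. }
    rewrite <- sumN_swap. apply sumN_ext. intros j _. rewrite sumN_single.
    specialize (Hd h j). destruct (Nat.ltb_spec (d h j) (2 ^ h)); [reflexivity|lia]. }
  assert (Hcnt : forall h s, sumN N (fun j => (if Nat.eqb (d h j) s then 1 else 0) - / INR (2 ^ h)) =
     sumN N (fun j => if Nat.eqb (d h j) s then 1 else 0) - INR N * / INR (2 ^ h)).
  { intros. rewrite sumN_minus, sumN_const. reflexivity. }
  (* The centred sums of the sampled values, followed from level m up to level m + e. *)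
  set (S0 := fun h => sumN N (fun j => grid f h (d h j)) - INR N * mean (2 ^ h) (grid f h)).
  assert (Hstep : forall h, (S h <= m + e)%nat -> Rabs (S0 (S h) - S0 h) <= V * E (S h)).
  { intros h Hh. assert (H2 : 0 < INR (2 ^ h)) by apply lt_0_INR, pow2_nat_pos.
    set (del := fun s => grid f (S h) (2 * s + 1) - grid f h s).
    assert (Hodd : forall s, (s < 2 ^ h)%nat -> (2 * s + 1 < 2 ^ S h)%nat) by (intros; rewrite Nat.pow_succ_r'; lia).
    assert (E1 : sumN N (fun j => grid f (S h) (d (S h) j)) - sumN N (fun j => grid f h (d h j)) =
       sumN (2 ^ h) (fun s => del s * sumN N (fun j => if Nat.eqb (d (S h) j) (2 * s + 1) then 1 else 0))).
    { rewrite <- sumN_minus.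
      rewrite (sumN_ext N _ (fun j => if Nat.odd (d (S h) j) then del (d (S h) j / 2)%nat else 0)).
      2:{ intros j _. rewrite <- (Hdd h j). set (D := d (S h) j).
          destruct (Nat.Even_or_Odd D) as [[s Hs]|[s Hs]].
          - replace (Nat.odd D) with false.
            2:{ rewrite Hs, Nat.odd_mul. reflexivity. }
            rewrite Hs. rewrite (Nat.mul_comm 2 s), Nat.div_mul by lia.
            rewrite (Nat.mul_comm s 2), grid_double. lra.
          - replace (Nat.odd D) with true.
            2:{ rewrite Hs, Nat.odd_add, Nat.odd_mul. reflexivity. }
            replace (D / 2)%nat with s by (apply (Nat.div_unique _ 2 s 1); lia).
            unfold del. rewrite Hs. reflexivity. }
      rewrite (sumN_ext (2 ^ h) _ (fun s => sumN N (fun j =>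
         if Nat.eqb s (d (S h) j / 2) then (if Nat.odd (d (S h) j) then del s else 0) else 0))).
      2:{ intros s _. rewrite <- sumN_scal. apply sumN_ext. intros j _. set (D := d (S h) j).
          destruct (Nat.Even_or_Odd D) as [[q Hq]|[q Hq]].
          - replace (Nat.odd D) with false by (rewrite Hq, Nat.odd_mul; reflexivity).
            destruct (Nat.eqb_spec D (2 * s + 1)); [lia|]. destruct (Nat.eqb s (D / 2)); ring.
          - replace (Nat.odd D) with true by (rewrite Hq, Nat.odd_add, Nat.odd_mul; reflexivity).
            replace (D / 2)%nat with q by (apply (Nat.div_unique _ 2 q 1); lia).
            destruct (Nat.eqb_spec D (2 * s + 1)), (Nat.eqb_spec s q); try lia; ring. }
      rewrite <- sumN_swap. apply sumN_ext. intros j _.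
      rewrite (sumN_single (2 ^ h) (d (S h) j / 2) (fun s => if Nat.odd (d (S h) j) then del s else 0)).
      rewrite Hdd. specialize (Hd h j). destruct (Nat.ltb_spec (d h j) (2 ^ h)); [reflexivity|lia]. }
    assert (E2 : mean (2 ^ S h) (grid f (S h)) - mean (2 ^ h) (grid f h) =
       sumN (2 ^ h) del * / INR (2 ^ S h)).
    { unfold mean. rewrite Nat.pow_succ_r'. rewrite sumN_double, mult_INR. simpl (INR 2).
      rewrite (sumN_ext _ (fun s => grid f (S h) (2 * s)) (grid f h)) by (intros; apply grid_double).
      unfold del. rewrite sumN_minus. field. lra. }
    assert (E3 : S0 (S h) - S0 h = sumN (2 ^ h) (fun s => del s *
        sumN N (fun j => (if Nat.eqb (d (S h) j) (2 * s + 1) then 1 else 0) - / INR (2 ^ S h)))).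
    { rewrite (sumN_ext _ _ (fun s => del s * sumN N (fun j => if Nat.eqb (d (S h) j) (2 * s + 1) then 1 else 0)
        - (INR N * / INR (2 ^ S h)) * del s)).
      2:{ intros s _. rewrite Hcnt. ring. }
      rewrite sumN_minus, sumN_scal, <- E1. unfold S0.
      replace (sumN N (fun j => grid f (S h) (d (S h) j)) - INR N * mean (2 ^ S h) (grid f (S h)) -
        (sumN N (fun j => grid f h (d h j)) - INR N * mean (2 ^ h) (grid f h))) with
        (sumN N (fun j => grid f (S h) (d (S h) j)) - sumN N (fun j => grid f h (d h j))
          - INR N * (mean (2 ^ S h) (grid f (S h)) - mean (2 ^ h) (grid f h))) by ring.
      rewrite E2. ring. }
    rewrite E3. apply Rabs_sum_mul_le; [|apply HE|].
    - intros s Hs. apply Hdev; [assumption|now apply Hodd].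
    (* The increments run from the left endpoint of a cell of level h to its midpoint, so [var_pick]
       bounds their total by V. *)
    - assert (HP := var_pick f V (2 ^ h) (fun s => INR (2 * s + 1) / INR (2 ^ S h)) HV (pow2_nat_pos h)).
      apply HP. intros s Hs. rewrite Nat.pow_succ_r'. rewrite plus_INR, (S_INR s), !mult_INR. change (INR 2) with 2. change (INR 1) with 1.
      replace ((2 * INR s + 1) / (2 * INR (2 ^ h))) with ((INR s + 1 / 2) / INR (2 ^ h)) by (field; lra).
      assert (0 < / INR (2 ^ h)) by now apply Rinv_0_lt_compat. unfold Rdiv. split; apply Rmult_le_compat_r; lra. }
  assert (Hall : forall k, (k <= e)%nat -> Rabs (S0 (m + k)%nat - S0 m) <= V * sumN k (fun i => E (m + S i)%nat)).
  { induction k as [|k IH]; intros Hk.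
    - rewrite Nat.add_0_r, Rminus_diag, Rabs_R0. simpl. lra.
    - cbn [sumN]. replace (S0 (m + S k)%nat - S0 m) with
        ((S0 (S (m + k)) - S0 (m + k)%nat) + (S0 (m + k)%nat - S0 m)) by (rewrite Nat.add_succ_r; ring).
      eapply Rle_trans; [apply Rabs_triang|]. specialize (IH ltac:(lia)).
      specialize (Hstep (m + k)%nat ltac:(lia)). rewrite Nat.add_succ_r. lra. }
  set (H := (m + e)%nat) in *.
  destruct (osc_exists f V (2 ^ H) HV (pow2_nat_pos H)) as [om [O1 [O2 O3]]].
  assert (HiH : 0 < / INR (2 ^ H)) by (apply Rinv_0_lt_compat, lt_0_INR, pow2_nat_pos).
  (* At the finest level the true values replace the sampled ones. In each cell the error is the
     oscillation times the number of points, which is at most E + N / 2^H. *)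
  assert (Hlast : Rabs (sumN N (fun j => f (y j)) - sumN N (fun j => grid f H (d H j)))
     <= 2 * V * (E H + INR N * / INR (2 ^ H))).
  { rewrite <- sumN_minus. eapply Rle_trans; [apply sumN_abs|].
    apply Rle_trans with (sumN N (fun j => om (d H j))).
    - apply sumN_le. intros j _. apply O2; [apply Hd|apply Hy].
    - rewrite Hcell. eapply Rle_trans; [|apply Rmult_le_compat_r; [|apply O3]].
      + rewrite <- sumN_scal_r. apply sumN_le. intros s Hs. apply Rmult_le_compat_l; [apply O1|].
        specialize (Hdev H s ltac:(lia) Hs). rewrite Hcnt in Hdev. apply Rabs_le_between in Hdev. lra.
      + specialize (HE H). assert (0 <= INR N) by apply pos_INR. nra. }
  assert (HA := Hall e ltac:(lia)). fold H in HA.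
  replace (sumN N (fun j => f (y j)) - sumN N (fun j => grid f m (d m j)) - INR N * (I - mean (2 ^ m) (grid f m)))
    with ((sumN N (fun j => f (y j)) - sumN N (fun j => grid f H (d H j))) + (S0 H - S0 m)
      + - (INR N * (I - mean (2 ^ H) (grid f H)))) by (unfold S0; ring).
  eapply Rle_trans; [apply Rabs_triang|]. rewrite Rabs_Ropp.
  assert (HB := Rabs_triang (sumN N (fun j => f (y j)) - sumN N (fun j => grid f H (d H j))) (S0 H - S0 m)).
  assert (HC : Rabs (INR N * (I - mean (2 ^ H) (grid f H))) <= INR N * (2 * V * / INR (2 ^ H))).
  { rewrite Rabs_mult, (Rabs_pos_eq (INR N)) by apply pos_INR.
    apply Rmult_le_compat_l; [apply pos_INR|assumption]. }
  lra.
Qed.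

(** * The upper bound for step functions *)

Lemma frac_part_nat_floor y : 0 <= y -> y = INR (nat_floor y) + frac_part y.
Proof.
  intros Hy. unfold frac_part, nat_floor.
  assert (0 <= Int_part y)%Z.
  { destruct (base_Int_part y) as [H1 H2]. apply le_IZR.
    destruct (Z_lt_le_dec (Int_part y) 0) as [H|H]; [|now apply IZR_le].
    assert (H3 : (Int_part y <= -1)%Z) by lia. apply IZR_le in H3. lra. }
  rewrite INR_IZR_INZ, Z2Nat.id by assumption. ring.
Qed.

Lemma frac_part_range y : 0 <= frac_part y < 1.
Proof. destruct (base_fp y). lra. Qed.

Lemma cell_index_frac h N x : 0 <= x -> cell_index h N x = nat_floor (INR (2 ^ h) * frac_part (INR N * x)).
Proof.
  intros Hx. set (y := frac_part (INR N * x)). assert (Hy := frac_part_range (INR N * x)). fold y in Hy.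
  assert (HN : 0 <= INR N * x) by (apply Rmult_le_pos; [apply pos_INR|assumption]).
  assert (E := frac_part_nat_floor _ HN). fold y in E. set (z := nat_floor (INR N * x)) in *.
  assert (H2 : 0 < INR (2 ^ h)) by apply lt_0_INR, pow2_nat_pos.
  assert (Hm := nat_floor_spec (INR (2 ^ h) * y) ltac:(nra)). set (m := nat_floor (INR (2 ^ h) * y)) in *.
  unfold cell_index. rewrite (nat_floor_unique _ (2 ^ h * z + m)).
  - rewrite Nat.add_comm, Nat.mul_comm, Nat.Div0.mod_add. apply Nat.mod_small.
    apply INR_lt. nra.
  - rewrite plus_INR, !mult_INR, Rmult_assoc, E. lra.
Qed.

Lemma cell_index_half h N x : 0 <= x -> (cell_index (S h) N x / 2 = cell_index h N x)%nat.
Proof.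
  intros Hx. rewrite !cell_index_frac by assumption.
  assert (Hy := frac_part_range (INR N * x)).
  assert (H2 : 0 < INR (2 ^ S h)) by apply lt_0_INR, pow2_nat_pos.
  rewrite <- nat_floor_div; [|apply Rmult_le_pos; lra|lia]. f_equal.
  rewrite Nat.pow_succ_r', mult_INR. change (INR 2) with 2. field.
Qed.

Lemma cell_index_bounds h N x : 0 <= x ->
  INR (cell_index h N x) / INR (2 ^ h) <= frac_part (INR N * x) < INR (S (cell_index h N x)) / INR (2 ^ h).
Proof.
  intros Hx. rewrite cell_index_frac by assumption. assert (Hy := frac_part_range (INR N * x)).
  assert (H2 : 0 < INR (2 ^ h)) by apply lt_0_INR, pow2_nat_pos.
  assert (H := nat_floor_spec (INR (2 ^ h) * frac_part (INR N * x)) ltac:(nra)). rewrite S_INR.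
  split; [apply Rle_div_l|apply Rlt_div_r]; lra.
Qed.

Lemma periodic_frac (f : R -> R) y : (forall x, f (x + 1) = f x) -> 0 <= y -> f (frac_part y) = f y.
Proof.
  intros Hf Hy.
  assert (H : forall k z, f (z + INR k) = f z).
  { induction k as [|k IH]; intros z; [now rewrite Rplus_0_r|].
    rewrite S_INR, <- Rplus_assoc, Hf. apply IH. }
  rewrite (frac_part_nat_floor y Hy) at 2. rewrite Rplus_comm. now rewrite H.
Qed.

Definition centered (K : nat) (c : nat -> R) (s : nat) : R := c s - mean K c.

Lemma exp_neg_sum_le m e : sumN e (fun i => exp (- (INR (m + S i) / 8))) <= 8 * exp (- (INR m / 8)).
Proof.
  rewrite (sumN_ext e _ (fun i => exp (- (INR m / 8)) * exp (- (INR (S i) / 8)))).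
  2:{ intros i _. rewrite <- exp_plus. f_equal. rewrite plus_INR. field. }
  rewrite sumN_scal. assert (H := geom_tail_sum e). assert (0 < exp (- (INR m / 8))) by apply exp_pos. nra.
Qed.

(** The index j0 is chosen before [f] and depends neither on it nor on [V]; this uniformity is what
    the supremum over all arcs in the discrepancy requires. The constant is 1080 = 864 + 2 * 108. *)
Lemma dyadic_approx K0 m eta : 0 < eta ->
  exists j0, forall n sigma f V x j N I, (j0 <= j)%nat -> 0 < x < 1 ->
    (forall y, f (y + 1) = f y) -> var_le f V -> dyadic_bounded n sigma K0 j x ->
    (2 ^ j <= N < 2 ^ (j + 1))%nat ->
    (forall h, Rabs (I - mean (2 ^ h) (grid f h)) <= 2 * V * / INR (2 ^ h)) ->
    Rabs (sumN N (fun k => f (INR (n (sigma k)) * x)) - INR N * I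
          - cell_sum n sigma m (centered (2 ^ m) (grid f m)) 0 N x)
      <= V * ((1080 * exp (- (INR m / 8)) + eta) * lil_scale j).
Proof.
  intros He. destruct (residue_small 4 eta K0 ltac:(lra) He) as [j1 Hj1].
  exists (j1 + 2 * m + 3)%nat. intros n sigma f V x j N I Hjj Hx Hf HV Hg HN HI.
  assert (HmH : (m <= depth j)%nat).
  { unfold depth. apply Nat.div_le_lower_bound; lia. }
  set (e := (depth j - m)%nat).
  assert (HmH' : (m + e = depth j)%nat) by (unfold e; lia).
  set (E := fun h => 108 * lil_scale j * exp (- (INR h / 8)) + residue K0 j).
  assert (HW := lil_scale_nonneg j).
  assert (HRem : 0 <= residue K0 j).
  { unfold residue. assert (0 <= (INR j + 1) * INR K0) by (apply Rmult_le_pos; [|apply pos_INR]; assert (H := pos_INR j); lra).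
    assert (0 < 2 ^ (j - depth j)) by (apply pow_lt; lra). lra. }
  assert (B := dyadic_sum_bv f V N (fun k => frac_part (INR (n (sigma k)) * x))
     (fun h k => cell_index h (n (sigma k)) x) E m e I HV).
  assert (B' := B (fun h k => cell_index_lt h _ x) (fun h k => cell_index_half h _ x ltac:(lra))
    (fun h k => conj (proj1 (cell_index_bounds h (n (sigma k)) x ltac:(lra))) (Rlt_le _ _ (proj2 (cell_index_bounds h (n (sigma k)) x ltac:(lra)))))).
  clear B. rewrite HmH' in B'.
  assert (B : Rabs (sumN N (fun j => f (frac_part (INR (n (sigma j)) * x))) -
      sumN N (fun j => grid f m (cell_index m (n (sigma j)) x)) - INR N * (I - mean (2 ^ m) (grid f m)))
      <= V * (sumN e (fun i => E (m + S i)%nat) + 2 * E (depth j) + 4 * INR N * / INR (2 ^ depth j))).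
  { apply B'.
    - intros h. unfold E. assert (0 < exp (- (INR h / 8))) by apply exp_pos. nra.
    - intros h s Hh Hs. assert (GF := cell_sum_initial n sigma K0 j x h s N Hg Hh Hs HN).
      unfold cell_sum, centered_cell in GF.
      rewrite (sumN_ext N _ (fun k => 1 * ((if Nat.eqb (cell_index h (n (sigma (0 + k)%nat)) x) s then 1 else 0) - / INR (2 ^ h))))
        by (intros; rewrite Rmult_1_l; reflexivity). exact GF.
    - apply HI. }
  clear B'.
  assert (HV0 := var_le_nonneg f V HV).
  replace (sumN N (fun k => f (INR (n (sigma k)) * x))) with
    (sumN N (fun k => f (frac_part (INR (n (sigma k)) * x)))).
  2:{ apply sumN_ext. intros k _. apply periodic_frac; [assumption|].
      apply Rmult_le_pos; [apply pos_INR|lra]. }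
  replace (cell_sum n sigma m (centered (2 ^ m) (grid f m)) 0 N x) with
    (sumN N (fun j => grid f m (cell_index m (n (sigma j)) x)) - INR N * mean (2 ^ m) (grid f m)).
  2:{ unfold cell_sum, centered. rewrite sumN_minus, sumN_const. reflexivity. }
  eapply Rle_trans; [|eapply Rle_trans; [apply B|]].
  - right. f_equal. ring.
  - apply Rmult_le_compat_l; [assumption|].
    specialize (Hj1 j ltac:(lia)).
    assert (S1 : sumN e (fun i => E (m + S i)%nat) <= 864 * lil_scale j * exp (- (INR m / 8)) + INR j * residue K0 j).
    { unfold E. rewrite sumN_plus, sumN_scal, sumN_const. assert (HH := exp_neg_sum_le m e).
      assert (INR e <= INR j) by (apply le_INR; assert (HHj := depth_le j); lia).
      assert (INR e * residue K0 j <= INR j * residue K0 j) by (apply Rmult_le_compat_r; assumption).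
      assert (108 * lil_scale j * sumN e (fun i => exp (- (INR (m + S i) / 8))) <= 108 * lil_scale j * (8 * exp (- (INR m / 8))))
        by (apply Rmult_le_compat_l; lra). lra. }
    assert (S2 : exp (- (INR (depth j) / 8)) <= exp (- (INR m / 8))).
    { apply exp_le. apply le_INR in HmH. lra. }
    assert (S3 : INR N * / INR (2 ^ depth j) <= 2 ^ (j - depth j + 1)).
    { assert (INR N <= INR (2 ^ (j + 1))) by (apply le_INR; lia). rewrite INR_pow2 in H.
      replace (j + 1)%nat with ((j - depth j + 1) + depth j)%nat in H by (assert (HHj := depth_le j); lia).
      rewrite pow_add in H. rewrite INR_pow2. apply Rle_div_l; [apply pow_lt; lra|assumption]. }
    assert (Hj3 : 3 <= INR j) by (replace 3 with (INR 3) by (simpl; ring); apply le_INR; lia).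
    set (P := 2 ^ (j - depth j + 1)) in *. assert (0 < P) by (apply pow_lt; lra).
    set (em := exp (- (INR m / 8))) in *. unfold E.
    assert (lil_scale j * exp (- (INR (depth j) / 8)) <= lil_scale j * em) by (apply Rmult_le_compat_l; assumption).
    assert (INR j * residue K0 j >= 3 * residue K0 j) by nra. assert (INR j * P >= 3 * P) by nra.
    set (A := sumN e _) in *. set (ee := exp (- (INR (depth j) / 8))) in *. lra.
Qed.

(** Since [c] sums to 0, the constants 1 / 2^h in the centred cells drop out. *)
Lemma cell_sum_cells n sigma h c u v x : sumN (2 ^ h) c = 0 ->
  cell_sum n sigma h c u v x = sumN (2 ^ h) (fun s => c s * cell_sum n sigma h (centered_cell (2 ^ h) s 1) u v x).
Proof.
  intros Hc. unfold cell_sum.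
  rewrite (sumN_ext (2 ^ h) _ (fun s => sumN v (fun j => c s * centered_cell (2 ^ h) s 1 (cell_index h (n (sigma (u + j)%nat)) x))))
    by (intros; symmetry; apply sumN_scal).
  rewrite <- sumN_swap. apply sumN_ext. intros j _. set (d := cell_index h (n (sigma (u + j)%nat)) x).
  rewrite (sumN_ext _ _ (fun s => (if Nat.eqb s d then c s else 0) - / INR (2 ^ h) * c s)).
  2:{ intros s _. unfold centered_cell. rewrite (Nat.eqb_sym d s). destruct (Nat.eqb s d); ring. }
  rewrite sumN_minus, sumN_scal, sumN_single, Hc.
  assert (Hd : (d < 2 ^ h)%nat) by apply cell_index_lt. destruct (Nat.ltb_spec d (2 ^ h)); [ring|lia].
Qed.

Definition lil_norm (N : nat) : R := sqrt (2 * INR N * ln (ln (INR N))).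

Lemma ln_N_ge j N : (1 <= j)%nat -> (2 ^ j <= N)%nat -> INR j * ln 2 <= ln (INR N).
Proof.
  intros Hj HN. apply le_INR in HN. rewrite INR_pow2, pow2_exp in HN.
  rewrite <- (ln_exp (INR j * ln 2)). apply ln_le; [apply exp_pos|assumption].
Qed.

Lemma lnln_ge j N : (1 <= j)%nat -> (2 ^ j <= N)%nat -> ln (INR j * ln 2) <= ln (ln (INR N)).
Proof.
  intros Hj HN. assert (H := ln_N_ge j N Hj HN). apply ln_le; [|assumption].
  apply le_INR in Hj. simpl in Hj. assert (H2 := ln2_lower). nra.
Qed.

Lemma ln_half_le j : (3 <= j)%nat -> ln (INR j) <= 2 * ln (INR j * ln 2).
Proof.
  intros Hj. apply le_INR in Hj. replace (INR 3) with 3 in Hj by (simpl; ring).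
  assert (H2 := ln2_lower). set (x := INR j) in *.
  replace (2 * ln (x * ln 2)) with (ln ((x * ln 2) * (x * ln 2))) by (rewrite ln_mult by nra; ring).
  apply ln_le; [lra|].
  assert (25 / 64 <= ln 2 * ln 2) by nra.
  replace (x * ln 2 * (x * ln 2)) with (x * (x * (ln 2 * ln 2))) by ring. nra.
Qed.

(** The 2 under the root of [lil_norm] makes up for ln j <= 2 ln (j ln 2). *)
Lemma lil_scale_le j N : (3 <= j)%nat -> (2 ^ j <= N)%nat -> lil_scale j <= lil_norm N.
Proof.
  intros Hj HN. unfold lil_scale, lil_norm. apply sqrt_le_1_alt.
  assert (H1 := ln_half_le j Hj). assert (H2 := lnln_ge j N ltac:(lia) HN).
  assert (H3 := ln_ge_1 j Hj). apply le_INR in HN. rewrite INR_pow2 in HN.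
  assert (0 < 2 ^ j) by (apply pow_lt; lra). nra.
Qed.

Lemma lil_norm_nonneg N : 0 <= lil_norm N.
Proof. apply sqrt_pos. Qed.

Lemma sqrt_ln_over_pow_small eta : 0 < eta -> exists j0, forall j, (j0 <= j)%nat ->
  sqrt (ln (INR j) / 2 ^ j) <= eta.
Proof.
  intros He. destruct (nat_above (16 / eta ^ 2)) as [J HJ]. exists (J + 1)%nat. intros j Hj.
  specialize (HJ j ltac:(lia)). apply Rlt_div_l in HJ; [|apply pow_lt; assumption].
  destruct (ln_le_self j ltac:(lia)) as [L0 L1]. assert (H2 := ln2_lower).
  assert (Hx : 0 <= INR j) by apply pos_INR. set (x := INR j) in *.
  rewrite <- (sqrt_square eta) by lra. apply sqrt_le_1_alt. apply Rle_div_l; [apply pow_lt; lra|].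
  assert (E := exp_ge_sqr (x * ln 2) ltac:(nra)). rewrite pow2_exp. fold x.
  assert (x ^ 2 / 16 <= exp (x * ln 2)).
  { assert ((x * (1 / 2)) ^ 2 <= (x * ln 2) ^ 2) by (apply pow_incr; nra). nra. }
  assert (0 <= eta * eta) by nra.
  apply Rle_trans with (eta * eta * (x ^ 2 / 16)); [|apply Rmult_le_compat_l; assumption].
  simpl in HJ. rewrite Rmult_1_r in HJ. nra.
Qed.

Lemma exp_neg_small eta : 0 < eta -> exists p, forall p', (p <= p')%nat -> exp (- (INR p' / 8)) <= eta.
Proof.
  intros He. destruct (nat_above (- 8 * ln eta)) as [p Hp]. exists p. intros p' Hp'.
  specialize (Hp p' Hp'). rewrite <- (exp_ln eta He). apply exp_le. lra.
Qed.

Lemma log2_bounds N : (1 <= N)%nat -> (2 ^ Nat.log2 N <= N < 2 ^ (Nat.log2 N + 1))%nat.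
Proof. intros H. rewrite Nat.add_1_r. apply Nat.log2_spec. lia. Qed.

Lemma log2_large J : exists N0, forall N, (N0 <= N)%nat -> (J <= Nat.log2 N)%nat.
Proof.
  exists (2 ^ J)%nat. intros N HN. rewrite <- (Nat.log2_pow2 J) by lia. now apply Nat.log2_le_mono.
Qed.

Definition large_gaps (n : nat -> nat) : Prop :=
  forall q, exists K0, forall k, (K0 <= k)%nat -> q * INR (n k) <= INR (n (S k)).

(** The sharp exponential bound is used only at 2^p times between 2^j and 2^(j+1); its exponent, at
    least (1 + kap) ln (j ln 2), makes the sum over j converge. Between these times the cellwise
    chaining bound applies, and it is made small by the choice of p. *)
Lemma step_upper (n sigma : nat -> nat) h c B sig eps :
  (forall k, (0 < n k)%nat) -> large_gaps n -> (forall i j, sigma i = sigma j -> i = j) ->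
  (forall s, (s < 2 ^ h)%nat -> Rabs (c s) <= B) -> sumN (2 ^ h) c = 0 -> 0 <= sig ->
  sumN (2 ^ h) (fun s => c s ^ 2) <= INR (2 ^ h) * sig ^ 2 -> 0 < eps ->
  ae01 (fun x => exists N0, forall N, (N0 <= N)%nat -> cell_sum n sigma h c 0 N x <= (sig + eps) * lil_norm N).
Proof.
  intros Hn Hgaps Hinj HB0 Hc0 Hsig Hvar Heps.
  (* [B] may be 0, whereas the tilts below are bounded by quotients with [B] in the denominator. *)
  assert (HB1 : exists B', 0 < B' /\ forall s, (s < 2 ^ h)%nat -> Rabs (c s) <= B').
  { exists (Rabs B + 1). split; [assert (H := Rabs_pos B); lra|]. intros s Hs.
    specialize (HB0 s Hs). assert (H := Rle_abs B). lra. }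
  clear HB0. destruct HB1 as [B' [HB HBc]]. clear B. rename B' into B.
  set (K := INR (2 ^ h)) in *. assert (HK : 1 <= K) by (apply (le_INR 1); assert (H := pow2_nat_pos h); lia).
  (* Half of [eps] goes into the threshold. With v = sig^2 + delta one has (1 + kap) v = sig^2 +
     e1^2 <= (sig + e1)^2, the surplus over the critical exponent. *)
  set (e1 := eps / 2). set (delta := e1 ^ 2 / 2).
  assert (Hd : 0 < delta) by (unfold delta, e1; nra).
  set (v := sig ^ 2 + delta). assert (Hv : 0 < v) by (unfold v; nra).
  set (kap := delta / v). assert (Hkap : 0 < kap) by (apply Rdiv_lt_0_compat; assumption).
  assert (Hkv : (1 + kap) * v <= (sig + e1) ^ 2).
  { unfold kap. replace ((1 + delta / v) * v) with (v + delta) by (field; lra). unfold v, delta, e1. nra. }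
  destruct (Hgaps 32) as [K32 HK32].
  set (q := Rmax 8 (128 * B ^ 2 * K / delta)).
  destruct (Hgaps q) as [Kq HKq].
  destruct (exp_neg_small (eps / (8 * 96 * (K * B)))) as [p Hp].
  { apply Rdiv_lt_0_compat; nra. }
  specialize (Hp p ltac:(lia)).
  set (Cl := (sig + e1) * 2 / v).
  assert (HCl : 0 < Cl) by (unfold Cl; apply Rdiv_lt_0_compat; unfold e1; nra).
  (* The two upper limits for the tilt in [mgf_step]. *)
  set (lmax := Rmin (1 / 16 / (B * K)) (delta / 2 / B ^ 3)).
  assert (Hlmax : 0 < lmax).
  { unfold lmax. apply Rmin_glb_lt; apply Rdiv_lt_0_compat; try lra; [nra|apply pow_lt; lra]. }
  destruct (sqrt_ln_over_pow_small (lmax / Cl)) as [j1 Hj1]; [apply Rdiv_lt_0_compat; assumption|].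
  set (ell := fun j => ln (INR j * ln 2)).
  set (thr' := fun u j => (sig + e1) * sqrt (2 * INR u * ell j)).
  set (bad := fun j x => exists i, (i < 2 ^ p)%nat /\
     thr' ((2 ^ p + i) * 2 ^ (j - p))%nat j + INR Kq * B <= cell_sum n sigma h c 0 ((2 ^ p + i) * 2 ^ (j - p)) x).
  assert (Hae : ae01 (fun x => exists J, forall j, (J <= j)%nat -> ~ bad j x)).
  { apply (ae_limsup bad (fun j => (INR (2 ^ p) * (4 * exp (- (1 + kap) * ln (ln 2)))) * exp (- (1 + kap) * ln (INR j)))).
    - apply (summable_scal (fun j => exp (- (1 + kap) * ln (INR j)))); [|now apply summable_pow].
      apply Rmult_lt_0_compat; [apply lt_0_INR, pow2_nat_pos|].
      assert (0 < exp (- (1 + kap) * ln (ln 2))) by apply exp_pos. lra.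
    - exists (j1 + p + 3)%nat. intros j Hj. rewrite !Rmult_assoc.
      apply small_sub with (fun x => exists i, (i < 2 ^ p)%nat /\ (0 < x < 1 /\
        thr' ((2 ^ p + i) * 2 ^ (j - p))%nat j + INR Kq * B <= cell_sum n sigma h c 0 ((2 ^ p + i) * 2 ^ (j - p)) x))
        (INR (2 ^ p) * (4 * (exp (- (1 + kap) * ln (ln 2)) * exp (- (1 + kap) * ln (INR j))))).
      2:{ intros x [Hx [i [Hi H]]]. exists i. auto. }
      2:{ lra. }
      apply small_bigor_const. intros i Hi.
      set (u := ((2 ^ p + i) * 2 ^ (j - p))%nat).
      assert (Hu : (2 ^ j <= u)%nat).
      { unfold u. replace j with (p + (j - p))%nat at 1 by lia. rewrite Nat.pow_add_r. nia. }
      assert (HuR : 2 ^ j <= INR u) by (apply le_INR in Hu; now rewrite INR_pow2 in Hu).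
      assert (H2j : 0 < 2 ^ j) by (apply pow_lt; lra).
      assert (Hell1 := ln_half_le j ltac:(lia)). fold (ell j) in Hell1. assert (Hell2 := ln_ge_1 j ltac:(lia)).
      assert (Hell3 : ell j <= ln (INR j)).
      { unfold ell. assert (Hjp : 3 <= INR j) by (replace 3 with (INR 3) by (simpl; ring); apply le_INR; lia).
        assert (A := ln2_lower). assert (A2 : ln 2 <= 1).
        { rewrite <- (ln_exp 1). apply ln_le; [lra|]. assert (HH := exp_ge_1x 1). lra. }
        apply ln_le; nra. }
      (* [lam] minimises lam^2 v u / 2 - lam t. It is at most a multiple of the square root of ln j
         / 2^j and thus falls below [lmax]. *)
      set (t := thr' u j). set (lam := t / (INR u * v)).
      assert (Hsq : 0 < sqrt (2 * INR u * ell j)) by (apply sqrt_lt_R0; nra).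
      assert (Ht : 0 < t) by (unfold t, thr'; apply Rmult_lt_0_compat; [unfold e1; lra|assumption]).
      assert (Hlam : 0 < lam) by (unfold lam; apply Rdiv_lt_0_compat; nra).
      assert (Hlam2 : lam <= lmax).
      { assert (A : sqrt (2 * INR u * ell j) <= INR u * (2 * sqrt (ln (INR j) / 2 ^ j))).
        { rewrite <- (sqrt_square (INR u)) at 2 by lra. rewrite <- (sqrt_square 2) at 2 by lra.
          assert (0 <= ln (INR j) / 2 ^ j) by (apply Rdiv_le_0_compat; lra).
          rewrite <- !sqrt_mult by nra. apply sqrt_le_1_alt.
          replace (INR u * INR u * (2 * 2 * (ln (INR j) / 2 ^ j))) with
            (INR u * (4 * (INR u / 2 ^ j * ln (INR j)))) by (field; lra).
          assert (1 <= INR u / 2 ^ j) by (apply Rle_div_r; lra).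
          rewrite Rmult_comm, <- Rmult_assoc. rewrite (Rmult_comm (ell j * 2)).
          apply Rmult_le_compat_l; [lra|]. nra. }
        specialize (Hj1 j ltac:(lia)).
        unfold lam, t, thr'. apply Rle_div_l; [nra|].
        apply Rle_trans with ((sig + e1) * (INR u * (2 * (lmax / Cl)))).
        - apply Rmult_le_compat_l; [unfold e1; lra|]. eapply Rle_trans; [apply A|].
          apply Rmult_le_compat_l; lra.
        - right. unfold Cl. field. repeat split; unfold e1; lra. }
      replace (4 * (exp (- (1 + kap) * ln (ln 2)) * exp (- (1 + kap) * ln (INR j)))) with
        (4 * exp (- (1 + kap) * ell j)).
      2:{ rewrite <- exp_plus. do 2 f_equal. unfold ell. rewrite ln_mult; [ring|apply lt_0_INR; lia|].
          assert (A := ln2_lower). lra. }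
      eapply small_sub; [apply (tail_bound n sigma h c B lam (lam ^ 2 * v / 2) Kq)| |].
      + assumption.
      + assumption.
      + assumption.
      + assumption.
      + assert (0 <= lam ^ 2) by apply pow2_ge_0. nra.
      + apply (mgf_step (fun k => n (Kq + k)%nat) h c lam B (sig ^ 2) delta q); auto.
        * intros k. rewrite Nat.add_succ_r. apply HKq. lia.
        * apply Rmax_l.
        * fold K. assert (A : lam <= 1 / 16 / (B * K)) by (eapply Rle_trans; [apply Hlam2|apply Rmin_l]).
          apply Rle_div_r in A; [assumption|nra].
        * assert (A : lam <= delta / 2 / B ^ 3) by (eapply Rle_trans; [apply Hlam2|apply Rmin_r]).
          apply Rle_div_r in A; [assumption|apply pow_lt; lra].
        * fold K. assert (A : 128 * B ^ 2 * K / delta <= q) by apply Rmax_r.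
          apply Rle_div_l in A; lra.
      + intros x Hx. exact Hx.
      + apply Rmult_le_compat_l; [lra|]. apply exp_le.
        replace (lam ^ 2 * v / 2 * INR u - lam * t) with (- (t ^ 2 / (2 * INR u * v))) by (unfold lam; field; lra).
        assert (E : t ^ 2 = (sig + e1) ^ 2 * (2 * INR u * ell j)).
        { unfold t, thr'. rewrite Rpow_mult_distr, pow2_sqrt by nra. reflexivity. }
        rewrite E. replace ((sig + e1) ^ 2 * (2 * INR u * ell j) / (2 * INR u * v)) with
          ((sig + e1) ^ 2 / v * ell j) by (field; lra).
        assert (1 + kap <= (sig + e1) ^ 2 / v) by (apply Rle_div_r; lra). nra. }
  apply ae_impl with (fun x => (exists J, forall j, (J <= j)%nat -> ~ bad j x) /\
     (exists J, forall j, (J <= j)%nat -> dyadic_bounded n sigma K32 j x)).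
  { apply ae_and; [assumption|]. apply dyadic_bounded_ae; auto. }
  intros x Hx [[J1 HJ1] [J2 HJ2]].
  destruct (residue_small (K * B + INR Kq * B) (eps / 8) K32) as [j3 Hj3];
    [assert (0 <= INR Kq) by apply pos_INR; nra|lra|].
  destruct (log2_large (J1 + J2 + j3 + 2 * p + 2 * h + 3)) as [N0 HN0].
  exists (N0 + 1)%nat. intros N HN. specialize (HN0 N ltac:(lia)).
  assert (Hb := log2_bounds N ltac:(lia)). set (j := Nat.log2 N) in *.
  assert (HpH : (p <= depth j)%nat) by (unfold depth; apply Nat.div_le_lower_bound; lia).
  assert (Hcut : exists i, (i < 2 ^ p)%nat /\ cut j N p = ((2 ^ p + i) * 2 ^ (j - p))%nat /\ (cut j N p <= N)%nat).
  { unfold cut. assert (H2 := pow2_nat_pos (j - p)). set (d := (2 ^ (j - p))%nat) in *.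
    assert (A : (2 ^ j = 2 ^ p * d)%nat) by (unfold d; rewrite <- Nat.pow_add_r; f_equal; lia).
    assert (A' : (2 ^ (j + 1) = 2 * 2 ^ p * d)%nat) by (rewrite Nat.pow_add_r, A; simpl; lia).
    assert (B1 : (2 ^ p <= N / d)%nat) by (apply Nat.div_le_lower_bound; lia).
    assert (B2 : (N / d < 2 * 2 ^ p)%nat) by (apply Nat.Div0.div_lt_upper_bound; lia).
    exists (N / d - 2 ^ p)%nat. split; [lia|]. split; [f_equal; lia|].
    rewrite Nat.mul_comm. apply Nat.Div0.mul_div_le. }
  destruct Hcut as [i [Hi [Ei Hle]]]. set (u := cut j N p) in *.
  replace N with (u + (N - u))%nat at 1 by lia. rewrite cell_sum_add, Nat.add_0_l.
  assert (HWt := lil_scale_le j N ltac:(lia) (proj1 Hb)). assert (HW := lil_scale_nonneg j).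
  assert (T1 : cell_sum n sigma h c 0 u x <= (sig + e1) * lil_norm N + INR Kq * B).
  { assert (A : ~ thr' u j + INR Kq * B <= cell_sum n sigma h c 0 u x).
    { intros A. apply (HJ1 j ltac:(lia)). exists i. split; [assumption|]. rewrite <- Ei. exact A. }
    assert (A' : thr' u j <= (sig + e1) * lil_norm N); [|lra].
    unfold thr', lil_norm. apply Rmult_le_compat_l; [unfold e1; lra|]. apply sqrt_le_1_alt.
    assert (L := lnln_ge j N ltac:(lia) (proj1 Hb)). fold (ell j) in L.
    assert (L1 := ln_half_le j ltac:(lia)). fold (ell j) in L1. assert (L2 := ln_ge_1 j ltac:(lia)).
    assert (INR u <= INR N) by (apply le_INR; assumption). assert (0 <= INR u) by apply pos_INR.
    rewrite !Rmult_assoc. apply Rmult_le_compat_l; [lra|]. apply Rmult_le_compat; lra. }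
  assert (T2 : cell_sum n sigma h c u (N - u) x <= K * B * (96 * lil_scale j * exp (- (INR p / 8)) + (INR j * INR K32 + 2 ^ (j - depth j)))).
  { rewrite cell_sum_cells by assumption. eapply Rle_trans; [apply Rle_abs|].
    assert (G : forall s, (s < 2 ^ h)%nat -> Rabs (cell_sum n sigma h (centered_cell (2 ^ h) s 1) u (N - u) x) <=
      96 * lil_scale j * exp (- (INR p / 8)) + (INR j * INR K32 + 2 ^ (j - depth j))).
    { intros s Hs.
      assert (HhH : (h <= depth j)%nat) by (unfold depth; apply Nat.div_le_lower_bound; lia).
      eapply Rle_trans; [apply (cell_sum_after_cut n sigma K32 j x h s N p (HJ2 j ltac:(lia)) HhH Hs (proj2 Hb) HpH)|].
      apply Rplus_le_compat_r. apply Rmult_le_compat_l; [lra|]. apply exp_le.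
      rewrite plus_INR. assert (0 <= INR h) by apply pos_INR. lra. }
    apply Rabs_sum_mul_le.
    - exact G.
    - eapply Rle_trans; [apply Rabs_pos|apply (G O)]. apply pow2_nat_pos.
    - unfold K. apply sumN_le_const. assumption. }
  assert (T3 : K * B * (96 * lil_scale j * exp (- (INR p / 8))) <= eps / 8 * lil_scale j).
  { replace (K * B * (96 * lil_scale j * exp (- (INR p / 8)))) with (lil_scale j * (exp (- (INR p / 8)) * (96 * (K * B)))) by ring.
    rewrite (Rmult_comm (eps / 8)). apply Rmult_le_compat_l; [assumption|].
    apply Rle_div_r in Hp; [|nra]. lra. }
  specialize (Hj3 j ltac:(lia)).
  assert (T4 : K * B * (INR j * INR K32 + 2 ^ (j - depth j)) + INR Kq * B <= eps / 8 * lil_scale j).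
  { eapply Rle_trans; [|apply Hj3]. assert (Hjp : 1 <= INR j) by (apply (le_INR 1); lia).
    set (P := 2 ^ (j - depth j + 1)) in *. assert (HP : 1 <= P) by (apply pow_R1_Rle; lra).
    assert (H0 : 0 <= INR K32) by apply pos_INR. assert (H1 : 0 <= INR Kq) by apply pos_INR.
    assert (HR : INR j * INR K32 + 2 ^ (j - depth j) <= residue K32 j) by (unfold residue; lra).
    set (X := INR j * INR K32 + 2 ^ (j - depth j)) in *.
    assert (HX : 0 <= X).
    { unfold X. assert (0 < 2 ^ (j - depth j)) by (apply pow_lt; lra). nra. }
    assert (HY : X + 1 <= INR j * (residue K32 j + P)).
    { assert (1 * (residue K32 j + P) <= INR j * (residue K32 j + P)) by (apply Rmult_le_compat_r; lra). lra. }
    set (Y := INR j * (residue K32 j + P)) in *.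
    rewrite (Rmult_assoc (K * B + INR Kq * B)). fold Y. assert (0 <= INR Kq * B) by nra. assert (0 <= K * B) by nra.
    assert (K * B * X <= K * B * Y) by (apply Rmult_le_compat_l; lra).
    assert (INR Kq * B * 1 <= INR Kq * B * Y) by (apply Rmult_le_compat_l; lra). lra. }
  assert (eps / 4 * lil_scale j <= eps / 4 * lil_norm N) by (apply Rmult_le_compat_l; lra).
  assert (0 <= eps * lil_norm N) by (apply Rmult_le_pos; [lra|apply lil_norm_nonneg]).
  unfold e1 in T1. lra.
Qed.

(** * Block averages and martingale differences *)

(** The conditional expectation of [g] given the partition into blocks of length [Rb]. *)
Definition block_avg (Rb : nat) (g : nat -> R) (i : nat) : R :=
  sumN Rb (fun t => g (Rb * (i / Rb) + t)%nat) / INR Rb.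

Lemma block_div Rb b t : (t < Rb)%nat -> ((Rb * b + t) / Rb = b)%nat.
Proof. intros H. symmetry. now apply (Nat.div_unique _ Rb b t). Qed.

Lemma block_avg_at Rb g b t : (t < Rb)%nat ->
  block_avg Rb g (Rb * b + t) = sumN Rb (fun t => g (Rb * b + t)%nat) / INR Rb.
Proof. intros H. unfold block_avg. now rewrite block_div. Qed.

Lemma block_avg_block_sum Rb g b : (0 < Rb)%nat ->
  sumN Rb (fun t => block_avg Rb g (Rb * b + t)) = sumN Rb (fun t => g (Rb * b + t)%nat).
Proof.
  intros H. rewrite (sumN_ext _ _ (fun _ => sumN Rb (fun t => g (Rb * b + t)%nat) / INR Rb))
    by (intros; now apply block_avg_at).
  rewrite sumN_const. field. apply not_0_INR. lia.
Qed.

Lemma blocks_sum Rb d b (g : nat -> R) :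
  sumN (Rb * d) (fun t => g (Rb * d * b + t)%nat) =
  sumN d (fun s => sumN Rb (fun t => g (Rb * (d * b + s) + t)%nat)).
Proof.
  rewrite (Nat.mul_comm Rb d), sumN_mul. apply sumN_ext. intros s _. apply sumN_ext. intros t _.
  f_equal. lia.
Qed.

Lemma block_avg_blocks_sum Rb d g b : (0 < Rb)%nat ->
  sumN (Rb * d) (fun t => block_avg Rb g (Rb * d * b + t)) = sumN (Rb * d) (fun t => g (Rb * d * b + t)%nat).
Proof.
  intros H. rewrite (blocks_sum Rb d b (block_avg Rb g)), (blocks_sum Rb d b g).
  apply sumN_ext. intros. now apply block_avg_block_sum.
Qed.

Lemma sumN_abs_le n f c : (forall i, (i < n)%nat -> Rabs (f i) <= c) -> Rabs (sumN n f) <= INR n * c.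
Proof.
  intros H. eapply Rle_trans; [apply sumN_abs|]. now apply sumN_le_const.
Qed.

Lemma block_avg_abs Rb g B i : (0 < Rb)%nat -> (forall i, Rabs (g i) <= B) -> Rabs (block_avg Rb g i) <= B.
Proof.
  intros HR HB. unfold block_avg. assert (0 < INR Rb) by now apply lt_0_INR.
  unfold Rdiv. rewrite Rabs_mult, (Rabs_pos_eq (/ INR Rb)) by (left; now apply Rinv_0_lt_compat).
  apply Rle_div_l; [assumption|]. rewrite Rmult_comm. now apply sumN_abs_le.
Qed.

Lemma total_var_dist g a i j : (i <= j)%nat -> Rabs (g (a + j)%nat - g (a + i)%nat) <= total_var g a j.
Proof.
  intros Hij. induction j as [|j IH].
  - replace i with O by lia. rewrite Rminus_diag, Rabs_R0. unfold total_var. simpl. lra.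
  - unfold total_var in *. cbn [sumN]. destruct (Nat.eq_dec i (S j)) as [->|Hn].
    + rewrite Rminus_diag, Rabs_R0.
      assert (0 <= sumN j (fun i => Rabs (g (a + i + 1)%nat - g (a + i)%nat))) by (apply sumN_nonneg; intros; apply Rabs_pos).
      assert (0 <= Rabs (g (a + j + 1)%nat - g (a + j)%nat)) by apply Rabs_pos. lra.
    + specialize (IH ltac:(lia)).
      replace (a + S j)%nat with (a + j + 1)%nat by lia.
      replace (g (a + j + 1)%nat - g (a + i)%nat) with
        ((g (a + j)%nat - g (a + i)%nat) + (g (a + j + 1)%nat - g (a + j)%nat)) by ring.
      eapply Rle_trans; [apply Rabs_triang|]. lra.
Qed.

Lemma total_var_mono g a L a' L' : (a' <= a)%nat -> (a + L <= a' + L')%nat -> total_var g a L <= total_var g a' L'.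
Proof.
  intros H1 H2. replace L' with ((a - a') + (L + (a' + L' - a - L)))%nat by lia.
  rewrite total_var_add. replace (a' + (a - a'))%nat with a by lia. rewrite total_var_add.
  assert (A := total_var_nonneg g a' (a - a')). assert (B := total_var_nonneg g (a + L) (a' + L' - a - L)). lra.
Qed.

Lemma total_var_blocks g Rb b d : total_var g (Rb * b) (Rb * d) = sumN d (fun s => total_var g (Rb * (b + s)) Rb).
Proof.
  unfold total_var. rewrite (Nat.mul_comm Rb d), sumN_mul. apply sumN_ext. intros s _. apply sumN_ext.
  intros t _. do 2 f_equal; f_equal; lia.
Qed.

Lemma avg_dist Rb (phi : nat -> R) z T : (0 < Rb)%nat ->
  (forall t, (t < Rb)%nat -> Rabs (phi t - z) <= T) -> Rabs (sumN Rb phi / INR Rb - z) <= T.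
Proof.
  intros HR H. assert (HR' : 0 < INR Rb) by now apply lt_0_INR.
  replace (sumN Rb phi / INR Rb - z) with (sumN Rb (fun t => phi t - z) / INR Rb).
  2:{ rewrite sumN_minus, sumN_const. field. lra. }
  unfold Rdiv. rewrite Rabs_mult, (Rabs_pos_eq (/ INR Rb)) by (left; now apply Rinv_0_lt_compat).
  apply Rle_div_l; [assumption|]. rewrite Rmult_comm. now apply sumN_abs_le.
Qed.

Lemma window_blocks Rb a L : (0 < Rb)%nat ->
  exists b d, (Rb * b <= a)%nat /\ (a + L <= Rb * b + Rb * d)%nat /\ (Rb * d <= L + 2 * Rb)%nat.
Proof.
  intros H. exists (a / Rb)%nat, (L / Rb + 2)%nat.
  assert (A := Nat.div_mod_eq a Rb). assert (A' := Nat.mod_upper_bound a Rb ltac:(lia)).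
  assert (B := Nat.div_mod_eq L Rb). assert (B' := Nat.mod_upper_bound L Rb ltac:(lia)).
  set (x := (a / Rb)%nat) in *. set (y := (L / Rb)%nat) in *. repeat split; nia.
Qed.

Lemma sum_window_mono (g : nat -> R) a L a' L' : (forall i, 0 <= g i) ->
  (a' <= a)%nat -> (a + L <= a' + L')%nat ->
  sumN L (fun i => g (a + i)%nat) <= sumN L' (fun i => g (a' + i)%nat).
Proof.
  intros Hg H1 H2. replace L' with ((a - a') + (L + (a' + L' - a - L)))%nat by lia.
  rewrite !sumN_add.
  rewrite (sumN_ext L (fun i => g (a' + (a - a' + i))%nat) (fun i => g (a + i)%nat)) by (intros; f_equal; lia).
  assert (0 <= sumN (a - a') (fun i => g (a' + i)%nat)) by (apply sumN_nonneg; auto).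
  assert (0 <= sumN (a' + L' - a - L) (fun i => g (a' + (a - a' + (L + i)))%nat)) by (apply sumN_nonneg; auto).
  lra.
Qed.

(** Two neighbouring block averages differ from the value of [g] at the common boundary by at most
    the variation over their own blocks, so the variation of [g] is counted at most twice. *)
Lemma total_var_block_avg g Rb V P : (0 < Rb)%nat -> (0 < P)%nat -> 0 <= V -> (forall a L, total_var g a L <= V * (INR L / INR P + 1)) ->
  forall a L, total_var (block_avg Rb g) a L <= 2 * V * ((INR L + 3 * INR Rb) / INR P + 1).
Proof.
  intros HR HP HV HT a L. destruct (window_blocks Rb a L HR) as [b [d [H1 [H2 H3]]]].
  assert (HP' : 0 < INR P) by now apply lt_0_INR.
  eapply Rle_trans; [apply (total_var_mono _ a L (Rb * b) (Rb * d) H1 H2)|].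
  rewrite total_var_blocks.
  set (h := fun b => sumN Rb (fun t => g (Rb * b + t)%nat) / INR Rb).
  set (T := fun b => total_var g (Rb * b) Rb).
  assert (E1 : forall s, total_var (block_avg Rb g) (Rb * s) Rb <= T s + T (S s)).
  { intros s. unfold total_var at 1. destruct Rb as [|R1]; [lia|]. cbn [sumN].
    rewrite sumN_zero.
    2:{ intros i Hi. rewrite <- (Nat.add_assoc (S R1 * s) i 1), !block_avg_at by lia. rewrite Rminus_diag. apply Rabs_R0. }
    rewrite block_avg_at by lia.
    replace (S R1 * s + R1 + 1)%nat with (S R1 * S s + 0)%nat by lia. rewrite block_avg_at by lia.
    fold (h s) (h (S s)).
    set (z := g (S R1 * S s)%nat).
    assert (A1 : Rabs (h s - z) <= T s).
    { apply avg_dist; [lia|]. intros t Ht. unfold z. replace (S R1 * S s)%nat with (S R1 * s + S R1)%nat by lia.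
      rewrite Rabs_minus_sym. eapply Rle_trans; [apply (total_var_dist g (S R1 * s) t (S R1)); lia|]. unfold T. lra. }
    assert (A2 : Rabs (h (S s) - z) <= T (S s)).
    { apply avg_dist; [lia|]. intros t Ht. unfold z. rewrite <- (Nat.add_0_r (S R1 * S s)) at 2.
      eapply Rle_trans; [apply (total_var_dist g (S R1 * S s) 0 t); lia|]. unfold T. apply total_var_mono; lia. }
    replace (h (S s) - h s) with ((h (S s) - z) - (h s - z)) by ring.
    eapply Rle_trans; [|apply Rplus_le_compat; [apply A1|apply A2]].
    rewrite Rplus_0_l, Rplus_comm. eapply Rle_trans; [apply Rabs_triang|]. rewrite Rabs_Ropp. lra. }
  eapply Rle_trans; [apply (sumN_le d _ (fun s => T (b + s)%nat + T (S (b + s))))|].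
  { intros s _. apply E1. }
  rewrite sumN_plus.
  assert (E2 : sumN d (fun s => T (b + s)%nat) <= sumN (S d) (fun s => T (b + s)%nat)).
  { cbn [sumN]. assert (HH := total_var_nonneg g (Rb * (b + d)) Rb). unfold T. lra. }
  assert (E3 : sumN d (fun s => T (S (b + s))) <= sumN (S d) (fun s => T (b + s)%nat)).
  { rewrite sumN_S_l. assert (HH := total_var_nonneg g (Rb * (b + 0)) Rb). fold (T (b + 0)%nat) in HH.
    rewrite (sumN_ext d (fun i => T (b + S i)%nat) (fun s => T (S (b + s)))) by (intros; f_equal; lia). lra. }
  assert (E4 : sumN (S d) (fun s => T (b + s)%nat) = total_var g (Rb * b) (Rb * S d)) by (symmetry; apply total_var_blocks).
  specialize (HT (Rb * b)%nat (Rb * S d)%nat).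
  assert (E5 : INR (Rb * S d) <= INR L + 3 * INR Rb).
  { replace 3 with (INR 3) by (simpl; ring). rewrite <- mult_INR, <- plus_INR. apply le_INR. lia. }
  assert (E6 : INR (Rb * S d) / INR P <= (INR L + 3 * INR Rb) / INR P)
    by (apply Rmult_le_compat_r; [left; now apply Rinv_0_lt_compat|assumption]).
  assert (V * (INR (Rb * S d) / INR P + 1) <= V * ((INR L + 3 * INR Rb) / INR P + 1))
    by (apply Rmult_le_compat_l; lra). lra.
Qed.

Lemma block_avg_dist_sum g Rb V P : (0 < Rb)%nat -> (0 < P)%nat -> 0 <= V -> (forall a L, total_var g a L <= V * (INR L / INR P + 1)) ->
  forall a L, sumN L (fun i => Rabs (block_avg Rb g (a + i) - g (a + i)%nat))
    <= INR Rb * (V * ((INR L + 2 * INR Rb) / INR P + 1)).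
Proof.
  intros HR HP HV HT a L. destruct (window_blocks Rb a L HR) as [b [d [H1 [H2 H3]]]].
  assert (HP' : 0 < INR P) by now apply lt_0_INR.
  eapply Rle_trans; [apply (sum_window_mono (fun i => Rabs (block_avg Rb g i - g i)) a L (Rb * b) (Rb * d)); auto; intros; apply Rabs_pos|].
  rewrite (Nat.mul_comm Rb d), sumN_mul.
  eapply Rle_trans; [apply (sumN_le d _ (fun s => INR Rb * total_var g (Rb * (b + s)) Rb))|].
  - intros s _. apply sumN_le_const. intros t Ht.
    replace (Rb * b + (s * Rb + t))%nat with (Rb * (b + s) + t)%nat by lia. rewrite block_avg_at by assumption.
    apply avg_dist; [assumption|]. intros t' Ht'.
    destruct (le_lt_dec t t') as [Hl|Hl].
    + eapply Rle_trans; [apply (total_var_dist g _ t t' Hl)|]. apply total_var_mono; lia.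
    + rewrite Rabs_minus_sym. eapply Rle_trans; [apply (total_var_dist g _ t' t); lia|]. apply total_var_mono; lia.
  - rewrite sumN_scal, <- total_var_blocks. apply Rmult_le_compat_l; [apply pos_INR|].
    eapply Rle_trans; [apply HT|]. apply Rmult_le_compat_l; [assumption|]. apply Rplus_le_compat_r.
    apply Rmult_le_compat_r; [left; now apply Rinv_0_lt_compat|].
    replace 2 with (INR 2) by reflexivity. rewrite <- mult_INR, <- plus_INR. apply le_INR. lia.
Qed.

Lemma prefix_window (g : nat -> R) a L : sumN L (fun i => g (a + i)%nat) = sumN (a + L) g - sumN a g.
Proof. rewrite sumN_add. ring. Qed.

(* Sums over whole blocks vanish, so only the two incomplete blocks at the ends contribute. *)
Lemma block_centered_window g Rb C : (0 < Rb)%nat -> 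
  (forall b, sumN Rb (fun t => g (Rb * b + t)%nat) = 0) ->
  (forall b y, (y < Rb)%nat -> Rabs (sumN y (fun t => g (Rb * b + t)%nat)) <= C) ->
  forall a L, Rabs (sumN L (fun i => g (a + i)%nat)) <= 2 * C.
Proof.
  intros HR H0 HC a L.
  assert (Hp : forall x, Rabs (sumN x g) <= C).
  { intros x. assert (A := Nat.div_mod_eq x Rb). assert (A' := Nat.mod_upper_bound x Rb ltac:(lia)).
    rewrite A. rewrite sumN_add.
    rewrite (Nat.mul_comm Rb) at 1. rewrite sumN_mul, sumN_zero, Rplus_0_l.
    - now apply HC.
    - intros s _. rewrite <- (H0 s). apply sumN_ext. intros. f_equal. lia. }
  rewrite prefix_window. assert (A := Hp (a + L)%nat). assert (B := Hp a).
  apply Rabs_le_between in A, B. apply Rabs_le. lra.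
Qed.

(** The tower property for blocks of decreasing length: factor [k] is constant on blocks of length
    [Rb (S k)], and its mean over every block of length [Rb k] is controlled. The last and finest
    factor is averaged first, over blocks on which all the others are constant. *)
Lemma block_martingale_bound (r : nat) : forall (Rb : nat -> nat) (g : nat -> nat -> R) (lo hi : nat -> R),
  (forall k, (k <= r)%nat -> (0 < Rb k)%nat) ->
  (forall k, (k < r)%nat -> Nat.divide (Rb (S k)) (Rb k)) ->
  (forall k i, (k < r)%nat -> 0 <= g k i) -> (forall k, (k < r)%nat -> 0 <= lo k) ->
  (forall k b t t', (k < r)%nat -> (t < Rb (S k))%nat -> (t' < Rb (S k))%nat ->
     g k (Rb (S k) * b + t)%nat = g k (Rb (S k) * b + t')%nat) ->
  (forall k b, (k < r)%nat -> lo k * INR (Rb k) <= sumN (Rb k) (fun t => g k (Rb k * b + t)%nat) <= hi k * INR (Rb k)) ->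
  (forall b t t', (t < Rb r)%nat -> (t' < Rb r)%nat ->
     prodf r (fun k => g k (Rb r * b + t)%nat) = prodf r (fun k => g k (Rb r * b + t')%nat)) /\
  forall b, prodf r lo * INR (Rb O) <= sumN (Rb O) (fun t => prodf r (fun k => g k (Rb O * b + t)%nat))
     <= prodf r hi * INR (Rb O).
Proof.
  induction r as [|r IH]; intros Rb g lo hi HR Hdiv Hg Hlo Hc Hs.
  - split; [reflexivity|]. intros b. simpl. rewrite sumN_const. lra.
  - destruct (IH Rb g lo hi) as [I1 I2];
      [intros; apply HR; lia|intros; apply Hdiv; lia|intros; apply Hg; lia|intros; apply Hlo; lia|
       intros; apply Hc; lia|intros; apply Hs; lia|].
    split.
    + intros b t t' Ht Ht'. rewrite !prodf_S_r. rewrite (Hc r b t t') by (try lia; assumption). f_equal.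
      destruct (Hdiv r ltac:(lia)) as [d Hd].
      assert (A := Nat.div_mod_eq b d). assert (A' := Nat.mod_upper_bound b d).
      assert (Hd0 : d <> O) by (intros ->; specialize (HR r ltac:(lia)); lia). specialize (A' Hd0).
      set (b' := (b / d)%nat) in *. set (s := (b mod d)%nat) in *.
      replace (Rb (S r) * b + t)%nat with (Rb r * b' + (Rb (S r) * s + t))%nat by (rewrite Hd; nia).
      replace (Rb (S r) * b + t')%nat with (Rb r * b' + (Rb (S r) * s + t'))%nat by (rewrite Hd; nia).
      apply I1; rewrite Hd; nia.
    + intros b. specialize (I2 b).
      assert (Hdv : Nat.divide (Rb r) (Rb O)).
      { assert (Hind : forall k, (k <= r)%nat -> Nat.divide (Rb k) (Rb O)).
        { induction k as [|k IHk]; intros Hk; [apply Nat.divide_refl|].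
          eapply Nat.divide_trans; [apply Hdiv; lia|apply IHk; lia]. }
        now apply Hind. }
      destruct Hdv as [D HD]. rewrite Nat.mul_comm in HD.
      rewrite (sumN_ext _ _ (fun t => prodf r (fun k => g k (Rb O * b + t)%nat) * g r (Rb O * b + t)%nat))
        by (intros t _; exact (prodf_S_r r (fun k => g k (Rb O * b + t)%nat))).
      rewrite !prodf_S_r.
      assert (E : forall phi : nat -> R, sumN (Rb O) (fun t => phi (Rb O * b + t)%nat) =
        sumN D (fun s => sumN (Rb r) (fun t => phi (Rb r * (D * b + s) + t)%nat))).
      { intros phi. rewrite HD. apply blocks_sum. }
      assert (Hr0 : (0 < Rb r)%nat) by (apply HR; lia).
      assert (E2 : forall s, lo r * sumN (Rb r) (fun t => prodf r (fun k => g k (Rb r * (D * b + s) + t)%nat))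
        <= sumN (Rb r) (fun t => prodf r (fun k => g k (Rb r * (D * b + s) + t)%nat) * g r (Rb r * (D * b + s) + t)%nat)
        <= hi r * sumN (Rb r) (fun t => prodf r (fun k => g k (Rb r * (D * b + s) + t)%nat))).
      { intros s. set (p0 := prodf r (fun k => g k (Rb r * (D * b + s) + 0)%nat)).
        assert (Hp0 : 0 <= p0) by (apply prodf_nonneg; intros; apply Hg; lia).
        rewrite (sumN_ext (Rb r) (fun t => prodf r (fun k => g k (Rb r * (D * b + s) + t)%nat)) (fun _ => p0))
          by (intros; now apply I1).
        rewrite (sumN_ext (Rb r) (fun t => _ * _) (fun t => p0 * g r (Rb r * (D * b + s) + t)%nat))
          by (intros; f_equal; now apply I1).
        rewrite sumN_const, sumN_scal. specialize (Hs r (D * b + s)%nat ltac:(lia)). nra. }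
      rewrite (E (fun i => prodf r (fun k => g k i) * g r i)).
      rewrite (E (fun i => prodf r (fun k => g k i))) in I2.
      assert (E3 : lo r * sumN D (fun s => sumN (Rb r) (fun t => prodf r (fun k => g k (Rb r * (D * b + s) + t)%nat)))
        <= sumN D (fun s => sumN (Rb r) (fun t => prodf r (fun k => g k (Rb r * (D * b + s) + t)%nat) * g r (Rb r * (D * b + s) + t)%nat)))
        by (rewrite <- sumN_scal; apply sumN_le; intros; apply E2).
      assert (E4 : sumN D (fun s => sumN (Rb r) (fun t => prodf r (fun k => g k (Rb r * (D * b + s) + t)%nat) * g r (Rb r * (D * b + s) + t)%nat))
        <= hi r * sumN D (fun s => sumN (Rb r) (fun t => prodf r (fun k => g k (Rb r * (D * b + s) + t)%nat))))
        by (rewrite <- sumN_scal; apply sumN_le; intros; apply E2).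
      assert (Hl := Hlo r ltac:(lia)).
      assert (Hh : 0 <= hi r).
      { specialize (Hs r O ltac:(lia)). assert (0 < INR (Rb r)) by now apply lt_0_INR.
        assert (0 <= lo r * INR (Rb r)) by nra. nra. }
      set (S1 := sumN D (fun s => sumN (Rb r) (fun t => prodf r (fun k => g k (Rb r * (D * b + s) + t)%nat)))) in *.
      nra.
Qed.

(** The estimates hold on arbitrary windows, with errors of about one period, because the blocks
    used for averaging are not aligned with the period [P]. *)
Definition wave (f : nat -> R) (P : nat) (B Vf sig2 : R) : Prop :=
  (0 < P)%nat /\ 0 < B /\ 0 <= Vf /\ 0 <= sig2 <= B ^ 2 /\
  (forall i, Rabs (f i) <= B) /\
  (forall a L, total_var f a L <= Vf * (INR L / INR P + 1)) /\
  (forall a L, Rabs (sumN L (fun i => f (a + i)%nat)) <= INR P * B) /\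
  (forall a L, sig2 * INR L - INR P * B ^ 2 <= sumN L (fun i => f (a + i)%nat ^ 2)
     <= sig2 * INR L + INR P * B ^ 2).

Lemma wave_cellfun c p K B sig2 : (0 < p)%nat -> (0 < K)%nat -> 0 < B ->
  (forall s, (s < K)%nat -> Rabs (c s) <= B) -> sumN K c = 0 ->
  sumN K (fun s => c s ^ 2) = INR K * sig2 ->
  wave (cellfun c p K) (p * K) B (2 * B * INR K) sig2.
Proof.
  intros Hp HK HB Hc H0 H2. assert (Hper := cellfun_periodic c p K Hp HK).
  assert (HP : (0 < p * K)%nat) by nia. assert (HK' : 0 < INR K) by now apply lt_0_INR.
  assert (HPR : 0 < INR (p * K)) by now apply lt_0_INR.
  assert (HB2 : forall i, Rabs (cellfun c p K i) <= B) by (intros; apply Hc, Nat.mod_upper_bound; lia).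
  assert (Hsq : forall i, 0 <= cellfun c p K i ^ 2 <= B ^ 2).
  { intros i. split; [apply pow2_ge_0|]. rewrite <- pow2_abs. apply pow_incr. split; [apply Rabs_pos|apply HB2]. }
  assert (Hs2 : 0 <= sig2 <= B ^ 2).
  { assert (A : 0 <= sumN K (fun s => c s ^ 2)) by (apply sumN_nonneg; intros; apply pow2_ge_0).
    assert (A' : sumN K (fun s => c s ^ 2) <= INR K * B ^ 2).
    { apply sumN_le_const. intros s Hs. rewrite <- pow2_abs. apply pow_incr. split; [apply Rabs_pos|now apply Hc]. }
    rewrite H2 in A, A'. split.
    - apply Rmult_le_reg_l with (INR K); [assumption|lra].
    - apply Rmult_le_reg_l with (INR K); [assumption|lra]. }
  (* Used below for the values and their squares, each with both signs, since [periodic_mean_le] is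
     one-sided. *)
  assert (Hmean : forall (phi : R -> R) M D a L, sumN K (fun s => phi (c s)) <= INR K * M ->
     (forall i, Rmax 0 (phi (cellfun c p K i) - M) <= D) ->
     sumN L (fun i => phi (cellfun c p K (a + i))) <= M * INR L + INR (p * K) * D).
  { intros phi M D a L H1 HD.
    apply (periodic_mean_le (p * K) (fun i => phi (cellfun c p K i)) M D a L HP).
    - intros i. now rewrite Hper.
    - change (fun i => phi (cellfun c p K i)) with (cellfun (fun s => phi (c s)) p K).
      rewrite cellfun_sum, mult_INR by assumption. assert (0 <= INR p) by apply pos_INR. nra.
    - apply sumN_le_const. intros. apply HD. }
  assert (H0' : sumN K (fun s => - c s) = 0) by (rewrite (sumN_opp K c), H0; ring).
  assert (H2' : sumN K (fun s => - c s ^ 2) = INR K * - sig2)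
    by (rewrite (sumN_opp K (fun s => c s ^ 2)), H2; ring).
  split; [assumption|]. split; [assumption|]. split; [nra|]. split; [assumption|]. split; [assumption|].
  split; [|split].
  - intros a L. apply total_var_periodic_le; [assumption..|]. rewrite cellfun_total_var by assumption.
    rewrite (Rmult_comm _ (INR K)). apply sumN_le_const. intros s Hs.
    assert (A1 := Hc s Hs). assert (A2 := Hc ((s + 1) mod K)%nat ltac:(apply Nat.mod_upper_bound; lia)).
    apply Rabs_le_between in A1, A2. apply Rabs_le. lra.
  - intros a L. apply Rabs_le. split.
    + assert (A := Hmean (fun x => - x) 0 B a L). cbv beta in A. rewrite H0', (sumN_opp L) in A.
      specialize (A ltac:(lra)). assert (A' := A ltac:(intros i; specialize (HB2 i); apply Rabs_le_between in HB2; apply Rmax_lub; lra)). lra.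
    + assert (A := Hmean (fun x => x) 0 B a L). cbv beta in A. change (sumN K (fun s => c s)) with (sumN K c) in A. rewrite H0 in A.
      specialize (A ltac:(lra)). assert (A' := A ltac:(intros i; specialize (HB2 i); apply Rabs_le_between in HB2; apply Rmax_lub; lra)). lra.
  - intros a L. split.
    + assert (A := Hmean (fun x => - x ^ 2) (- sig2) (B ^ 2) a L). cbv beta in A. rewrite H2', (sumN_opp L) in A.
      specialize (A ltac:(lra)). assert (A' := A ltac:(intros i; specialize (Hsq i); apply Rmax_lub; lra)). lra.
    + assert (A := Hmean (fun x => x ^ 2) sig2 (B ^ 2) a L). cbv beta in A. rewrite H2 in A.
      specialize (A ltac:(lra)). assert (A' := A ltac:(intros i; specialize (Hsq i); apply Rmax_lub; lra)). lra.
Qed.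

(* The increment of the conditional expectation of [f] between the coarse blocks of length [R0] and the
   fine blocks of length [R1]. *)
Definition avg_increment (R1 R0 : nat) (f : nat -> R) (i : nat) : R := block_avg R1 f i - block_avg R0 f i.

(** A block average changes only at the ends of blocks, by at most 2 B. This serves for the long
    blocks, where [total_var_block_avg] would bring in the uncontrolled ratio of block length to
    period. *)
Lemma total_var_block_avg_sup Rb g B : (0 < Rb)%nat -> 0 <= B -> (forall i, Rabs (g i) <= B) ->
  forall a L, total_var (block_avg Rb g) a L <= 2 * B * (INR L / INR Rb + 1).
Proof.
  intros HR HB0 HB a L.
  set (phi := fun i => if Nat.eqb ((i + 1) mod Rb) 0 then 2 * B else 0).
  assert (Hphi : forall i, 0 <= phi i) by (intros; unfold phi; destruct (Nat.eqb _ _); lra).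
  assert (Hper : periodic Rb phi).
  { intros i. unfold phi. replace (i + Rb + 1)%nat with (i + 1 + 1 * Rb)%nat by lia.
    now rewrite Nat.Div0.mod_add. }
  apply Rle_trans with (sumN L (fun i => phi (a + i)%nat)).
  - apply sumN_le. intros i _. set (x := (a + i)%nat). unfold phi.
    destruct (Nat.eqb_spec ((x + 1) mod Rb) 0) as [E|E].
    + assert (A := block_avg_abs Rb g B (x + 1) HR HB). assert (A' := block_avg_abs Rb g B x HR HB).
      apply Rabs_le_between in A, A'. apply Rabs_le. lra.
    + assert (D1 := Nat.div_mod_eq (x + 1) Rb). assert (D2 := Nat.mod_upper_bound (x + 1) Rb ltac:(lia)).
      set (b := ((x + 1) / Rb)%nat) in *. set (t := ((x + 1) mod Rb)%nat) in *.
      rewrite D1. replace x with (Rb * b + (t - 1))%nat by lia. rewrite !block_avg_at by lia.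
      rewrite Rminus_diag, Rabs_R0. lra.
  - eapply Rle_trans; [apply (periodic_sum_le Rb phi a L HR Hper Hphi)|].
    rewrite Rmult_comm. apply Rmult_le_compat_r.
    + assert (0 <= INR L / INR Rb) by (apply Rdiv_le_0_compat; [apply pos_INR|now apply lt_0_INR]). lra.
    + destruct Rb as [|R1]; [lia|]. cbn [sumN]. rewrite sumN_zero.
      * unfold phi. destruct (Nat.eqb _ _); lra.
      * intros i Hi. unfold phi. rewrite Nat.mod_small by lia.
        destruct (Nat.eqb_spec (i + 1) 0); [lia|reflexivity].
Qed.

(** Averaging over [R1], much shorter than the period, hardly changes [f], and averaging over [R0],
    much longer, nearly annihilates it. So the increment is close to [f] in L1 and yet exactly
    centred on the coarse blocks. *)
Lemma avg_increment_props (f : nat -> R) P B Vf sig2 R1 R0 d tau :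
  wave f P B Vf sig2 -> (0 < R1)%nat -> (0 < d)%nat -> R0 = (R1 * d)%nat -> 0 < tau <= 1 / 8 ->
  INR R1 <= tau * INR P -> INR P <= tau * INR R0 ->
  (forall b t t', (t < R1)%nat -> (t' < R1)%nat -> avg_increment R1 R0 f (R1 * b + t) = avg_increment R1 R0 f (R1 * b + t')) /\
  (forall i, Rabs (avg_increment R1 R0 f i) <= 2 * B) /\
  (forall b, sumN R0 (fun t => avg_increment R1 R0 f (R0 * b + t)) = 0) /\
  (forall b, sumN R0 (fun t => avg_increment R1 R0 f (R0 * b + t) ^ 2) <= INR R0 * (sig2 + tau * B ^ 2)) /\
  (forall a L, total_var (avg_increment R1 R0 f) a L <= (4 * Vf + 2 * B) * (INR L / INR P + 1)) /\
  (forall a L, Rabs (sumN L (fun i => avg_increment R1 R0 f (a + i))) <= 6 * (INR P * B)) /\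
  (forall a L, sumN L (fun i => Rabs (avg_increment R1 R0 f (a + i) - f (a + i)%nat)) <= tau * (Vf + B) * (INR L + 2 * INR P)).
Proof.
  intros [HP [HB [HVf [Hsig [W1 [W2 [W3 W4]]]]]]] HR1 Hd HR0 Htau HR1P HPR0.
  assert (HR0' : (0 < R0)%nat) by nia.
  assert (HPr : 0 < INR P) by now apply lt_0_INR. assert (HR0r : 0 < INR R0) by now apply lt_0_INR.
  assert (HR1r : 0 < INR R1) by now apply lt_0_INR.
  assert (HAB : forall Rb i, (0 < Rb)%nat -> Rabs (block_avg Rb f i) <= B) by (intros; now apply block_avg_abs).
  assert (Hblk : forall b, sumN R0 (fun t => block_avg R1 f (R0 * b + t)) = sumN R0 (fun t => f (R0 * b + t)%nat)).
  { intros b. rewrite HR0. now apply block_avg_blocks_sum. }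
  assert (Hc0 : forall b, sumN R0 (fun t => avg_increment R1 R0 f (R0 * b + t)) = 0).
  { intros b. unfold avg_increment. rewrite sumN_minus, Hblk, block_avg_block_sum by assumption. ring. }
  assert (Hrho : forall i, Rabs (block_avg R0 f i) <= INR P * B / INR R0).
  { intros i. unfold block_avg, Rdiv. rewrite Rabs_mult, (Rabs_pos_eq (/ INR R0)) by (left; now apply Rinv_0_lt_compat).
    apply Rmult_le_compat_r; [left; now apply Rinv_0_lt_compat|apply W3]. }
  split; [|split; [|split; [|split; [|split; [|split]]]]].
  - intros b t t' Ht Ht'. unfold avg_increment. rewrite (block_avg_at R1 f b t Ht), (block_avg_at R1 f b t' Ht'). f_equal.
    unfold block_avg. assert (E : ((R1 * b + t) / R0 = (R1 * b + t') / R0)%nat).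
    { rewrite HR0, <- !Nat.Div0.div_div, !block_div by assumption. reflexivity. }
    now rewrite E.
  - intros i. unfold avg_increment. assert (A := HAB R1 i HR1). assert (A' := HAB R0 i HR0').
    apply Rabs_le_between in A, A'. apply Rabs_le. lra.
  - exact Hc0.
  (* Subtracting the coarse mean lowers the second moment, and so does averaging over the fine
     blocks; what remains is the second moment of [f] over a window of many periods. *)
  - intros b. set (rho := sumN R0 (fun t => f (R0 * b + t)%nat) / INR R0).
    assert (E1 : sumN R0 (fun t => avg_increment R1 R0 f (R0 * b + t) ^ 2) =
      sumN R0 (fun t => block_avg R1 f (R0 * b + t) ^ 2) - INR R0 * rho ^ 2).
    { rewrite (sumN_ext _ _ (fun t => block_avg R1 f (R0 * b + t) ^ 2 - 2 * rho * block_avg R1 f (R0 * b + t) + rho ^ 2)).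
      2:{ intros t Ht. unfold avg_increment. rewrite (block_avg_at R0 f b t Ht). fold rho. ring. }
      rewrite sumN_plus, sumN_minus, sumN_scal, sumN_const, Hblk. unfold rho. field. lra. }
    assert (E2 : sumN R0 (fun t => block_avg R1 f (R0 * b + t) ^ 2) <= sumN R0 (fun t => f (R0 * b + t)%nat ^ 2)).
    { rewrite HR0, (blocks_sum R1 d b (fun i => block_avg R1 f i ^ 2)), (blocks_sum R1 d b (fun i => f i ^ 2)).
      apply sumN_le. intros s _. set (x := (d * b + s)%nat).
      rewrite (sumN_ext _ _ (fun _ => (sumN R1 (fun t => f (R1 * x + t)%nat) / INR R1) ^ 2))
        by (intros t Ht; now rewrite block_avg_at).
      rewrite sumN_const. assert (A := sumN_sqr_le R1 (fun t => f (R1 * x + t)%nat)). cbv beta in A.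
      set (S1 := sumN R1 (fun t => f (R1 * x + t)%nat)) in *.
      replace (INR R1 * (S1 / INR R1) ^ 2) with (S1 ^ 2 / INR R1) by (field; lra).
      apply Rle_div_l; [assumption|]. lra. }
    specialize (W4 (R0 * b)%nat R0). assert (0 <= INR R0 * rho ^ 2) by (apply Rmult_le_pos; [lra|apply pow2_ge_0]).
    assert (INR P * B ^ 2 <= tau * INR R0 * B ^ 2) by (apply Rmult_le_compat_r; [apply pow2_ge_0|assumption]). lra.
  - intros a L. assert (HL : 0 <= INR L) by apply pos_INR.
    assert (A1 := total_var_block_avg f R1 Vf P HR1 HP HVf W2 a L).
    assert (A2 := total_var_block_avg_sup R0 f B HR0' ltac:(lra) W1 a L).
    assert (A3 : total_var (avg_increment R1 R0 f) a L <= total_var (block_avg R1 f) a L + total_var (block_avg R0 f) a L).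
    { unfold total_var. rewrite <- sumN_plus. apply sumN_le. intros i _. unfold avg_increment.
      replace (block_avg R1 f (a + i + 1) - block_avg R0 f (a + i + 1) - (block_avg R1 f (a + i) - block_avg R0 f (a + i))) with
        ((block_avg R1 f (a + i + 1) - block_avg R1 f (a + i)) + - (block_avg R0 f (a + i + 1) - block_avg R0 f (a + i))) by ring.
      eapply Rle_trans; [apply Rabs_triang|]. rewrite Rabs_Ropp. lra. }
    set (y := INR L / INR P). assert (Hy : 0 <= y) by (apply Rdiv_le_0_compat; assumption).
    assert (A4 : (INR L + 3 * INR R1) / INR P <= y + 1).
    { apply Rle_div_l; [assumption|]. replace ((y + 1) * INR P) with (INR L + INR P) by (unfold y; field; lra). nra. }
    assert (A5 : INR L / INR R0 <= y).
    { apply Rmult_le_compat_l; [assumption|]. apply Rinv_le_contravar; nra. }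
    assert (2 * Vf * ((INR L + 3 * INR R1) / INR P + 1) <= 2 * Vf * (y + 1 + 1)) by (apply Rmult_le_compat_l; lra).
    assert (2 * B * (INR L / INR R0 + 1) <= 2 * B * (y + 1)) by (apply Rmult_le_compat_l; lra). nra.
  (* An incomplete coarse block costs P B for the coarse average and 2 P B for the fine one;
     [block_centered_window] doubles the sum. *)
  - intros a L. replace (6 * (INR P * B)) with (2 * (3 * (INR P * B))) by ring.
    apply (block_centered_window (avg_increment R1 R0 f) R0); auto.
    intros b y Hy. unfold avg_increment. rewrite sumN_minus.
    assert (A1 : Rabs (sumN y (fun t => block_avg R0 f (R0 * b + t))) <= INR P * B).
    { eapply Rle_trans; [apply (sumN_abs_le y _ (INR P * B / INR R0)); intros; apply Hrho|].
      unfold Rdiv. rewrite (Rmult_comm (INR P * B)), <- Rmult_assoc.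
      rewrite <- (Rmult_1_l (INR P * B)) at 2. apply Rmult_le_compat_r; [nra|].
      apply Rle_div_l; [assumption|]. rewrite Rmult_1_l. apply le_INR. lia. }
    assert (A2 : Rabs (sumN y (fun t => block_avg R1 f (R0 * b + t))) <= 2 * (INR P * B)).
    { assert (D1 := Nat.div_mod_eq y R1). assert (D2 := Nat.mod_upper_bound y R1 ltac:(lia)).
      set (y1 := (y / R1)%nat) in *. set (y2 := (y mod R1)%nat) in *. rewrite D1, sumN_add.
      assert (E : sumN (R1 * y1) (fun t => block_avg R1 f (R0 * b + t)) = sumN (R1 * y1) (fun t => f (R0 * b + t)%nat)).
      { rewrite (Nat.mul_comm R1 y1), !sumN_mul. apply sumN_ext. intros s _.
        rewrite (sumN_ext R1 (fun r => block_avg R1 f (R0 * b + (s * R1 + r))) (fun r => block_avg R1 f (R1 * (d * b + s) + r)))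
          by (intros; f_equal; rewrite HR0; lia).
        rewrite block_avg_block_sum by assumption. apply sumN_ext. intros. f_equal. rewrite HR0. lia. }
      rewrite E. eapply Rle_trans; [apply Rabs_triang|].
      assert (F1 := W3 (R0 * b)%nat (R1 * y1)%nat).
      assert (F2 : Rabs (sumN y2 (fun i => block_avg R1 f (R0 * b + (R1 * y1 + i)))) <= INR y2 * B)
        by (apply sumN_abs_le; intros; now apply HAB).
      assert (INR y2 <= INR R1) by (apply le_INR; lia).
      assert (INR R1 <= INR P) by nra. assert (INR y2 * B <= INR P * B) by (apply Rmult_le_compat_r; lra). lra. }
    unfold Rminus. eapply Rle_trans; [apply Rabs_triang|]. rewrite Rabs_Ropp. lra.
  - intros a L. assert (HL : 0 <= INR L) by apply pos_INR.
    assert (A1 := block_avg_dist_sum f R1 Vf P HR1 HP HVf W2 a L).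
    apply Rle_trans with (sumN L (fun i => Rabs (block_avg R1 f (a + i) - f (a + i)%nat) + INR P * B / INR R0)).
    + apply sumN_le. intros i _. unfold avg_increment.
      replace (block_avg R1 f (a + i) - block_avg R0 f (a + i) - f (a + i)%nat) with
        ((block_avg R1 f (a + i) - f (a + i)%nat) + - block_avg R0 f (a + i)) by ring.
      eapply Rle_trans; [apply Rabs_triang|]. rewrite Rabs_Ropp. specialize (Hrho (a + i)%nat). lra.
    + rewrite sumN_plus, sumN_const.
      assert (E1 : INR R1 * (Vf * ((INR L + 2 * INR R1) / INR P + 1)) <= tau * Vf * (INR L + 2 * INR P)).
      { apply Rle_trans with ((tau * INR P) * (Vf * ((INR L + INR P) / INR P + 1))).
        - apply Rmult_le_compat; [lra| |assumption|].
          + apply Rmult_le_pos; [assumption|].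
            assert (0 <= (INR L + 2 * INR R1) / INR P) by (apply Rdiv_le_0_compat; lra). lra.
          + apply Rmult_le_compat_l; [assumption|]. apply Rplus_le_compat_r. apply Rmult_le_compat_r.
            * left; now apply Rinv_0_lt_compat.
            * nra.
        - right. field. lra. }
      assert (E2 : INR P * B / INR R0 <= tau * B).
      { apply Rle_div_l; [assumption|]. nra. }
      assert (INR L * (INR P * B / INR R0) <= INR L * (tau * B)) by (apply Rmult_le_compat_l; assumption).
      assert (0 <= tau * B * (2 * INR P)) by (assert (0 < tau * B) by nra; nra). lra.
Qed.

(** * Tilted measures *)

(* Dominates [ln (1 + u)] for small [u]. *)
Definition log_majorant (u : R) : R := u - u ^ 2 / 2 + Rabs u ^ 3.

(** The quadratic coefficient collects eta from the product of the linear terms, eta^2 / 2 from the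
    square in the exponential series and - eta / 2 from the quadratic term of [log_majorant]. *)
Lemma tilt_growth_pointwise u eta : Rabs u <= 1 / 8 -> 0 < eta <= 1 ->
  (1 + u) * exp (eta * log_majorant u) <= 1 + (1 + eta) * u + (eta + eta ^ 2) / 2 * u ^ 2 + 11 * Rabs u ^ 3.
Proof.
  intros Hu He. set (a := Rabs u) in *.
  assert (Ha : 0 <= a) by apply Rabs_pos. assert (Hua : - a <= u <= a) by (apply Rabs_le_between; unfold a; lra).
  assert (Hu2 : u ^ 2 = a ^ 2) by (unfold a; now rewrite pow2_abs).
  assert (Hw : - (a ^ 2) <= - u ^ 2 / 2 + a ^ 3 <= 0) by (rewrite Hu2; simpl; nra).
  set (w := - u ^ 2 / 2 + a ^ 3) in *.
  assert (HL : log_majorant u = u + w) by (unfold log_majorant, w; fold a; lra).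
  rewrite HL. set (v := eta * (u + w)).
  assert (Ha2 : a ^ 2 <= a / 8) by (simpl; nra).
  assert (Hv : Rabs v <= 2 * a).
  { unfold v. rewrite Rabs_mult, (Rabs_pos_eq eta) by lra.
    assert (Rabs (u + w) <= 2 * a) by (apply Rabs_le; lra).
    assert (0 <= Rabs (u + w)) by apply Rabs_pos. nra. }
  assert (HE := exp_le_cube v ltac:(lra)).
  assert (Hv3 : Rabs v ^ 3 <= 8 * a ^ 3).
  { replace (8 * a ^ 3) with ((2 * a) ^ 3) by ring. apply pow_incr. split; [apply Rabs_pos|assumption]. }
  assert (Ha3 : 0 <= a ^ 3) by (apply pow_le; assumption).
  assert (Ha23 : a ^ 2 * a ^ 2 <= a ^ 3 / 8) by (replace (a ^ 2 * a ^ 2) with (a ^ 3 * a) by ring; nra).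
  assert (Hv2 : v ^ 2 <= eta ^ 2 * u ^ 2 + 3 * a ^ 3).
  { unfold v. assert (Huw : (u + w) ^ 2 <= u ^ 2 + 3 * a ^ 3).
    { replace ((u + w) ^ 2) with (u ^ 2 + 2 * (u * w) + w ^ 2) by ring.
      assert (Huw1 : u * w <= a ^ 3).
      { replace (a ^ 3) with (a * a ^ 2) by ring.
        apply Rle_trans with (Rabs (u * w)); [apply Rle_abs|]. rewrite Rabs_mult. fold a.
        apply Rmult_le_compat_l; [assumption|]. apply Rabs_le. lra. }
      assert (w ^ 2 <= a ^ 2 * a ^ 2).
      { rewrite <- (pow2_abs w). replace (a ^ 2 * a ^ 2) with ((a ^ 2) ^ 2) by ring. apply pow_incr.
        split; [apply Rabs_pos|apply Rabs_le; lra]. }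
      lra. }
    rewrite Rpow_mult_distr. assert (0 <= eta ^ 2 <= 1) by (simpl; nra). nra. }
  assert (HE2 : exp v <= 1 + eta * u + (eta ^ 2 - eta) / 2 * u ^ 2 + 13 / 2 * a ^ 3).
  { eapply Rle_trans; [apply HE|].
    assert (v = eta * u - eta * u ^ 2 / 2 + eta * a ^ 3) by (unfold v, w; field).
    assert (eta * a ^ 3 <= a ^ 3) by nra. lra. }
  apply Rle_trans with ((1 + u) * (1 + eta * u + (eta ^ 2 - eta) / 2 * u ^ 2 + 13 / 2 * a ^ 3)).
  { apply Rmult_le_compat_l; lra. }
  assert (Hu3 : - (a ^ 3) <= u * u ^ 2 <= a ^ 3).
  { rewrite Hu2. replace (a ^ 3) with (a * a ^ 2) by ring. assert (0 <= a ^ 2) by apply pow2_ge_0. split; nra. }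
  assert (Hb : -1 <= (eta ^ 2 - eta) / 2 <= 0) by (simpl; nra).
  assert ((eta ^ 2 - eta) / 2 * (u * u ^ 2) <= a ^ 3) by nra.
  assert (u * a ^ 3 <= a ^ 3 / 8) by nra. simpl in *. nra.
Qed.

(** The tilt shifts the mean of f by lam F f, replaced here by lam f^2 at the cost of |F - f|.
    Together with the quadratic term of the exponential this gives the coefficient - eta + eta^2 /
    2. *)
Lemma tilt_drift_pointwise F f lam B eta : 0 <= lam -> 0 < eta <= 1 -> 0 < B -> lam * B <= 1 / 16 ->
  Rabs F <= 2 * B -> Rabs f <= B ->
  (1 + lam * F) * exp (- (eta * lam) * f) <=
    1 + lam * F - eta * lam * f + lam ^ 2 * ((- eta + eta ^ 2 / 2) * f ^ 2)
    + lam ^ 2 * (B * Rabs (F - f)) + lam ^ 2 * (2 * lam * B ^ 3).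
Proof.
  intros Hl He HB HlB HF Hf. apply Rabs_le_between in HF. assert (Hf' := Hf). apply Rabs_le_between in Hf'.
  set (x := lam * B) in *. assert (Hx : 0 <= x) by (unfold x; nra).
  set (v := - (eta * lam) * f).
  assert (Hv : Rabs v <= x).
  { unfold v. rewrite Rabs_mult, Rabs_Ropp, Rabs_pos_eq by nra. unfold x.
    assert (0 <= Rabs f) by apply Rabs_pos.
    assert (eta * lam * Rabs f <= 1 * lam * Rabs f) by (apply Rmult_le_compat_r; nra).
    assert (lam * Rabs f <= lam * B) by (apply Rmult_le_compat_l; lra). lra. }
  assert (HE := exp_le_cube v ltac:(lra)).
  assert (Hv3 : Rabs v ^ 3 <= x ^ 3) by (apply pow_incr; split; [apply Rabs_pos|assumption]).
  assert (Hx3 : 0 <= x ^ 3) by (apply pow_le; assumption).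
  assert (HlF : - (2 * x) <= lam * F <= 2 * x) by (unfold x; split; nra).
  apply Rle_trans with ((1 + lam * F) * (1 + v + v ^ 2 / 2 + x ^ 3 / 2)).
  { apply Rmult_le_compat_l; lra. }
  assert (Hv2 : v ^ 2 <= x ^ 2) by (rewrite <- pow2_abs; apply pow_incr; split; [apply Rabs_pos|assumption]).
  assert (Hv2' : v ^ 2 = lam ^ 2 * (eta ^ 2 * f ^ 2)) by (unfold v; ring).
  assert (C1 : (lam * F) * (v ^ 2 / 2) <= x ^ 3).
  { replace (x ^ 3) with (2 * x * (x ^ 2 / 2)) by field.
    assert (0 <= v ^ 2) by apply pow2_ge_0.
    apply Rle_trans with (2 * x * (v ^ 2 / 2)); [apply Rmult_le_compat_r; lra|apply Rmult_le_compat_l; lra]. }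
  assert (C2 : (1 + lam * F) * (x ^ 3 / 2) <= x ^ 3) by nra.
  assert (C3 : lam * F * v <= lam ^ 2 * (- eta * f ^ 2) + lam ^ 2 * (B * Rabs (F - f))).
  { replace (lam * F * v) with (lam ^ 2 * (- eta * f ^ 2) + lam ^ 2 * (eta * (- (F - f) * f))) by (unfold v; ring).
    apply Rplus_le_compat_l. apply Rmult_le_compat_l; [apply pow2_ge_0|].
    assert (A : - (F - f) * f <= Rabs (F - f) * B).
    { eapply Rle_trans; [apply Rle_abs|]. rewrite Rabs_mult, Rabs_Ropp.
      apply Rmult_le_compat_l; [apply Rabs_pos|assumption]. }
    assert (0 <= Rabs (F - f) * B) by (apply Rmult_le_pos; [apply Rabs_pos|lra]).
    apply Rle_trans with (eta * (Rabs (F - f) * B)); [apply Rmult_le_compat_l; lra|]. nra. }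
  replace (lam ^ 2 * (2 * lam * B ^ 3)) with (2 * x ^ 3) by (unfold x; ring).
  assert (E : (1 + lam * F) * (1 + v + v ^ 2 / 2 + x ^ 3 / 2) =
    1 + lam * F + v + v ^ 2 / 2 + lam * F * v + lam * F * (v ^ 2 / 2) + (1 + lam * F) * (x ^ 3 / 2)) by ring.
  rewrite E. rewrite Hv2' at 1. unfold v at 1. lra.
Qed.

(* The blocks of length [Rb k] are long, and those of length [Rb (S k)] short, compared with the
   period [P k] of [f k]. *)
Definition tower (r : nat) (f : nat -> nat -> R) (P Rb : nat -> nat) (Q : nat) (B Vf sig2 tau : R) : Prop :=
  0 < tau <= 1 / 8 /\ (exists D, Q = (Rb O * D)%nat) /\ (0 < Q)%nat /\
  (forall k, (k <= r)%nat -> (0 < Rb k)%nat) /\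
  (forall k, (k < r)%nat -> wave (f k) (P k) B Vf sig2 /\ Nat.divide (Rb (S k)) (Rb k) /\
     INR (Rb (S k)) <= tau * INR (P k) /\ INR (P k) <= tau * INR (Rb k)).

Definition mart_diff (f : nat -> nat -> R) (Rb : nat -> nat) (k i : nat) : R := avg_increment (Rb (S k)) (Rb k) (f k) i.

Lemma tower_mart_diff r f P Rb Q B Vf sig2 tau k : tower r f P Rb Q B Vf sig2 tau -> (k < r)%nat ->
  (forall b t t', (t < Rb (S k))%nat -> (t' < Rb (S k))%nat ->
     mart_diff f Rb k (Rb (S k) * b + t) = mart_diff f Rb k (Rb (S k) * b + t')) /\
  (forall i, Rabs (mart_diff f Rb k i) <= 2 * B) /\
  (forall b, sumN (Rb k) (fun t => mart_diff f Rb k (Rb k * b + t)) = 0) /\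
  (forall b, sumN (Rb k) (fun t => mart_diff f Rb k (Rb k * b + t) ^ 2) <= INR (Rb k) * (sig2 + tau * B ^ 2)) /\
  (forall a L, total_var (mart_diff f Rb k) a L <= (4 * Vf + 2 * B) * (INR L / INR (P k) + 1)) /\
  (forall a L, Rabs (sumN L (fun i => mart_diff f Rb k (a + i))) <= 6 * (INR (P k) * B)) /\
  (forall a L, sumN L (fun i => Rabs (mart_diff f Rb k (a + i) - f k (a + i)%nat)) <= tau * (Vf + B) * (INR L + 2 * INR (P k))).
Proof.
  intros [Ht [_ [_ [HR H]]]] Hk. destruct (H k Hk) as [Hw [[d Hd] [H1 H2]]].
  assert (A := HR k ltac:(lia)). assert (A' := HR (S k) ltac:(lia)).
  apply (avg_increment_props (f k) (P k) B Vf sig2 (Rb (S k)) (Rb k) d tau); auto; nia.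
Qed.

Lemma tower_martingale_bound r f P Rb Q B Vf sig2 tau (g : nat -> nat -> R) lo hi :
  tower r f P Rb Q B Vf sig2 tau ->
  (forall k i, (k < r)%nat -> 0 <= g k i) -> (forall k, (k < r)%nat -> 0 <= lo k) ->
  (forall k b t t', (k < r)%nat -> (t < Rb (S k))%nat -> (t' < Rb (S k))%nat ->
     g k (Rb (S k) * b + t)%nat = g k (Rb (S k) * b + t')%nat) ->
  (forall k b, (k < r)%nat -> lo k * INR (Rb k) <= sumN (Rb k) (fun t => g k (Rb k * b + t)%nat) <= hi k * INR (Rb k)) ->
  prodf r lo * INR Q <= sumN Q (fun i => prodf r (fun k => g k i)) <= prodf r hi * INR Q.
Proof.
  intros [Ht [[D HD] [HQ [HR H]]]] Hg Hlo Hc Hs.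
  destruct (block_martingale_bound r Rb g lo hi HR ltac:(intros k Hk; apply (H k Hk)) Hg Hlo Hc Hs) as [_ HB].
  rewrite HD. rewrite (Nat.mul_comm (Rb O) D), sumN_mul, mult_INR.
  assert (E : forall s, sumN (Rb O) (fun r0 => prodf r (fun k => g k (s * Rb O + r0)%nat)) =
    sumN (Rb O) (fun t => prodf r (fun k => g k (Rb O * s + t)%nat)))
    by (intros s; rewrite (Nat.mul_comm s); reflexivity).
  rewrite (sumN_ext D _ _ (fun s _ => E s)).
  split.
  - replace (prodf r lo * (INR D * INR (Rb O))) with (sumN D (fun _ => prodf r lo * INR (Rb O)))
      by (rewrite sumN_const; ring).
    apply sumN_le. intros; apply HB.
  - replace (prodf r hi * (INR D * INR (Rb O))) with (sumN D (fun _ => prodf r hi * INR (Rb O)))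
      by (rewrite sumN_const; ring).
    apply sumN_le. intros; apply HB.
Qed.

Lemma prodf_one r : prodf r (fun _ => 1) = 1.
Proof. induction r as [|r IH]; simpl; [reflexivity|]. rewrite IH. ring. Qed.

(* Applied to the union of two disjoint sets of frequencies, this says that the two tilts are exactly
   uncorrelated, no matter how the frequencies interlace. *)
Lemma tilt_mean_one r f P Rb Q B Vf sig2 tau (b : nat -> R) :
  tower r f P Rb Q B Vf sig2 tau -> 0 < B -> (forall k, Rabs (b k) * (2 * B) <= 1 / 2) ->
  sumN Q (fun i => prodf r (fun k => 1 + b k * mart_diff f Rb k i)) = INR Q.
Proof.
  intros HT HB Hb.
  destruct (tower_martingale_bound r f P Rb Q B Vf sig2 tau (fun k i => 1 + b k * mart_diff f Rb k i) (fun _ => 1) (fun _ => 1) HT) as [A1 A2].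
  - intros k i Hk. destruct (tower_mart_diff r f P Rb Q B Vf sig2 tau k HT Hk) as [_ [M2 _]].
    assert (Rabs (b k * mart_diff f Rb k i) <= 1 / 2).
    { rewrite Rabs_mult. eapply Rle_trans; [|apply (Hb k)]. apply Rmult_le_compat_l; [apply Rabs_pos|apply M2]. }
    apply Rabs_le_between in H. lra.
  - intros; lra.
  - intros k c t t' Hk Ht Ht'. destruct (tower_mart_diff r f P Rb Q B Vf sig2 tau k HT Hk) as [M1 _].
    now rewrite (M1 c t t').
  - intros k c Hk. destruct (tower_mart_diff r f P Rb Q B Vf sig2 tau k HT Hk) as [_ [_ [M3 _]]].
    rewrite sumN_plus, sumN_const, sumN_scal, M3. lra.
  - rewrite prodf_one in *. lra.
Qed.

(** Bounds, under the tilted measure, the moment of order [eta] of the majorant of the likelihood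
    ratio, so that the ratio can be truncated. The 88 is 11 * 2^3, from the cubic error at |u| <= 2
    lam B. *)
Lemma tilt_growth r f P Rb Q B Vf sig2 tau (a : nat -> R) lam eta :
  tower r f P Rb Q B Vf sig2 tau -> 0 < B -> (forall k, a k = 0 \/ a k = 1) ->
  0 < lam -> lam * B <= 1 / 16 -> 0 < eta <= 1 ->
  sumN Q (fun i => prodf r (fun k => 1 + lam * a k * mart_diff f Rb k i) *
      exp (eta * sumN r (fun k => log_majorant (lam * a k * mart_diff f Rb k i))))
   <= exp (sumN r a * (lam ^ 2 * ((eta + eta ^ 2) / 2 * (sig2 + tau * B ^ 2) + 88 * lam * B ^ 3))) * INR Q.
Proof.
  intros HT HB Ha Hl HlB He. set (c := lam ^ 2 * ((eta + eta ^ 2) / 2 * (sig2 + tau * B ^ 2) + 88 * lam * B ^ 3)).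
  rewrite (sumN_ext Q _ (fun i => prodf r (fun k => (1 + lam * a k * mart_diff f Rb k i) * exp (eta * log_majorant (lam * a k * mart_diff f Rb k i))))).
  2:{ intros i _. rewrite prodf_mult, <- sumN_scal, prodf_exp. reflexivity. }
  assert (Hu : forall k i, (k < r)%nat -> Rabs (lam * a k * mart_diff f Rb k i) <= 1 / 8).
  { intros k i Hk. destruct (tower_mart_diff r f P Rb Q B Vf sig2 tau k HT Hk) as [_ [M2 _]]. specialize (M2 i).
    destruct (Ha k) as [-> | ->].
    - rewrite Rmult_0_r, Rmult_0_l, Rabs_R0. lra.
    - rewrite Rmult_1_r, Rabs_mult, (Rabs_pos_eq lam) by lra.
      assert (0 <= Rabs (mart_diff f Rb k i)) by apply Rabs_pos. nra. }
  assert (HM := tower_martingale_bound r f P Rb Q B Vf sig2 tau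
    (fun k i => (1 + lam * a k * mart_diff f Rb k i) * exp (eta * log_majorant (lam * a k * mart_diff f Rb k i)))
    (fun _ => 0) (fun k => exp (a k * c)) HT).
  eapply Rle_trans; [apply HM|].
  - intros k i Hk. specialize (Hu k i Hk). apply Rabs_le_between in Hu.
    apply Rmult_le_pos; [lra|left; apply exp_pos].
  - intros; lra.
  - intros k b t t' Hk Ht Ht'. destruct (tower_mart_diff r f P Rb Q B Vf sig2 tau k HT Hk) as [M1 _].
    now rewrite (M1 b t t').
  - intros k b Hk. destruct (tower_mart_diff r f P Rb Q B Vf sig2 tau k HT Hk) as [_ [M2 [M3 [M4 _]]]].
    assert (HRk : 0 <= INR (Rb k)) by apply pos_INR. split.
    + rewrite Rmult_0_l. apply sumN_nonneg. intros t _. specialize (Hu k (Rb k * b + t)%nat Hk). apply Rabs_le_between in Hu.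
      apply Rmult_le_pos; [lra|left; apply exp_pos].
    + destruct (Ha k) as [E|E].
      * rewrite (sumN_ext _ _ (fun _ => 1)).
        2:{ intros t _. rewrite E, Rmult_0_r, Rmult_0_l. unfold log_majorant. rewrite Rabs_R0.
            replace (eta * (0 - 0 ^ 2 / 2 + 0 ^ 3)) with 0 by field. rewrite exp_0. ring. }
        rewrite sumN_const, E, Rmult_0_l, exp_0. lra.
      * eapply Rle_trans; [apply sumN_le; intros t _; apply (tilt_growth_pointwise _ eta (Hu k (Rb k * b + t)%nat Hk) He)|].
        rewrite E, !Rmult_1_r, Rmult_1_l.
        eapply Rle_trans; [apply (sumN_le _ _ (fun t => 1 + ((1 + eta) * lam) * mart_diff f Rb k (Rb k * b + t)
          + ((eta + eta ^ 2) / 2 * lam ^ 2) * mart_diff f Rb k (Rb k * b + t) ^ 2 + 88 * (lam * B) ^ 3))|].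
        -- intros t _. set (F := mart_diff f Rb k (Rb k * b + t)).
           assert (HF : Rabs F <= 2 * B) by apply M2.
           assert (A3 : Rabs (lam * F) ^ 3 <= 8 * (lam * B) ^ 3).
           { replace (8 * (lam * B) ^ 3) with ((lam * (2 * B)) ^ 3) by ring. apply pow_incr.
             split; [apply Rabs_pos|]. rewrite Rabs_mult, (Rabs_pos_eq lam) by lra. apply Rmult_le_compat_l; lra. }
           replace ((lam * F) ^ 2) with (lam ^ 2 * F ^ 2) by ring. lra.
        -- rewrite !sumN_plus, !sumN_scal, !sumN_const, M3.
           assert (A : (eta + eta ^ 2) / 2 * lam ^ 2 * sumN (Rb k) (fun t => mart_diff f Rb k (Rb k * b + t) ^ 2) <=
             (eta + eta ^ 2) / 2 * lam ^ 2 * (INR (Rb k) * (sig2 + tau * B ^ 2))).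
           { apply Rmult_le_compat_l; [|apply M4]. assert (0 <= lam ^ 2) by apply pow2_ge_0.
             assert (0 <= (eta + eta ^ 2) / 2) by (simpl; nra). nra. }
           assert (A2 := exp_ge_1x c).
           apply Rle_trans with ((1 + c) * INR (Rb k)); [|apply Rmult_le_compat_r; assumption].
           unfold c. lra.
  - apply Rmult_le_compat_r; [apply pos_INR|]. rewrite prodf_exp, sumN_scal_r. lra.
Qed.

Lemma abs_exp_diff x y : Rabs x <= 1 / 16 -> Rabs y <= 1 / 16 -> Rabs (exp x - exp y) <= 5 / 2 * Rabs (x - y).
Proof.
  intros Hx Hy. apply Rabs_le_between in Hx, Hy.
  replace (exp x - exp y) with (exp y * (exp (x - y) - 1)).
  2:{ rewrite Rmult_minus_distr_l, <- exp_plus, Rmult_1_r. do 2 f_equal. ring. }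
  rewrite Rabs_mult, (Rabs_pos_eq (exp y)) by (left; apply exp_pos).
  assert (A := abs_exp_sub_1 (x - y) ltac:(apply Rabs_le; lra)).
  assert (B : exp y <= 5 / 4).
  { assert (C := exp_le_sqr y ltac:(apply Rabs_le; lra)). nra. }
  assert (0 < exp y) by apply exp_pos. assert (0 <= Rabs (exp (x - y) - 1)) by apply Rabs_pos. nra.
Qed.

(** The functions [f k] need not be constant on the fine blocks, so the martingale argument cannot
    handle their exponentials. The mixed factors are treated as Riesz factors of period [P k]
    instead. *)
Lemma tilt_tame r f P Rb Q B Vf sig2 tau lam eta k :
  tower r f P Rb Q B Vf sig2 tau -> 0 < lam -> lam * B <= 1 / 16 -> 0 < eta <= 1 -> (k < r)%nat ->
  tame (fun i => (1 + lam * mart_diff f Rb k i) * exp (- (eta * lam) * f k i)) (P k)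
    (1 - lam ^ 2 * ((eta - eta ^ 2 / 2) * sig2 - tau * (Vf + B) * B - 2 * lam * B ^ 3))
    (lam * (9 * B + Vf)) (lam * (11 * Vf + 4 * B)).
Proof.
  intros HT Hl HlB He Hk. assert (HT' := HT). destruct HT' as [Htau [_ [_ [_ H]]]].
  destruct (H k Hk) as [[HP [HB [HVf [Hsig [W1 [W2 [W3 W4]]]]]]] _]. clear H.
  destruct (tower_mart_diff r f P Rb Q B Vf sig2 tau k HT Hk) as [_ [M2 [_ [_ [M5 [M6 M7]]]]]].
  set (F := mart_diff f Rb k) in *. set (g := f k) in *.
  assert (Hv : forall i, Rabs (- (eta * lam) * g i) <= 1 / 16).
  { intros i. rewrite Rabs_mult, Rabs_Ropp, Rabs_pos_eq by nra. specialize (W1 i).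
    assert (0 <= Rabs (g i)) by apply Rabs_pos.
    assert (eta * lam * Rabs (g i) <= 1 * lam * Rabs (g i)) by (apply Rmult_le_compat_r; nra). nra. }
  assert (HF : forall i, - (1 / 8) <= lam * F i <= 1 / 8).
  { intros i. specialize (M2 i). apply Rabs_le_between in M2. split; nra. }
  assert (Hev : forall i, 0 < exp (- (eta * lam) * g i) <= 5 / 4).
  { intros i. split; [apply exp_pos|]. specialize (Hv i).
    assert (C := exp_le_sqr (- (eta * lam) * g i)). specialize (C ltac:(lra)). apply Rabs_le_between in Hv. nra. }
  assert (HPr : 0 < INR (P k)) by now apply lt_0_INR.
  split; [|split].
  - intros i. specialize (HF i). specialize (Hev i).
    split; [nra|]. apply Rle_trans with (9 / 8 * (5 / 4)); [apply Rmult_le_compat; lra|lra].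
  - intros a L. apply Rle_trans with (2 * lam * total_var F a L + 3 * lam * total_var g a L).
    + unfold total_var. rewrite <- !sumN_scal, <- sumN_plus. apply sumN_le. intros i _.
      set (x := (a + i + 1)%nat). set (y := (a + i)%nat).
      replace ((1 + lam * F x) * exp (- (eta * lam) * g x) - (1 + lam * F y) * exp (- (eta * lam) * g y)) with
        (lam * (F x - F y) * exp (- (eta * lam) * g x) + (1 + lam * F y) * (exp (- (eta * lam) * g x) - exp (- (eta * lam) * g y))) by ring.
      eapply Rle_trans; [apply Rabs_triang|]. rewrite !Rabs_mult, (Rabs_pos_eq lam) by lra.
      assert (C1 := Hev x). assert (C2 := HF y). rewrite (Rabs_pos_eq (exp _)) by lra. rewrite (Rabs_pos_eq (1 + _)) by lra.
      assert (C3 := abs_exp_diff _ _ (Hv x) (Hv y)).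
      replace (- (eta * lam) * g x - - (eta * lam) * g y) with (- (eta * lam) * (g x - g y)) in C3 by ring.
      rewrite Rabs_mult, Rabs_Ropp, (Rabs_pos_eq (eta * lam)) in C3 by nra.
      assert (D1 : 0 <= Rabs (F x - F y)) by apply Rabs_pos. assert (D2 : 0 <= Rabs (g x - g y)) by apply Rabs_pos.
      assert (D3 : eta * lam * Rabs (g x - g y) <= lam * Rabs (g x - g y)) by (apply Rmult_le_compat_r; nra).
      assert (D4 : lam * Rabs (F x - F y) * exp (- (eta * lam) * g x) <= lam * Rabs (F x - F y) * 2)
        by (apply Rmult_le_compat_l; [nra|lra]).
      assert (D5 : (1 + lam * F y) * Rabs (exp (- (eta * lam) * g x) - exp (- (eta * lam) * g y)) <= 9 / 8 * (5 / 2 * (lam * Rabs (g x - g y)))).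
      { apply Rmult_le_compat; [lra|apply Rabs_pos|lra|lra]. }
      assert (0 <= lam * Rabs (g x - g y)) by nra. lra.
    + specialize (M5 a L). specialize (W2 a L).
      set (y := INR L / INR (P k) + 1) in *.
      assert (2 * lam * total_var F a L <= 2 * lam * ((4 * Vf + 2 * B) * y)) by (apply Rmult_le_compat_l; lra).
      assert (3 * lam * total_var g a L <= 3 * lam * (Vf * y)) by (apply Rmult_le_compat_l; lra). lra.
  - intros a L. assert (HL : 0 <= INR L) by apply pos_INR.
    eapply Rle_trans; [apply sumN_le; intros i _; apply (tilt_drift_pointwise _ _ lam B eta); auto; lra|].
    rewrite !sumN_plus, sumN_minus, sumN_plus, !sumN_scal, !sumN_const.
    specialize (M6 a L). specialize (M7 a L). specialize (W3 a L). destruct (W4 a L) as [W4' _].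
    apply Rabs_le_between in M6, W3.
    set (SF := sumN L (fun i => F (a + i)%nat)) in *. set (Sg := sumN L (fun i => g (a + i)%nat)) in *.
    set (S2 := sumN L (fun i => g (a + i)%nat ^ 2)) in *.
    set (SD := sumN L (fun i => Rabs (F (a + i)%nat - g (a + i)%nat))) in *.
    set (p := INR (P k)) in *. set (th := eta - eta ^ 2 / 2).
    assert (Hth : 0 <= th <= 1) by (unfold th; simpl; nra).
    assert (Hl2 : 0 <= lam ^ 2) by apply pow2_ge_0.
    assert (E1 : lam * SF <= lam * (6 * (p * B))) by (apply Rmult_le_compat_l; lra).
    assert (E2 : - (eta * lam * Sg) <= lam * (p * B)).
    { assert (0 <= p * B) by nra. assert (- Sg <= p * B) by lra.
      apply Rle_trans with (eta * lam * (p * B)); [assert (0 <= eta * lam) by nra; nra|]. apply Rmult_le_compat_r; nra. }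
    assert (E3 : lam ^ 2 * (- eta + eta ^ 2 / 2) * S2 <= - (lam ^ 2 * th * sig2 * INR L) + lam * (p * B)).
    { replace (lam ^ 2 * (- eta + eta ^ 2 / 2) * S2) with (- (lam ^ 2 * th * S2)) by (unfold th; field).
      assert (A : lam ^ 2 * th * (sig2 * INR L - p * B ^ 2) <= lam ^ 2 * th * S2)
        by (apply Rmult_le_compat_l; [nra|assumption]).
      assert (A' : lam ^ 2 * th * (p * B ^ 2) <= lam * (p * B)).
      { replace (lam ^ 2 * th * (p * B ^ 2)) with ((lam * B) * th * (lam * (p * B))) by ring.
        assert (0 <= lam * (p * B)) by nra. assert ((lam * B) * th <= 1) by nra. nra. }
      lra. }
    assert (E4 : lam ^ 2 * B * SD <= lam ^ 2 * (tau * (Vf + B) * B) * INR L + lam * (p * (B + Vf))).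
    { assert (A : lam ^ 2 * B * SD <= lam ^ 2 * B * (tau * (Vf + B) * (INR L + 2 * p))) by (apply Rmult_le_compat_l; nra).
      assert (A' : lam ^ 2 * B * (tau * (Vf + B) * (2 * p)) <= lam * (p * (B + Vf))).
      { replace (lam ^ 2 * B * (tau * (Vf + B) * (2 * p))) with (((lam * B) * (2 * tau)) * (lam * (p * (B + Vf)))) by ring.
        assert (0 <= lam * (p * (B + Vf))) by (apply Rmult_le_pos; [lra|apply Rmult_le_pos; lra]).
        assert ((lam * B) * (2 * tau) <= 1) by nra. nra. }
      lra. }
    fold th. lra.
Qed.

(** Under the tilted measure the sum of the selected [f k] has mean about lam sig^2 times their
    number; this exponential moment controls its lower tail. *)
Lemma tilt_drift r f P Rb Q B Vf sig2 tau (a : nat -> R) lam eta q :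
  tower r f P Rb Q B Vf sig2 tau -> 0 < B -> 0 <= Vf -> (forall k, a k = 0 \/ a k = 1) ->
  0 < lam -> lam * B <= 1 / 16 -> 0 < eta <= 1 -> 8 <= q -> lam * (11 * Vf + 9 * B) <= 1 / 4 ->
  (forall k, (S k < r)%nat -> q * INR (P (S k)) <= INR (P k)) ->
  sumN Q (fun i => prodf r (fun k => 1 + lam * a k * mart_diff f Rb k i) *
      exp (- (eta * lam) * sumN r (fun k => a k * f k i)))
   <= 2 * exp (sumN r a * (lam ^ 2 * (- (eta - eta ^ 2 / 2) * sig2 + tau * (Vf + B) * B + 2 * lam * B ^ 3
         + 4 * (9 * B + Vf) * (11 * Vf + 4 * B) / q))) * INR Q.
Proof.
  intros HT HB HVf Ha Hl HlB He Hq HlV Hgap.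
  destruct (Nat.eq_dec r 0) as [->|Hr0].
  { simpl. rewrite Rmult_0_r, Rmult_0_l, exp_0, sumN_const. assert (0 <= INR Q) by apply pos_INR. lra. }
  set (c := (eta - eta ^ 2 / 2) * sig2 - tau * (Vf + B) * B - 2 * lam * B ^ 3).
  set (D := lam * (9 * B + Vf)). set (V := lam * (11 * Vf + 4 * B)).
  set (g := fun k i => (1 + lam * a k * mart_diff f Rb k i) * exp (- (eta * lam) * (a k * f k i))).
  assert (HD : 0 <= D <= 1 / 4) by (unfold D; nra). assert (HV : 0 <= V <= 1 / 4) by (unfold V; nra).
  assert (Hl2 : 0 <= lam ^ 2) by apply pow2_ge_0.
  assert (HT' := HT). destruct HT' as [Htau [[D0 HD0] [HQ [HR H]]]].
  assert (Hav : forall k, 0 <= a k <= 1) by (intros k; destruct (Ha k) as [-> | ->]; lra).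
  set (z := 4 * (9 * B + Vf) * (11 * Vf + 4 * B) / q).
  assert (Hz : 0 <= z) by (unfold z; apply Rdiv_le_0_compat; [|lra]; apply Rmult_le_pos; lra).
  assert (HzD : forall k, 4 * D * (V * a k) / q = a k * (lam ^ 2 * z)).
  { intros k. unfold D, V, z. field. lra. }
  rewrite (sumN_ext Q _ (fun i => prodf r (fun k => g k (0 + i)%nat))).
  2:{ intros i _. unfold g. rewrite prodf_mult, <- sumN_scal, prodf_exp. reflexivity. }
  assert (Hc2 : forall k, (k < r)%nat -> lam ^ 2 * c <= 1 / 2).
  { intros k Hk. destruct (H k Hk) as [[_ [_ [_ [[S1 S2] _]]]] _].
    assert (c <= B ^ 2).
    { unfold c. assert (0 <= tau * (Vf + B) * B) by (apply Rmult_le_pos; [apply Rmult_le_pos; lra|lra]).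
      assert (0 <= 2 * lam * B ^ 3) by (apply Rmult_le_pos; [lra|apply pow_le; lra]).
      assert ((eta - eta ^ 2 / 2) * sig2 <= 1 * sig2) by (apply Rmult_le_compat_r; [lra|simpl; nra]). lra. }
    apply Rle_trans with (lam ^ 2 * B ^ 2); [apply Rmult_le_compat_l; assumption|].
    replace (lam ^ 2 * B ^ 2) with ((lam * B) ^ 2) by ring.
    assert (0 <= lam * B) by nra. simpl. nra. }
  assert (HIB := riesz_product_bound q D Hq (proj1 HD) r g P (fun k => 1 - a k * (lam ^ 2 * c)) (fun k => V * a k)).
  assert (HIB' : interval_bound (fun i => prodf r (fun k => g k i))
     (prodf r (fun k => 1 - a k * (lam ^ 2 * c) + 4 * D * (V * a k) / q)) (4 * D * INR (P O))).
  { apply HIB; [|assumption]. intros k Hk. destruct (H k Hk) as [HW _].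
    split; [apply HW|]. specialize (Hc2 k Hk). specialize (Hav k). split; [|split; [nra|nra]].
    unfold g. destruct (Ha k) as [E|E]; rewrite E.
    - assert (tame (fun _ => 1) (P k) (1 - 0 * (lam ^ 2 * c)) D (V * 0)) as [T1 [T2 T3]] by (apply tame_const; lra).
      assert (Eg : forall i, (1 + lam * 0 * mart_diff f Rb k i) * exp (- (eta * lam) * (0 * f k i)) = 1).
      { intros. rewrite !Rmult_0_l, !Rmult_0_r, exp_0. ring. }
      split; [|split].
      + intros i. rewrite Eg. lra.
      + intros b L. eapply Rle_trans; [|apply (T2 b L)]. apply sumN_le. intros. rewrite !Eg. lra.
      + intros b L. eapply Rle_trans; [|apply (T3 b L)]. apply sumN_le. intros. rewrite !Eg. lra.
    - destruct (tilt_tame r f P Rb Q B Vf sig2 tau lam eta k HT Hl HlB He Hk) as [T1 [T2 T3]].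
      fold c D V in T2, T3. rewrite !Rmult_1_l, !Rmult_1_r.
      assert (Eg : forall i, (1 + lam * mart_diff f Rb k i) * exp (- (eta * lam) * (1 * f k i)) =
        (1 + lam * mart_diff f Rb k i) * exp (- (eta * lam) * f k i)) by (intros; now rewrite Rmult_1_l).
      split; [|split].
      + intros i. rewrite Eg. apply T1.
      + intros b L. eapply Rle_trans; [|apply (T2 b L)]. apply sumN_le. intros. rewrite !Eg. lra.
      + intros b L. eapply Rle_trans; [|apply (T3 b L)]. apply sumN_le. intros. rewrite Eg. lra. }
  specialize (HIB' O Q). eapply Rle_trans; [apply HIB'|].
  assert (HE : 0 <= prodf r (fun k => 1 - a k * (lam ^ 2 * c) + 4 * D * (V * a k) / q) <=
     exp (sumN r a * (lam ^ 2 * (- (eta - eta ^ 2 / 2) * sig2 + tau * (Vf + B) * B + 2 * lam * B ^ 3 + z)))).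
  { assert (Hpt : forall k, (k < r)%nat -> 0 <= 1 - a k * (lam ^ 2 * c) + 4 * D * (V * a k) / q <=
       exp (a k * (lam ^ 2 * (- (eta - eta ^ 2 / 2) * sig2 + tau * (Vf + B) * B + 2 * lam * B ^ 3 + z)))).
    { intros k Hk. rewrite HzD. specialize (Hc2 k Hk). specialize (Hav k). split.
      - assert (0 <= a k * (lam ^ 2 * z)) by (apply Rmult_le_pos; [lra|apply Rmult_le_pos; assumption]). nra.
      - eapply Rle_trans; [|apply exp_ge_1x]. right. unfold c. ring. }
    split; [apply prodf_nonneg; intros k Hk; now apply Hpt|].
    rewrite <- sumN_scal_r, <- prodf_exp. now apply prodf_le. }
  assert (HQr : 0 < INR Q) by now apply lt_0_INR.
  assert (HP0 : 4 * D * INR (P O) <= INR Q).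
  {  destruct (H O ltac:(lia)) as [_ [_ [_ HP]]].
    assert (INR (Rb O) <= INR Q). { apply le_INR. rewrite HD0. assert (D0 <> O) by (intros ->; lia). nia. }
    assert (0 <= INR (P O)) by apply pos_INR. assert (INR (P O) <= INR Q) by nra. nra. }
  fold z. assert (0 <= 4 * D * INR (P O)) by (apply Rmult_le_pos; [lra|apply pos_INR]).
  eapply Rle_trans; [apply Rmult_le_compat_r; [lra|apply HE]|].
  set (ex := exp _) in *. nra.
Qed.

Lemma one_plus_le_exp_log_majorant u : Rabs u <= 1 / 2 -> 1 + u <= exp (log_majorant u).
Proof.
  intros Hu. assert (H := ln_le_cube u Hu). apply Rabs_le_between in Hu.
  rewrite <- (exp_ln (1 + u)) by lra. apply exp_le. exact H.
Qed.

(* The truncated tilts have means close to 1, pairwise correlations at most 1 and second moments at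
   most [exp theta]; so their average over the [J] windows is close to 1 in mean square, and it
   can rarely vanish. *)
Lemma window_chebyshev r f P Rb Q B Vf sig2 tau J (a : nat -> nat -> R) (lam s : nat -> R) eta theta e1 e2 :
  tower r f P Rb Q B Vf sig2 tau -> 0 < B -> (0 < J)%nat -> 0 < eta ->
  (forall w k, a w k = 0 \/ a w k = 1) -> (forall w w' k, w <> w' -> a w k * a w' k = 0) ->
  (forall w, (w < J)%nat -> 0 < lam w /\ lam w * B <= 1 / 16) ->
  (forall w, (w < J)%nat -> sumN Q (fun i => prodf r (fun k => 1 + lam w * a w k * mart_diff f Rb k i) *
      exp (eta * sumN r (fun k => log_majorant (lam w * a w k * mart_diff f Rb k i)))) <= e1 * exp (eta * theta) * INR Q) ->
  (forall w, (w < J)%nat -> sumN Q (fun i => prodf r (fun k => 1 + lam w * a w k * mart_diff f Rb k i) *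
      exp (- (eta * lam w) * sumN r (fun k => a w k * f k i))) <= e2 * exp (- (eta * lam w) * s w) * INR Q) ->
  exists phi : nat -> R, (forall i, 0 <= phi i) /\
    (forall i, (forall w, (w < J)%nat -> sumN r (fun k => a w k * f k i) < s w) -> phi i = 1) /\
    sumN Q phi <= (exp theta / INR J + 2 * (e1 + e2)) * INR Q.
Proof.
  intros HT HB HJ Heta Ha Hdis Hlam H1 H2.
  assert (HJr : 0 < INR J) by now apply lt_0_INR.
  assert (HT' := HT). destruct HT' as [_ [_ [HQ _]]]. assert (HQr : 0 < INR Q) by now apply lt_0_INR.
  set (X := fun w i => prodf r (fun k => 1 + lam w * a w k * mart_diff f Rb k i)).
  set (Gs := fun w i => sumN r (fun k => log_majorant (lam w * a w k * mart_diff f Rb k i))).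
  set (S := fun w i => sumN r (fun k => a w k * f k i)).
  assert (Hu : forall w k i, (w < J)%nat -> (k < r)%nat -> Rabs (lam w * a w k * mart_diff f Rb k i) <= 1 / 8).
  { intros w k i Hw Hk. destruct (tower_mart_diff r f P Rb Q B Vf sig2 tau k HT Hk) as [_ [M2 _]]. specialize (M2 i).
    destruct (Hlam w Hw) as [L1 L2]. destruct (Ha w k) as [-> | ->].
    - rewrite Rmult_0_r, Rmult_0_l, Rabs_R0. lra.
    - rewrite Rmult_1_r, Rabs_mult, (Rabs_pos_eq (lam w)) by lra.
      assert (0 <= Rabs (mart_diff f Rb k i)) by apply Rabs_pos. nra. }
  assert (HX0 : forall w i, (w < J)%nat -> 0 <= X w i).
  { intros w i Hw. apply prodf_nonneg. intros k Hk. specialize (Hu w k i Hw Hk). apply Rabs_le_between in Hu. lra. }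
  assert (HXG : forall w i, (w < J)%nat -> X w i <= exp (Gs w i)).
  { intros w i Hw. unfold X, Gs. rewrite <- prodf_exp. apply prodf_le. intros k Hk.
    specialize (Hu w k i Hw Hk). split; [apply Rabs_le_between in Hu; lra|]. apply one_plus_le_exp_log_majorant. lra. }
  assert (HXm : forall w, (w < J)%nat -> sumN Q (X w) = INR Q).
  { intros w Hw. apply (tilt_mean_one r f P Rb Q B Vf sig2 tau (fun k => lam w * a w k) HT HB).
    intros k. destruct (Hlam w Hw) as [L1 L2]. destruct (Ha w k) as [-> | ->].
    - rewrite Rmult_0_r, Rabs_R0. lra.
    - rewrite Rmult_1_r, Rabs_pos_eq by lra. lra. }
  assert (HXX : forall w w', (w < J)%nat -> (w' < J)%nat -> w <> w' -> sumN Q (fun i => X w i * X w' i) = INR Q).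
  { intros w w' Hw Hw' Hn.
    rewrite <- (tilt_mean_one r f P Rb Q B Vf sig2 tau (fun k => lam w * a w k + lam w' * a w' k) HT HB).
    - apply sumN_ext. intros i _. unfold X. rewrite <- prodf_mult. apply prodf_ext. intros k _.
      assert (D := Hdis w w' k Hn).
      replace ((1 + lam w * a w k * mart_diff f Rb k i) * (1 + lam w' * a w' k * mart_diff f Rb k i)) with
        (1 + (lam w * a w k + lam w' * a w' k) * mart_diff f Rb k i
           + (a w k * a w' k) * (lam w * lam w' * mart_diff f Rb k i ^ 2)) by ring.
      rewrite D. ring.
    - intros k. destruct (Hlam w Hw) as [L1 L2]. destruct (Hlam w' Hw') as [L1' L2'].
      rewrite Rabs_pos_eq; destruct (Ha w k) as [-> | ->], (Ha w' k) as [-> | ->]; nra. }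
  (* The truncation keeps the positions where the log-majorant is at most [theta], which bounds the
     tilt by exp theta, and where the block sum reaches its target. *)
  set (ok := fun w i => Gs w i <= theta /\ s w <= S w i).
  set (Xt := fun w i => if excluded_middle_informative (ok w i) then X w i else 0).
  assert (HXt : forall w i, (w < J)%nat -> 0 <= Xt w i <= X w i /\ Xt w i <= exp theta).
  { intros w i Hw. specialize (HX0 w i Hw). specialize (HXG w i Hw). unfold Xt.
    destruct (excluded_middle_informative (ok w i)) as [[O1 O2]|_].
    - assert (exp (Gs w i) <= exp theta) by now apply exp_le. lra.
    - assert (0 < exp theta) by apply exp_pos. lra. }
  assert (HXt1 : forall w, (w < J)%nat -> (1 - (e1 + e2)) * INR Q <= sumN Q (Xt w)).
  { intros w Hw. destruct (Hlam w Hw) as [L1 L2].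
    (* What the truncation discards is bounded by two exponential Markov inequalities under the
       tilted measure, one for each condition. *)
    assert (A : sumN Q (X w) <= sumN Q (fun i => Xt w i + exp (- (eta * theta)) * (X w i * exp (eta * Gs w i))
        + exp (eta * lam w * s w) * (X w i * exp (- (eta * lam w) * S w i)))).
    { apply sumN_le. intros i _. specialize (HX0 w i Hw).
      assert (P1 : 0 <= exp (- (eta * theta)) * (X w i * exp (eta * Gs w i))).
      { apply Rmult_le_pos; [left; apply exp_pos|]. apply Rmult_le_pos; [assumption|left; apply exp_pos]. }
      assert (P2 : 0 <= exp (eta * lam w * s w) * (X w i * exp (- (eta * lam w) * S w i))).
      { apply Rmult_le_pos; [left; apply exp_pos|]. apply Rmult_le_pos; [assumption|left; apply exp_pos]. }
      unfold Xt. destruct (excluded_middle_informative (ok w i)) as [O|O]; [lra|].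
      unfold ok in O. apply not_and_or in O. destruct O as [O|O]; apply Rnot_le_lt in O.
      - assert (1 <= exp (- (eta * theta)) * exp (eta * Gs w i)).
        { rewrite <- exp_plus. rewrite <- exp_0 at 1. apply exp_le. nra. }
        assert (X w i * 1 <= X w i * (exp (- (eta * theta)) * exp (eta * Gs w i))) by (apply Rmult_le_compat_l; assumption).
        lra.
      - assert (1 <= exp (eta * lam w * s w) * exp (- (eta * lam w) * S w i)).
        { rewrite <- exp_plus. rewrite <- exp_0 at 1. apply exp_le. assert (0 < eta * lam w) by nra. nra. }
        assert (X w i * 1 <= X w i * (exp (eta * lam w * s w) * exp (- (eta * lam w) * S w i))) by (apply Rmult_le_compat_l; assumption).
        lra. }
    rewrite HXm, !sumN_plus, !sumN_scal in A by assumption.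
    specialize (H1 w Hw). specialize (H2 w Hw).
    assert (A1 : exp (- (eta * theta)) * sumN Q (fun i => X w i * exp (eta * Gs w i)) <= e1 * INR Q).
    { replace (e1 * INR Q) with (exp (- (eta * theta)) * (e1 * exp (eta * theta) * INR Q)).
      - apply Rmult_le_compat_l; [left; apply exp_pos|exact H1].
      - rewrite exp_Ropp. field. assert (H := exp_pos (eta * theta)). lra. }
    assert (A2 : exp (eta * lam w * s w) * sumN Q (fun i => X w i * exp (- (eta * lam w) * S w i)) <= e2 * INR Q).
    { replace (e2 * INR Q) with (exp (eta * lam w * s w) * (e2 * exp (- (eta * lam w) * s w) * INR Q)).
      - apply Rmult_le_compat_l; [left; apply exp_pos|exact H2].
      - replace (- (eta * lam w) * s w) with (- (eta * lam w * s w)) by ring.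
        rewrite exp_Ropp. field. assert (H := exp_pos (eta * lam w * s w)). lra. }
    lra. }
  set (Y := fun i => sumN J (fun w => Xt w i)).
  (* If every window misses its target, then [Y] vanishes and the normalised square equals 1. *)
  exists (fun i => (Y i - INR J) ^ 2 / INR J ^ 2). split; [|split].
  - intros i. apply Rdiv_le_0_compat; [apply pow2_ge_0|apply pow_lt; assumption].
  - intros i Hi. replace (Y i) with 0.
    + field. lra.
    + symmetry. apply sumN_zero. intros w Hw. unfold Xt.
      destruct (excluded_middle_informative (ok w i)) as [[_ O]|_]; [|reflexivity].
      specialize (Hi w Hw). unfold S in O. lra.
  - assert (E1 : sumN Q (fun i => Y i ^ 2) <= INR J * exp theta * INR Q + INR J ^ 2 * INR Q).
    { rewrite (sumN_ext Q _ (fun i => sumN J (fun w => sumN J (fun w' => Xt w i * Xt w' i)))) by (intros; apply sumN_sqr).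
      rewrite sumN_swap.
      apply Rle_trans with (sumN J (fun w => sumN J (fun w' => (if Nat.eqb w' w then exp theta * INR Q else 0) + INR Q))).
      - apply sumN_le. intros w Hw. rewrite sumN_swap. apply sumN_le. intros w' Hw'.
        destruct (Nat.eqb_spec w' w) as [->|Hn].
        + apply Rle_trans with (sumN Q (fun i => exp theta * X w i)).
          * apply sumN_le. intros i _. destruct (HXt w i Hw) as [T1 T2].
            apply Rmult_le_compat; lra.
          * rewrite sumN_scal, HXm by assumption. lra.
        + rewrite Rplus_0_l, <- (HXX w w' Hw Hw' ltac:(auto)). apply sumN_le. intros i _.
          destruct (HXt w i Hw) as [T1 _]. destruct (HXt w' i Hw') as [T1' _].
          apply Rmult_le_compat; lra.
      - rewrite (sumN_ext J _ (fun _ => exp theta * INR Q + INR J * INR Q)).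
        + rewrite sumN_const. right. ring.
        + intros w Hw. rewrite sumN_plus, sumN_const.
          rewrite (sumN_single J w (fun _ => exp theta * INR Q)).
          destruct (Nat.ltb_spec w J); [reflexivity|lia]. }
    assert (E2 : INR J * ((1 - (e1 + e2)) * INR Q) <= sumN Q Y).
    { unfold Y. rewrite sumN_swap. rewrite <- sumN_const. apply sumN_le. intros w Hw. now apply HXt1. }
    rewrite (sumN_ext Q _ (fun i => / INR J ^ 2 * (Y i ^ 2 - 2 * INR J * Y i + INR J ^ 2)))
      by (intros; field; lra).
    rewrite sumN_scal, sumN_plus, sumN_minus, sumN_scal, sumN_const.
    replace ((exp theta / INR J + 2 * (e1 + e2)) * INR Q) with
      (/ INR J ^ 2 * (INR J * exp theta * INR Q + INR J ^ 2 * INR Q - 2 * INR J * (INR J * ((1 - (e1 + e2)) * INR Q)) + INR Q * INR J ^ 2))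
      by (field; lra).
    apply Rmult_le_compat_l; [left; apply Rinv_0_lt_compat, pow_lt; assumption|].
    assert (2 * INR J * (INR J * ((1 - (e1 + e2)) * INR Q)) <= 2 * INR J * sumN Q Y)
      by (apply Rmult_le_compat_l; lra).
    fold Y. lra.
Qed.

(** Block lengths Q / 2^al are nested automatically. With 2^(al k) between 2^s and 2^(s+1) times n
    (K0 + k), the length [Rb k] lies between the periods of n (K0 + k) and of n (K0 + S k),
    separated from both by a factor 2^s; this takes q >= 2^(2 s + 1). The functions start at K0 + 1
    so that n K0 can provide the coarsest blocks. *)
Lemma tower_exists (n : nat -> nat) K0 m c B sig2 q s r :
  (forall k, (0 < n k)%nat) -> 0 < B ->
  (forall i, (i < 2 ^ m)%nat -> Rabs (c i) <= B) -> sumN (2 ^ m) c = 0 ->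
  sumN (2 ^ m) (fun i => c i ^ 2) = INR (2 ^ m) * sig2 ->
  (3 <= s)%nat -> 2 ^ (2 * s + 1) <= q ->
  (forall k, (K0 <= k)%nat -> q * INR (n k) <= INR (n (S k))) ->
  exists Q Rb, let P := fun k => (Q / n (K0 + S k)%nat)%nat in
    let f := fun k => cellfun c (Q / (2 ^ m * n (K0 + S k)%nat)) (2 ^ m) in
    tower r f P Rb Q B (2 * B * INR (2 ^ m)) sig2 (/ 2 ^ s) /\
    (forall k, (k < r)%nat -> Nat.divide (2 ^ m * n (K0 + S k)%nat)%nat Q) /\
    (forall k, (S k < r)%nat -> q * INR (P (S k)) <= INR (P k)).
Proof.
  intros Hn HB Hc H0 H2 Hs Hq Hgap.
  set (al := fun k => (s + Nat.log2 (n (K0 + k)%nat) + 1)%nat).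
  destruct (common_multiple (fun k => (2 ^ m * n (K0 + k)%nat * 2 ^ al k)%nat) (S r)) as [Q [HQ Hdiv]].
  { intros k. assert (A := pow2_nat_pos m). assert (A' := pow2_nat_pos (al k)). specialize (Hn (K0 + k)%nat). nia. }
  exists Q, (fun k => (Q / 2 ^ al k)%nat). intros P f.
  assert (HQr : 0 < INR Q) by now apply lt_0_INR.
  assert (Hal : forall k, 2 ^ s * INR (n (K0 + k)%nat) <= 2 ^ al k <= 2 ^ (S s) * INR (n (K0 + k)%nat)).
  { intros k. assert (A := Nat.log2_spec (n (K0 + k)%nat) (Hn (K0 + k)%nat)). unfold al.
    set (l := Nat.log2 (n (K0 + k)%nat)) in *. destruct A as [A1 A2]. apply le_INR in A1. apply lt_INR in A2.
    rewrite INR_pow2 in A1, A2. simpl in A2. rewrite !pow_add. simpl.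
    assert (0 < 2 ^ s) by (apply pow_lt; lra). split; nra. }
  assert (Hda : forall k, (k <= r)%nat -> Nat.divide (2 ^ al k)%nat Q).
  { intros k Hk. eapply Nat.divide_trans; [|apply (Hdiv k); lia]. apply Nat.divide_factor_r. }
  assert (Hdm : forall k, (k < r)%nat -> Nat.divide (2 ^ m * n (K0 + S k)%nat)%nat Q).
  { intros k Hk. eapply Nat.divide_trans; [|apply (Hdiv (S k)); lia]. apply Nat.divide_factor_l. }
  assert (HRb : forall k, (k <= r)%nat -> INR (Q / 2 ^ al k) = INR Q / 2 ^ al k /\ (0 < Q / 2 ^ al k)%nat).
  { intros k Hk. destruct (Hda k Hk) as [z Hz]. assert (A := pow2_nat_pos (al k)). rewrite Hz.
    rewrite Nat.div_mul by lia. split; [|nia]. rewrite mult_INR, INR_pow2. field. apply pow_nonzero. lra. }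
  assert (HP : forall k, (k < r)%nat -> INR (P k) = INR Q / INR (n (K0 + S k)%nat)).
  { intros k Hk. unfold P. destruct (divide_cell_period m (n (K0 + S k)%nat) Q (Hn _) HQ (Hdm k Hk)) as [_ [_ [z Hz]]].
    assert (A := Hn (K0 + S k)%nat). rewrite Hz. rewrite Nat.div_mul by lia. rewrite mult_INR. field. apply not_0_INR. lia. }
  assert (Hq1 : 1 <= q) by (eapply Rle_trans; [|apply Hq]; apply pow_R1_Rle; lra).
  assert (Hmono : forall k, (al k <= al (S k))%nat).
  { intros k. unfold al. assert (Nat.log2 (n (K0 + k)%nat) <= Nat.log2 (n (K0 + S k)%nat))%nat; [|lia].
    apply Nat.log2_le_mono. apply INR_le. specialize (Hgap (K0 + k)%nat ltac:(lia)).
    rewrite <- Nat.add_succ_r in Hgap. assert (0 <= INR (n (K0 + k)%nat)) by apply pos_INR. nra. }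
  assert (H2s : 0 < 2 ^ s) by (apply pow_lt; lra).
  split; [|split; [assumption|]].
  - split; [|split; [|split; [assumption|split]]].
    + split; [now apply Rinv_0_lt_compat|]. replace (1 / 8) with (/ 2 ^ 3) by (simpl; field).
      apply Rinv_le_contravar; [apply pow_lt; lra|]. apply Rle_pow; [lra|assumption].
    + destruct (Hda O ltac:(lia)) as [z Hz]. exists (2 ^ al 0)%nat. rewrite Hz at 2.
      rewrite Nat.div_mul by (assert (A := pow2_nat_pos (al 0%nat)); lia). assumption.
    + intros k Hk. now apply HRb.
    + intros k Hk. destruct (divide_cell_period m (n (K0 + S k)%nat) Q (Hn _) HQ (Hdm k Hk)) as [D1 [D2 D3]].
      split; [|split; [|split]].
      * unfold f, P. rewrite D2. apply wave_cellfun; auto. apply pow2_nat_pos.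
      * destruct (Hda (S k) ltac:(lia)) as [z Hz]. exists (2 ^ (al (S k) - al k))%nat.
        rewrite Hz. rewrite Nat.div_mul by (assert (A := pow2_nat_pos (al (S k))); lia).
        replace (2 ^ al (S k))%nat with (2 ^ (al (S k) - al k) * 2 ^ al k)%nat.
        2:{ rewrite <- Nat.pow_add_r. f_equal. specialize (Hmono k). lia. }
        rewrite Nat.mul_assoc, Nat.div_mul by (assert (A := pow2_nat_pos (al k)); lia). ring.
      * rewrite (HP k Hk). rewrite (proj1 (HRb (S k) ltac:(lia))). destruct (Hal (S k)) as [A1 _].
        assert (A2 : 0 < INR (n (K0 + S k)%nat)) by (apply lt_0_INR, Hn).
        assert (A3 : 0 < 2 ^ al (S k)) by (apply pow_lt; lra).
        replace (/ 2 ^ s * (INR Q / INR (n (K0 + S k)%nat))) with (INR Q / (2 ^ s * INR (n (K0 + S k)%nat))) by (field; lra).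
        apply Rmult_le_compat_l; [lra|]. apply Rinv_le_contravar; [nra|assumption].
      * rewrite (HP k Hk). rewrite (proj1 (HRb k ltac:(lia))). destruct (Hal k) as [_ A1].
        assert (A2 : 0 < INR (n (K0 + S k)%nat)) by (apply lt_0_INR, Hn).
        assert (A3 : 0 < 2 ^ al k) by (apply pow_lt; lra).
        specialize (Hgap (K0 + k)%nat ltac:(lia)). rewrite <- Nat.add_succ_r in Hgap.
        assert (A4 : 2 ^ s * 2 ^ al k <= INR (n (K0 + S k)%nat)).
        { assert (A5 : 2 ^ (2 * s + 1) = 2 ^ s * 2 ^ S s) by (rewrite <- pow_add; f_equal; lia).
          assert (0 <= INR (n (K0 + k)%nat)) by apply pos_INR.
          apply Rle_trans with (2 ^ s * (2 ^ S s * INR (n (K0 + k)%nat))); [apply Rmult_le_compat_l; lra|].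
          rewrite <- Rmult_assoc, <- A5. nra. }
        replace (/ 2 ^ s * (INR Q / 2 ^ al k)) with (INR Q / (2 ^ s * 2 ^ al k)) by (field; lra).
        apply Rmult_le_compat_l; [lra|]. apply Rinv_le_contravar; [nra|assumption].
  - intros k Hk. unfold P. apply (gap_periods (fun k => n (K0 + S k)%nat) q Q k); auto.
    + rewrite (Nat.add_succ_r K0 (S k)). apply Hgap. lia.
    + apply (divide_cell_period m (n (K0 + S k)%nat) Q (Hn _) HQ (Hdm k ltac:(lia))).
    + apply (divide_cell_period m (n (K0 + S (S k))%nat) Q (Hn _) HQ (Hdm (S k) ltac:(lia))).
Qed.

(** * The lower bound for step functions *)

(** An injective sequence tends to infinity, so late blocks of times avoid the frequencies with
    small gaps altogether. *)
Lemma injective_eventually (sigma : nat -> nat) K1 : (forall i j, sigma i = sigma j -> i = j) ->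
  exists U0, forall j, (U0 <= j)%nat -> (K1 <= sigma j)%nat.
Proof.
  intros Hinj. induction K1 as [|K1 [U0 H]]; [exists O; intros; lia|].
  destruct (classic (exists j, sigma j = K1)) as [[j0 Hj0]|Hn].
  - exists (Nat.max U0 (S j0)). intros j Hj. specialize (H j ltac:(lia)).
    assert (sigma j <> K1); [|lia]. intros E. assert (j = j0) by (apply Hinj; congruence). lia.
  - exists U0. intros j Hj. specialize (H j Hj). assert (sigma j <> K1); [|lia].
    intros E. apply Hn. now exists j.
Qed.

Lemma block_weight_disjoint sigma u v u' v' k : (forall i j, sigma i = sigma j -> i = j) ->
  (u + v <= u' \/ u' + v' <= u)%nat -> block_weight sigma u v k * block_weight sigma u' v' k = 0.
Proof.
  intros Hinj Hd.
  assert (Hw : forall u v, block_weight sigma u v k = 0 \/ exists j, (u <= j < u + v)%nat /\ sigma j = k).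
  { intros u0 v0. destruct (classic (exists j, (u0 <= j < u0 + v0)%nat /\ sigma j = k)) as [H|H]; [now right|left].
    apply sumN_zero. intros j Hj. destruct (Nat.eqb_spec (sigma (u0 + j)%nat) k) as [E|E]; [|reflexivity].
    exfalso. apply H. exists (u0 + j)%nat. split; [lia|assumption]. }
  destruct (Hw u v) as [-> |[j [Hj Ej]]]; [ring|]. destruct (Hw u' v') as [-> |[j' [Hj' Ej']]]; [ring|].
  assert (j = j') by (apply Hinj; congruence). lia.
Qed.

Lemma block_weight_before sigma u v k : (forall j, (u <= j)%nat -> (k < sigma j)%nat) -> block_weight sigma u v k = 0.
Proof.
  intros H. apply sumN_zero. intros j Hj. specialize (H (u + j)%nat ltac:(lia)).
  destruct (Nat.eqb_spec (sigma (u + j)%nat) k); [lia|reflexivity].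
Qed.

Lemma reorder_tail sigma u v K1 r (h : nat -> R) :
  (forall j, (u <= j)%nat -> (K1 <= sigma j)%nat) -> (forall j, (j < u + v)%nat -> (sigma j < r)%nat) ->
  sumN v (fun j => h (sigma (u + j)%nat)) = sumN r (fun k => block_weight sigma u v (K1 + k) * h (K1 + k)%nat).
Proof.
  intros H1 H2. rewrite (reorder sigma u v (K1 + r) h).
  2:{ intros j Hj. specialize (H2 (u + j)%nat ltac:(lia)). lia. }
  rewrite sumN_add, sumN_zero; [ring|]. intros k Hk. rewrite block_weight_before; [ring|].
  intros j Hj. specialize (H1 j Hj). lia.
Qed.

Definition block_start (p i : nat) : nat := (2 ^ (p * i))%nat.
Definition block_len (p i : nat) : nat := (2 ^ (p * S i) - 2 ^ (p * i))%nat.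
(** The factor 1 - eps is that of the tilt, taken below its optimum, and 1 - 2 eps leaves room under
    the drift. The parameter [A] stands for log log N. *)
Definition low_threshold (p i : nat) (sig eps A : R) : R :=
  (1 - 2 * eps) * (1 - eps) * sig * sqrt (2 * INR (block_len p i) * A).

Lemma block_len_ge p i : (1 <= p)%nat -> (2 ^ i <= block_len p i)%nat /\ (block_start p i + block_len p i = block_start p (S i))%nat.
Proof.
  intros Hp. unfold block_len, block_start.
  assert (E : (2 ^ (p * S i) = 2 ^ p * 2 ^ (p * i))%nat) by (rewrite <- Nat.pow_add_r; f_equal; lia).
  assert (A : (2 ^ 1 <= 2 ^ p)%nat) by (apply Nat.pow_le_mono_r; lia). simpl in A.
  assert (B : (2 ^ i <= 2 ^ (p * i))%nat) by (apply Nat.pow_le_mono_r; nia).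
  rewrite E. split; nia.
Qed.

Lemma lower_window (n sigma : nat -> nat) m c B sig eps p :
  (forall k, (0 < n k)%nat) -> large_gaps n -> (forall i j, sigma i = sigma j -> i = j) -> 0 < B ->
  (forall s, (s < 2 ^ m)%nat -> Rabs (c s) <= B) -> sumN (2 ^ m) c = 0 -> 0 < sig ->
  sumN (2 ^ m) (fun s => c s ^ 2) = INR (2 ^ m) * sig ^ 2 -> 0 < eps <= 1 / 2 -> (1 <= p)%nat ->
  exists J0, forall J, (J0 <= J)%nat ->
    small (fun x => 0 < x < 1 /\ forall w, (w < J)%nat ->
       cell_sum n sigma m c (block_start p (J + w)) (block_len p (J + w)) x < low_threshold p (J + w) sig eps (ln (INR J)))
     (14 * exp (- (eps ^ 2 / 32 * ln (INR J)))).
Proof.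
  intros Hn Hgaps Hinj HB Hc Hc0 Hsig Hvar Heps Hp.
  set (K := INR (2 ^ m)). set (Vf := 2 * B * K).
  assert (HK : 1 <= K) by (apply (le_INR 1); assert (H := pow2_nat_pos m); lia).
  assert (HVf : 0 <= Vf) by (unfold Vf; nra).
  assert (Hsig2 : 0 < sig ^ 2) by (apply pow_lt; assumption).
  assert (He2 : 0 < eps ^ 2) by (apply pow_lt; lra).
  (* Three errors in the drift, from [tau], from the size of the tilt and from the gaps, get z1
     each; together they stay below eps^2 sig^2 / 4. *)
  set (z1 := eps ^ 2 * sig ^ 2 / 12). assert (Hz1 : 0 < z1) by (unfold z1; nra).
  destruct (nat_above ((Vf + B) * B / z1 + 4 * B ^ 2 / (eps * sig ^ 2))) as [s0 Hs0].
  set (s := (s0 + 3)%nat). set (tau := / 2 ^ s).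
  assert (H2s : INR s0 < 2 ^ s).
  { unfold s. rewrite pow_add. assert (A : (s0 < 2 ^ s0)%nat) by (apply Nat.pow_gt_lin_r; lia).
    apply lt_INR in A. rewrite INR_pow2 in A. assert (0 < 2 ^ s0) by (apply pow_lt; lra). simpl (2 ^ 3). lra. }
  assert (Htau0 : 0 < tau) by (unfold tau; apply Rinv_0_lt_compat, pow_lt; lra).
  assert (Hq1 : 0 <= (Vf + B) * B / z1) by (apply Rdiv_le_0_compat; [nra|assumption]).
  assert (Hq2 : 0 <= 4 * B ^ 2 / (eps * sig ^ 2)) by (apply Rdiv_le_0_compat; [assert (0 <= B ^ 2) by apply pow2_ge_0; lra|nra]).
  assert (Htau1 : tau * (Vf + B) * B <= z1).
  { specialize (Hs0 s0 ltac:(lia)). assert (A : (Vf + B) * B / z1 <= 2 ^ s) by lra.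
    apply Rle_div_l in A; [|assumption]. unfold tau.
    assert (0 < 2 ^ s) by (apply pow_lt; lra).
    rewrite Rmult_assoc, Rmult_comm. apply Rle_div_l; [assumption|lra]. }
  assert (Htau2 : tau * B ^ 2 <= eps / 4 * sig ^ 2).
  { specialize (Hs0 s0 ltac:(lia)). assert (A : 4 * B ^ 2 / (eps * sig ^ 2) <= 2 ^ s) by lra.
    apply Rle_div_l in A; [|nra]. unfold tau.
    assert (0 < 2 ^ s) by (apply pow_lt; lra).
    rewrite Rmult_comm. apply Rle_div_l; [assumption|lra]. }
  set (Z := 4 * (9 * B + Vf) * (11 * Vf + 4 * B)). assert (HZ : 0 <= Z) by (unfold Z; nra).
  set (q := Rmax (2 ^ (2 * s + 1)) (Rmax 8 (Z / z1))).
  assert (Hq8 : 8 <= q) by (eapply Rle_trans; [apply Rmax_l|apply Rmax_r]).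
  assert (HqZ : Z / q <= z1).
  { assert (A : Z / z1 <= q) by (eapply Rle_trans; [apply (Rmax_r 8)|apply Rmax_r]).
    apply Rle_div_l in A; [|assumption]. apply Rle_div_l; lra. }
  destruct (Hgaps q) as [K0 HK0].
  destruct (injective_eventually sigma (S K0) Hinj) as [U0 HU0].
  set (lmax := Rmin (1 / 16 / B) (Rmin (1 / 4 / (11 * Vf + 9 * B)) (Rmin (z1 / (2 * B ^ 3)) (eps ^ 2 * sig ^ 2 / 32 / (176 * B ^ 3))))).
  assert (HB3 : 0 < B ^ 3) by (apply pow_lt; lra).
  assert (Hlmax : 0 < lmax).
  { unfold lmax. repeat apply Rmin_glb_lt; apply Rdiv_lt_0_compat; try lra; nra. }
  destruct (sqrt_ln_over_pow_small (lmax * sig / 2)) as [J1 HJ1]; [nra|].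
  exists (J1 + U0 + 3)%nat. intros J HJ.
  assert (HL1 := ln_ge_1 J ltac:(lia)). set (A := ln (INR J)) in *.
  (* A fraction 1 - eps of the optimal tilt. At the optimum the mean log-likelihood would be about
     ln J and the second moment of order J; the reduced tilt allows truncation at J^(1 - eps), below
     the number of windows. *)
  set (lam := fun w => (1 - eps) * sqrt (2 * A / INR (block_len p (J + w))) / sig).
  assert (Hvb : forall w, 2 ^ J <= INR (block_len p (J + w)) /\ 0 < INR (block_len p (J + w))).
  { intros w. destruct (block_len_ge p (J + w) Hp) as [V1 _]. apply le_INR in V1. rewrite INR_pow2, pow_add in V1.
    assert (0 < 2 ^ J) by (apply pow_lt; lra). assert (1 <= 2 ^ w) by (apply pow_R1_Rle; lra). split; nra. }
  assert (Hlam : forall w, 0 < lam w <= lmax).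
  { intros w. destruct (Hvb w) as [V1 V2]. unfold lam. split.
    - apply Rdiv_lt_0_compat; [|assumption]. apply Rmult_lt_0_compat; [lra|]. apply sqrt_lt_R0. apply Rdiv_lt_0_compat; lra.
    - apply Rle_div_l; [assumption|].
      assert (E : sqrt (2 * A / INR (block_len p (J + w))) <= 2 * sqrt (A / 2 ^ J)).
      { rewrite <- (sqrt_square 2) at 2 by lra. assert (0 < 2 ^ J) by (apply pow_lt; lra).
        rewrite <- sqrt_mult; [|lra|apply Rdiv_le_0_compat; lra]. apply sqrt_le_1_alt.
        replace (2 * 2 * (A / 2 ^ J)) with (4 * A / 2 ^ J) by (field; lra).
        apply Rmult_le_compat; [lra|left; now apply Rinv_0_lt_compat|lra|apply Rinv_le_contravar; assumption]. }
      specialize (HJ1 J ltac:(lia)). fold A in HJ1.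
      assert (0 <= sqrt (2 * A / INR (block_len p (J + w)))) by apply sqrt_pos. nra. }
  assert (HlamB : forall w, lam w * B <= 1 / 16).
  { intros w. destruct (Hlam w) as [_ L]. assert (L' : lam w <= 1 / 16 / B) by (eapply Rle_trans; [apply L|apply Rmin_l]).
    apply Rle_div_r in L'; assumption. }
  assert (HlamV : forall w, lam w * (11 * Vf + 9 * B) <= 1 / 4).
  { intros w. destruct (Hlam w) as [_ L]. assert (L' : lam w <= 1 / 4 / (11 * Vf + 9 * B)).
    { eapply Rle_trans; [apply L|]. eapply Rle_trans; [apply Rmin_r|apply Rmin_l]. }
    apply Rle_div_r in L'; [assumption|lra]. }
  assert (HlamZ : forall w, 2 * lam w * B ^ 3 <= z1).
  { intros w. destruct (Hlam w) as [_ L]. assert (L' : lam w <= z1 / (2 * B ^ 3)).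
    { eapply Rle_trans; [apply L|]. eapply Rle_trans; [apply Rmin_r|]. eapply Rle_trans; [apply Rmin_r|apply Rmin_l]. }
    apply Rle_div_r in L'; lra. }
  assert (HlamY : forall w, 176 * lam w * B ^ 3 <= eps ^ 2 * sig ^ 2 / 32).
  { intros w. destruct (Hlam w) as [_ L]. assert (L' : lam w <= eps ^ 2 * sig ^ 2 / 32 / (176 * B ^ 3)).
    { eapply Rle_trans; [apply L|]. eapply Rle_trans; [apply Rmin_r|]. eapply Rle_trans; [apply Rmin_r|apply Rmin_r]. }
    apply Rle_div_r in L'; lra. }
  assert (Hl2 : forall w, INR (block_len p (J + w)) * lam w ^ 2 = 2 * (1 - eps) ^ 2 * A / sig ^ 2).
  { intros w. destruct (Hvb w) as [V1 V2]. unfold lam, Rdiv. rewrite !Rpow_mult_distr, pow2_sqrt.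
    - field. split; lra.
    - apply Rdiv_le_0_compat; lra. }
  assert (Hls : forall w, lam w * low_threshold p (J + w) sig eps A = (1 - 2 * eps) * (2 * (1 - eps) ^ 2 * A)).
  { intros w. destruct (Hvb w) as [V1 V2]. unfold lam, low_threshold.
    replace ((1 - eps) * sqrt (2 * A / INR (block_len p (J + w))) / sig * ((1 - 2 * eps) * (1 - eps) * sig * sqrt (2 * INR (block_len p (J + w)) * A)))
      with ((1 - 2 * eps) * (1 - eps) ^ 2 * (sqrt (2 * A / INR (block_len p (J + w))) * sqrt (2 * INR (block_len p (J + w)) * A))) by (field; lra).
    rewrite <- sqrt_mult; [|apply Rdiv_le_0_compat; lra|nra].
    replace (2 * A / INR (block_len p (J + w)) * (2 * INR (block_len p (J + w)) * A)) with ((2 * A) * (2 * A)) by (field; lra).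
    rewrite sqrt_square by lra. ring. }
  (* The log-likelihood has mean about (1 - eps)^2 A under the tilt. Truncation at (1 - eps) A
     leaves a margin of order eps A, which [eta] of order eps turns into the gain exp(- kap). *)
  set (eta := eps / 2). set (theta := (1 - eps) * A). set (kap := eps ^ 2 / 32 * A).
  destruct (range_bound sigma 0 (block_start p (J + J))) as [r Hr].
  destruct (tower_exists n K0 m c B (sig ^ 2) q s r Hn HB Hc Hc0 Hvar ltac:(unfold s; lia) (Rmax_l _ _) HK0)
    as [Q [Rb [HT [Hdiv Hgap]]]].
  set (P := fun k => (Q / n (K0 + S k)%nat)%nat) in *.
  set (f := fun k => cellfun c (Q / (2 ^ m * n (K0 + S k)%nat)) (2 ^ m)) in *.
  fold K Vf tau in HT.
  set (a := fun w k => block_weight sigma (block_start p (J + w)) (block_len p (J + w)) (S K0 + k)).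
  assert (Hub : forall w j, (block_start p (J + w) <= j)%nat -> (S K0 <= sigma j)%nat).
  { intros w j Hj. apply HU0. assert (U0 < block_start p (J + w))%nat; [|lia]. unfold block_start.
    apply Nat.lt_le_trans with (2 ^ (J + w))%nat; [|apply Nat.pow_le_mono_r; nia].
    assert (J + w < 2 ^ (J + w))%nat by (apply Nat.pow_gt_lin_r; lia). lia. }
  assert (Hsr : forall w j, (w < J)%nat -> (j < block_start p (J + w) + block_len p (J + w))%nat -> (sigma j < r)%nat).
  { intros w j Hw Hj. apply (Hr j). destruct (block_len_ge p (J + w) Hp) as [_ E]. rewrite E in Hj.
    eapply Nat.lt_le_trans; [apply Hj|]. unfold block_start. apply Nat.pow_le_mono_r; nia. }
  assert (Hsum : forall w h, (w < J)%nat -> sumN (block_len p (J + w)) (fun j => h (sigma (block_start p (J + w) + j)%nat)) =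
     sumN r (fun k => a w k * h (S K0 + k)%nat)).
  { intros w h Hw. apply reorder_tail; [apply Hub|intros j Hj; now apply (Hsr w j Hw)]. }
  assert (Hsa : forall w, (w < J)%nat -> sumN r (a w) = INR (block_len p (J + w))).
  { intros w Hw. assert (E := Hsum w (fun _ => 1) Hw). cbv beta in E. rewrite sumN_const, Rmult_1_r in E.
    rewrite E. apply sumN_ext. intros; ring. }
  assert (Ha : forall w k, a w k = 0 \/ a w k = 1) by (intros; now apply block_weight_01).
  destruct (window_chebyshev r f P Rb Q B Vf (sig ^ 2) tau J a lam (fun w => low_threshold p (J + w) sig eps A)
    eta theta (exp (- kap)) (2 * exp (- kap)) HT HB ltac:(lia) ltac:(unfold eta; lra) Ha) as [phi [F1 [F2 F3]]].
  - intros w w' k Hww. apply block_weight_disjoint; [assumption|].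
    destruct (block_len_ge p (J + w) Hp) as [_ E]. destruct (block_len_ge p (J + w') Hp) as [_ E'].
    rewrite E, E'. unfold block_start. destruct (Nat.lt_trichotomy w w') as [H|[H|H]]; [left| contradiction |right];
      apply Nat.pow_le_mono_r; nia.
  - intros w Hw. split; [apply Hlam|apply HlamB].
  - intros w Hw.
    eapply Rle_trans; [apply (tilt_growth r f P Rb Q B Vf (sig ^ 2) tau (a w) (lam w) eta HT HB (Ha w)); [apply Hlam|apply HlamB|unfold eta; lra]|].
    apply Rmult_le_compat_r; [apply pos_INR|]. rewrite <- exp_plus. apply exp_le.
    rewrite (Hsa w Hw). specialize (HlamY w). rewrite <- Rmult_assoc, Hl2.
    set (Y := 88 * lam w * B ^ 3) in *.
    assert (HY : Y <= eps ^ 2 * sig ^ 2 / 64) by (unfold Y; lra).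
    assert (E1 : (eta + eta ^ 2) / 2 * (sig ^ 2 + tau * B ^ 2) + Y <=
      sig ^ 2 * ((eta + eta ^ 2) / 2 * (1 + eps / 4) + eps ^ 2 / 64)).
    { assert (0 <= (eta + eta ^ 2) / 2) by (unfold eta; simpl; nra).
      assert ((eta + eta ^ 2) / 2 * (sig ^ 2 + tau * B ^ 2) <= (eta + eta ^ 2) / 2 * (sig ^ 2 + eps / 4 * sig ^ 2))
        by (apply Rmult_le_compat_l; lra). lra. }
    apply Rle_trans with (2 * (1 - eps) ^ 2 * A / sig ^ 2 * (sig ^ 2 * ((eta + eta ^ 2) / 2 * (1 + eps / 4) + eps ^ 2 / 64))).
    { apply Rmult_le_compat_l; [|assumption]. apply Rdiv_le_0_compat; [|assumption].
      assert (0 <= (1 - eps) ^ 2) by apply pow2_ge_0. nra. }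
    replace (2 * (1 - eps) ^ 2 * A / sig ^ 2 * (sig ^ 2 * ((eta + eta ^ 2) / 2 * (1 + eps / 4) + eps ^ 2 / 64))) with
      (A * ((1 - eps) ^ 2 * ((eta + eta ^ 2) * (1 + eps / 4) + eps ^ 2 / 32))) by (field; lra).
    unfold kap, theta. replace (- (eps ^ 2 / 32 * A) + eta * ((1 - eps) * A)) with (A * (eta * (1 - eps) - eps ^ 2 / 32)) by field.
    apply Rmult_le_compat_l; [lra|].
    assert (E2 : (1 - eps) ^ 2 * (eps ^ 2 / 32) <= eps ^ 2 / 32).
    { assert ((1 - eps) ^ 2 <= 1) by (simpl; nra). nra. }
    assert (E3 : (1 - eps) ^ 2 * ((eta + eta ^ 2) * (1 + eps / 4)) <= eta * (1 - eps) - eps ^ 2 / 16).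
    { replace ((1 - eps) ^ 2 * ((eta + eta ^ 2) * (1 + eps / 4))) with
        (eta * (1 - eps) * ((1 - eps) * ((1 + eta) * (1 + eps / 4)))) by ring.
      assert (E4 : (1 - eps) * ((1 + eta) * (1 + eps / 4)) <= 1 - eps / 4).
      { unfold eta. assert (0 <= eps ^ 3) by (apply pow_le; lra). simpl in *. nra. }
      assert (0 <= eta * (1 - eps)) by (unfold eta; nra).
      apply Rle_trans with (eta * (1 - eps) * (1 - eps / 4)); [apply Rmult_le_compat_l; assumption|].
      unfold eta in *. simpl. nra. }
    lra.
  - intros w Hw.
    eapply Rle_trans; [apply (tilt_drift r f P Rb Q B Vf (sig ^ 2) tau (a w) (lam w) eta q HT HB HVf (Ha w));
      [apply Hlam|apply HlamB|unfold eta; lra|assumption|apply HlamV|assumption]|].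
    apply Rmult_le_compat_r; [apply pos_INR|]. rewrite (Rmult_assoc 2 (exp (- kap))).
    apply Rmult_le_compat_l; [lra|]. rewrite <- exp_plus. apply exp_le.
    rewrite (Hsa w Hw). specialize (HlamZ w). rewrite <- Rmult_assoc, Hl2.
    replace (- (eta * lam w) * low_threshold p (J + w) sig eps A) with (- eta * (lam w * low_threshold p (J + w) sig eps A)) by ring.
    rewrite Hls. fold Z.
    set (z := - (eta - eta ^ 2 / 2) * sig ^ 2 + tau * (Vf + B) * B + 2 * lam w * B ^ 3 + Z / q).
    assert (Hz : z <= sig ^ 2 * (- (eta - eta ^ 2 / 2) + eps ^ 2 / 4)) by (unfold z, z1 in *; lra).
    set (La := 2 * (1 - eps) ^ 2 * A).
    assert (HLa : A / 2 <= La).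
    { unfold La. assert (1 / 4 <= (1 - eps) ^ 2) by (simpl; nra). nra. }
    apply Rle_trans with (La / sig ^ 2 * (sig ^ 2 * (- (eta - eta ^ 2 / 2) + eps ^ 2 / 4))).
    { apply Rmult_le_compat_l; [|assumption]. apply Rdiv_le_0_compat; [lra|assumption]. }
    replace (La / sig ^ 2 * (sig ^ 2 * (- (eta - eta ^ 2 / 2) + eps ^ 2 / 4))) with
      (La * (- (eta - eta ^ 2 / 2) + eps ^ 2 / 4)) by (field; lra).
    unfold kap. assert (E : - (eta - eta ^ 2 / 2) + eps ^ 2 / 4 = - eta * (1 - 2 * eps) - 5 / 8 * eps ^ 2) by (unfold eta; field).
    rewrite E. assert (A / 2 * eps ^ 2 <= La * eps ^ 2) by (apply Rmult_le_compat_r; lra).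
    assert (0 <= A * eps ^ 2) by nra. lra.
  - eapply small_sub; [apply (small_of_markov Q phi (fun x => forall w, (w < J)%nat ->
       cell_sum n sigma m c (block_start p (J + w)) (block_len p (J + w)) x < low_threshold p (J + w) sig eps (ln (INR J)))
       (exp theta / INR J + 2 * (exp (- kap) + 2 * exp (- kap))))| |].
    + apply HT.
    + assumption.
    + intros x Hx Hall. rewrite F2; [lra|]. intros w Hw. fold A in Hall. eapply Rle_lt_trans; [|apply (Hall w Hw)].
      right. unfold cell_sum. rewrite (Hsum w (fun j => c (cell_index m (n j) x)) Hw). apply sumN_ext. intros k Hk.
      f_equal. unfold f. rewrite Nat.add_succ_comm. symmetry.
      apply cell_index_cellfun; [lra|apply HT|apply Hn|now apply Hdiv].
    + apply F3.
    + intros x Hx. exact Hx.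
    (* Here exp theta / J = J^(-eps). The terms of [window_chebyshev] add up to 1 + 2 (1 + 2) = 7
       times exp(- kap), doubled to 14 by [small_of_markov]. *)
    + assert (E : exp theta / INR J <= exp (- kap)).
      { assert (HJp : 0 < INR J) by (apply lt_0_INR; lia).
        replace (exp theta / INR J) with (exp (- (eps * A))).
        - apply exp_le. unfold kap. assert (eps ^ 2 / 32 <= eps) by (simpl; nra). nra.
        - unfold theta, Rdiv. replace ((1 - eps) * A) with (- (eps * A) + A) by ring.
          rewrite exp_plus. unfold A at 3. rewrite exp_ln by assumption. field. lra. }
      fold A. fold kap. lra.
Qed.

(** The last block must dominate everything before it. As consecutive starting times have ratio 2^p,
    [step_upper] for - c shows that the earlier sum costs at most a multiple of 2^(-p/2) times the
    norm at N. *)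
Lemma step_lower (n sigma : nat -> nat) m c B sig delta :
  (forall k, (0 < n k)%nat) -> large_gaps n -> (forall i j, sigma i = sigma j -> i = j) -> 0 < B ->
  (forall s, (s < 2 ^ m)%nat -> Rabs (c s) <= B) -> sumN (2 ^ m) c = 0 -> 0 < sig ->
  sumN (2 ^ m) (fun s => c s ^ 2) = INR (2 ^ m) * sig ^ 2 -> 0 < delta ->
  ae01 (fun x => forall N0, exists N, (N0 <= N)%nat /\ (sig - delta) * lil_norm N <= cell_sum n sigma m c 0 N x).
Proof.
  intros Hn Hgaps Hinj HB Hc Hc0 Hsig Hvar Hdel.
  set (eps := Rmin (1 / 2) (delta / (20 * sig))).
  assert (Heps : 0 < eps <= 1 / 2).
  { unfold eps. split; [|apply Rmin_l]. apply Rmin_glb_lt; [lra|apply Rdiv_lt_0_compat; lra]. }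
  assert (Heps2 : 20 * sig * eps <= delta).
  { assert (A : eps <= delta / (20 * sig)) by apply Rmin_r. apply Rle_div_r in A; lra. }
  destruct (nat_above ((sig + 1) * 4 / delta + 1 / eps)) as [p0 Hp0]. specialize (Hp0 p0 ltac:(lia)).
  assert (Hpa : 0 <= (sig + 1) * 4 / delta) by (apply Rdiv_le_0_compat; lra).
  assert (Hpb : 0 <= 1 / eps) by (apply Rdiv_le_0_compat; lra).
  (* An even exponent makes 2^(-p/2) a power of 2. *)
  set (p' := S p0). set (p := (2 * p')%nat).
  assert (H2p : INR p0 < 2 ^ p').
  { assert (A : (p' < 2 ^ p')%nat) by (apply Nat.pow_gt_lin_r; lia). apply lt_INR in A. rewrite INR_pow2 in A.
    unfold p' in A at 1. rewrite S_INR in A. lra. }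
  set (d := / 2 ^ p'). assert (H2p0 : 0 < 2 ^ p') by (apply pow_lt; lra).
  assert (Hd : 0 < d) by (unfold d; now apply Rinv_0_lt_compat).
  assert (Hd1 : (sig + 1) * d <= delta / 4).
  { assert (A : (sig + 1) * 4 / delta <= 2 ^ p') by lra. apply (proj1 (Rle_div_l _ _ _ Hdel)) in A.
    unfold d. apply (proj2 (Rle_div_l (sig + 1) (delta / 4) _ H2p0)). lra. }
  assert (Hd2 : d <= eps).
  { assert (A : 1 / eps <= 2 ^ p') by lra. apply (proj1 (Rle_div_l _ _ _ (proj1 Heps))) in A.
    unfold d. replace (/ 2 ^ p') with (1 / 2 ^ p') by (unfold Rdiv; ring).
    apply (proj2 (Rle_div_l 1 eps _ H2p0)). lra. }
  assert (Hdp : 2 ^ p = / (d * d)).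
  { unfold d, p. rewrite <- Rinv_mult, Rinv_inv, <- pow_add. f_equal. lia. }
  (* For J <= i < 2 J one has ln (i/2) <= ln J, so this threshold, which does not mention J, lies
     below the one of the window starting at J. *)
  set (E := fun i x => cell_sum n sigma m c (block_start p i) (block_len p i) x < low_threshold p i sig eps (ln (INR i / 2))).
  assert (Hae : ae01 (fun x => forall I0, exists i, (I0 <= i)%nat /\ ~ E i x)).
  { destruct (lower_window n sigma m c B sig eps p Hn Hgaps Hinj HB Hc Hc0 Hsig Hvar Heps ltac:(unfold p, p'; lia)) as [J0 HJ0].
    apply null_sub with (fun x => exists I0, (0 < x < 1 /\ forall i, (I0 <= i)%nat -> E i x)).
    - apply null_union. intros I0. apply null_of_small. intros e0 He0.
      destruct (ln_INR_unbounded (- ln (e0 / 14) * (32 / eps ^ 2))) as [J1 HJ1].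
      set (J := (J0 + J1 + I0 + 1)%nat). specialize (HJ1 J ltac:(lia)).
      eapply small_sub; [apply (HJ0 J ltac:(lia))| |].
      + intros x [Hx HE]. split; [assumption|]. intros w Hw.
        eapply Rlt_le_trans; [apply (HE (J + w)%nat ltac:(lia))|]. unfold low_threshold.
        apply Rmult_le_compat_l.
        * apply Rmult_le_pos; [|lra]. apply Rmult_le_pos; lra.
        * apply sqrt_le_1_alt. apply Rmult_le_compat_l; [assert (A := pos_INR (block_len p (J + w))); lra|].
          assert (0 < INR J) by (apply lt_0_INR; lia).
          rewrite plus_INR. assert (INR w <= INR J) by (apply le_INR; lia). assert (0 <= INR w) by apply pos_INR.
          apply ln_le; lra.
      + assert (He2 : 0 < eps ^ 2) by (apply pow_lt; lra).
        apply Rle_trans with (14 * exp (ln (e0 / 14))).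
        * apply Rmult_le_compat_l; [lra|]. apply exp_le.
          apply Rmult_lt_compat_l with (r := eps ^ 2 / 32) in HJ1; [|lra].
          replace (eps ^ 2 / 32 * (- ln (e0 / 14) * (32 / eps ^ 2))) with (- ln (e0 / 14)) in HJ1 by (field; lra). lra.
        * rewrite exp_ln by lra. lra.
    - intros x [Hx Hn']. apply not_all_ex_not in Hn'. destruct Hn' as [I0 HI]. exists I0. split; [assumption|].
      intros i Hi. apply NNPP. intros HnE. apply HI. exists i. auto. }
  assert (Hup : ae01 (fun x => exists N0, forall N, (N0 <= N)%nat -> cell_sum n sigma m (fun s => - c s) 0 N x <= (sig + 1) * lil_norm N)).
  { apply (step_upper n sigma m (fun s => - c s) B sig 1 Hn Hgaps Hinj); try lra.
    - intros s Hs. rewrite Rabs_Ropp. now apply Hc.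
    - rewrite (sumN_opp _ c), Hc0. ring.
    - rewrite (sumN_ext _ _ (fun s => c s ^ 2)) by (intros; ring). lra. }
  eapply ae_impl; [apply (ae_and _ _ Hae Hup)|]. intros x Hx [H1 [N1 H2]] N0.
  destruct (ln_INR_unbounded ((ln (INR p) + 2 * ln 2) / eps)) as [I1 HI1].
  destruct (H1 (N0 + N1 + I1 + 3)%nat) as [i [Hi HE]]. specialize (HI1 i ltac:(lia)).
  assert (Hp1 : (1 <= p)%nat) by (unfold p, p'; lia).
  destruct (block_len_ge p i Hp1) as [_ Evb].
  exists (block_start p (S i)).
  assert (Hi2 : (i < 2 ^ i)%nat) by (apply Nat.pow_gt_lin_r; lia).
  assert (Hubi : (i <= block_start p i)%nat).
  { unfold block_start. assert (2 ^ i <= 2 ^ (p * i))%nat by (apply Nat.pow_le_mono_r; nia). lia. }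
  split; [lia|]. rewrite <- Evb. rewrite cell_sum_add, Nat.add_0_l. rewrite Evb.
  set (N := block_start p (S i)) in *.
  assert (Hlow : low_threshold p i sig eps (ln (INR i / 2)) <= cell_sum n sigma m c (block_start p i) (block_len p i) x)
    by (apply Rnot_lt_le; exact HE).
  assert (Hneg : - ((sig + 1) * lil_norm (block_start p i)) <= cell_sum n sigma m c 0 (block_start p i) x).
  { specialize (H2 (block_start p i) ltac:(lia)). unfold cell_sum in *. rewrite sumN_opp in H2. lra. }
  assert (HNu : INR (block_start p i) = d * d * INR N).
  { unfold N, block_start. rewrite !INR_pow2. replace (p * S i)%nat with (p + p * i)%nat by lia. rewrite pow_add, Hdp. field.
    apply Rgt_not_eq. assumption. }
  assert (HNp : 0 < INR N) by (apply lt_0_INR; lia).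
  assert (Hi3 : 3 <= INR i) by (replace 3 with (INR 3) by (simpl; ring); apply le_INR; lia).
  assert (Hln2 := ln2_lower). assert (Hln21 : ln 2 <= 1).
  { rewrite <- (ln_exp 1). apply ln_le; [lra|]. assert (HH := exp_ge_1x 1). lra. }
  assert (HpR : 1 <= INR p) by (apply (le_INR 1); assumption).
  assert (HlnN : ln (INR N) = INR p * (INR i + 1) * ln 2).
  { unfold N, block_start. rewrite INR_pow2, pow2_exp, ln_exp, mult_INR, S_INR. ring. }
  assert (HlnU : ln (INR (block_start p i)) = INR p * INR i * ln 2).
  { unfold block_start. rewrite INR_pow2, pow2_exp, ln_exp, mult_INR. ring. }
  assert (HLi : 1 <= ln (INR i)) by (apply ln_ge_1; lia).
  assert (Hpi : 3 / 2 < INR p * INR i * ln 2).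
  { assert (3 <= INR p * INR i) by nra. nra. }
  assert (Hmono : ln (ln (INR (block_start p i))) <= ln (ln (INR N))).
  { rewrite HlnN, HlnU. apply ln_le; [lra|]. apply Rmult_le_compat_r; nra. }
  assert (Hll0 : 0 <= ln (ln (INR (block_start p i)))).
  { rewrite HlnU. rewrite <- ln_1. apply ln_le; lra. }
  assert (HtU : lil_norm (block_start p i) <= d * lil_norm N).
  { unfold lil_norm. rewrite HNu at 1. replace d with (sqrt (d * d)) at 3 by (apply sqrt_square; lra).
    rewrite <- sqrt_mult; [|nra|].
    - apply sqrt_le_1_alt. replace (d * d * (2 * INR N * ln (ln (INR N)))) with (2 * (d * d * INR N) * ln (ln (INR N))) by ring.
      apply Rmult_le_compat_l; [|assumption]. assert (0 <= d * d * INR N) by (apply Rmult_le_pos; nra). lra.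
    - apply Rmult_le_pos; lra. }
  assert (HLN : ln (ln (INR N)) <= ln (INR p) + ln 2 + ln (INR i)).
  { rewrite HlnN. rewrite <- !ln_mult by nra. apply ln_le; [nra|].
    replace (INR p * 2 * INR i) with (INR p * (2 * INR i)) by ring.
    rewrite Rmult_assoc. apply Rmult_le_compat_l; [lra|]. nra. }
  assert (Hgrow : (1 - eps) * ((1 - eps) * ln (ln (INR N))) <= ln (INR i / 2)).
  { unfold Rdiv. rewrite ln_mult, ln_Rinv by lra.
    apply Rlt_div_l in HI1; [|lra].
    apply Rle_trans with ((1 - eps) * ln (ln (INR N))).
    - assert (0 <= (1 - eps) * ln (ln (INR N))) by (apply Rmult_le_pos; lra). nra.
    - apply Rle_trans with ((1 - eps) * (ln (INR p) + ln 2 + ln (INR i))); [apply Rmult_le_compat_l; lra|].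
      assert (0 <= ln (INR p)) by (rewrite <- ln_1; apply ln_le; lra). nra. }
  assert (Hv : (1 - eps) * ((1 - eps) * INR N) <= INR (block_len p i)).
  { assert (A : INR (block_start p i) + INR (block_len p i) = INR N) by (rewrite <- plus_INR, Evb; reflexivity).
    rewrite HNu in A. assert (d * d <= eps * eps) by (apply Rmult_le_compat; lra).
    assert (d * d * INR N <= eps * eps * INR N) by (apply Rmult_le_compat_r; lra). 
    assert (0 <= eps * (1 - eps) * INR N) by (apply Rmult_le_pos; [nra|lra]). nra. }
  assert (Hsq : (1 - eps) * (1 - eps) * lil_norm N <= sqrt (2 * INR (block_len p i) * ln (INR i / 2))).
  { unfold lil_norm. rewrite <- (sqrt_square ((1 - eps) * (1 - eps))) by nra.
    rewrite <- sqrt_mult; [|nra|apply Rmult_le_pos; lra]. apply sqrt_le_1_alt.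
    replace ((1 - eps) * (1 - eps) * ((1 - eps) * (1 - eps)) * (2 * INR N * ln (ln (INR N)))) with
      (2 * ((1 - eps) * ((1 - eps) * INR N)) * ((1 - eps) * ((1 - eps) * ln (ln (INR N))))) by ring.
    apply Rmult_le_compat; [|apply Rmult_le_pos; [lra|apply Rmult_le_pos; lra]| |assumption].
    - apply Rmult_le_pos; [lra|]. apply Rmult_le_pos; [lra|apply Rmult_le_pos; lra].
    - lra. }
  assert (HtN := lil_norm_nonneg N).
  assert (Hlow2 : (1 - 5 * eps) * sig * lil_norm N <= low_threshold p i sig eps (ln (INR i / 2))).
  { unfold low_threshold. apply Rle_trans with ((1 - 2 * eps) * (1 - eps) * sig * ((1 - eps) * (1 - eps) * lil_norm N)).
    - replace ((1 - 2 * eps) * (1 - eps) * sig * ((1 - eps) * (1 - eps) * lil_norm N)) with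
        ((1 - 2 * eps) * (1 - eps) ^ 3 * (sig * lil_norm N)) by ring.
      rewrite Rmult_assoc. apply Rmult_le_compat_r; [nra|].
      assert (A : 1 - 3 * eps <= (1 - eps) ^ 3) by (simpl; nra).
      assert ((1 - 2 * eps) * (1 - 3 * eps) <= (1 - 2 * eps) * (1 - eps) ^ 3) by (apply Rmult_le_compat_l; lra). nra.
    - apply Rmult_le_compat_l; [|assumption]. apply Rmult_le_pos; [|lra]. apply Rmult_le_pos; lra. }
  assert ((sig + 1) * lil_norm (block_start p i) <= delta / 4 * lil_norm N).
  { apply Rle_trans with ((sig + 1) * (d * lil_norm N)); [apply Rmult_le_compat_l; lra|].
    rewrite <- Rmult_assoc. apply Rmult_le_compat_r; assumption. }
  assert (5 * eps * sig * lil_norm N <= delta / 4 * lil_norm N) by (apply Rmult_le_compat_r; lra).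
  assert (0 <= delta * lil_norm N) by nra. lra.
Qed.

Lemma inv_S_small eps : 0 < eps -> exists r, / (INR r + 1) < eps.
Proof.
  intros He. destruct (nat_above (/ eps)) as [r Hr]. exists r. specialize (Hr r ltac:(lia)).
  rewrite <- (Rinv_inv eps). apply Rinv_lt_contravar.
  - apply Rmult_lt_0_compat; [now apply Rinv_0_lt_compat|]. assert (0 <= INR r) by apply pos_INR. lra.
  - lra.
Qed.

(** Taking 1 / (r + 1) for eps leaves countably many null sets. A vanishing variance is treated
    apart, since [step_lower] requires sig > 0; in that case [c] is 0 on all cells. *)
Lemma step_lil (n sigma : nat -> nat) m c B sig :
  (forall k, (0 < n k)%nat) -> large_gaps n -> (forall i j, sigma i = sigma j -> i = j) ->
  (forall s, (s < 2 ^ m)%nat -> Rabs (c s) <= B) -> sumN (2 ^ m) c = 0 -> 0 <= sig ->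
  sumN (2 ^ m) (fun s => c s ^ 2) = INR (2 ^ m) * sig ^ 2 ->
  ae01 (fun x =>
    (forall eps, 0 < eps -> exists N0, forall N, (N0 <= N)%nat -> cell_sum n sigma m c 0 N x <= (sig + eps) * lil_norm N) /\
    (forall eps, 0 < eps -> forall N0, exists N, (N0 <= N)%nat /\ (sig - eps) * lil_norm N <= cell_sum n sigma m c 0 N x)).
Proof.
  intros Hn Hgaps Hinj HB Hc0 Hsig Hvar.
  assert (Hpos : forall r, 0 < / (INR r + 1)) by (intros r; apply Rinv_0_lt_compat; assert (A := pos_INR r); lra).
  assert (H1 : ae01 (fun x => forall r, exists N0, forall N, (N0 <= N)%nat ->
     cell_sum n sigma m c 0 N x <= (sig + / (INR r + 1)) * lil_norm N)).
  { apply ae_forall. intros r. apply (step_upper n sigma m c B); auto. lra. }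
  assert (H2 : ae01 (fun x => forall r, forall N0, exists N, (N0 <= N)%nat /\
     (sig - / (INR r + 1)) * lil_norm N <= cell_sum n sigma m c 0 N x)).
  { apply ae_forall. intros r. destruct Hsig as [Hsig|Hsig].
    - apply (step_lower n sigma m c (Rmax B 1)); auto.
      + eapply Rlt_le_trans; [|apply Rmax_r]. lra.
      + intros s Hs. eapply Rle_trans; [now apply HB|apply Rmax_l].
    - subst sig. assert (Hz : forall s, (s < 2 ^ m)%nat -> c s = 0).
      { intros s Hs. assert (A := sumN_term_le (2 ^ m) (fun s => c s ^ 2) s ltac:(intros; apply pow2_ge_0) Hs).
        rewrite Hvar in A. simpl in A. assert (0 <= c s * c s) by nra. apply Rsqr_0_uniq. unfold Rsqr. lra. }
      apply null_sub with (fun _ => False).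
      + apply null_of_small. intros e He. apply small_empty; [tauto|lra].
      + intros x [Hx Hf]. apply Hf. intros N0. exists N0. split; [lia|]. unfold cell_sum. rewrite sumN_zero.
        * assert (A := lil_norm_nonneg N0). specialize (Hpos r). nra.
        * intros j _. apply Hz. apply cell_index_lt. }
  eapply ae_impl; [apply (ae_and _ _ H1 H2)|]. intros x Hx [A1 A2]. split.
  - intros eps He. destruct (inv_S_small eps He) as [r Hr]. destruct (A1 r) as [N0 HN0]. exists N0. intros N HN.
    eapply Rle_trans; [apply (HN0 N HN)|]. apply Rmult_le_compat_r; [apply lil_norm_nonneg|lra].
  - intros eps He N0. destruct (inv_S_small eps He) as [r Hr]. destruct (A2 r N0) as [N [HN HN2]]. exists N. split; [assumption|].
    eapply Rle_trans; [|apply HN2]. apply Rmult_le_compat_r; [apply lil_norm_nonneg|lra].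
Qed.

(** * Functions of bounded variation *)

(** Interior values suffice because a step function is unconstrained at the points of its
    subdivision; the gluing of step functions at a common endpoint relies on this. *)
Lemma IsStepFun_ext (f g : R -> R) a b : a <= b -> (forall x, a < x < b -> f x = g x) ->
  IsStepFun f a b -> IsStepFun g a b.
Proof.
  intros Hab Hfg [l [l0 [H1 [H2 [H3 [H4 H5]]]]]]. exists l, l0.
  repeat split; try assumption. intros i Hi x Hx. unfold open_interval in Hx.
  rewrite <- (H5 i Hi x Hx). symmetry. apply Hfg.
  rewrite Rmin_left in H2 by assumption. rewrite Rmax_right in H3 by assumption.
  assert (A : forall j, (j < length l)%nat -> a <= pos_Rl l j <= b).
  { intros j Hj. split.
    - rewrite <- H2. apply RList_P5; [assumption|]. apply RList_P3. exists j. auto.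
    - rewrite <- H3. apply RList_P7; [assumption|]. apply RList_P3. exists j. auto. }
  assert (Hl : (0 < length l)%nat) by lia.
  assert (A1 := A i ltac:(lia)). assert (A2 := A (S i) ltac:(lia)). lra.
Qed.

(** The condition in [Riemann_integrable] as a proposition with a fixed error, so that it can be
    glued along a partition. *)
Definition step_approximable (f : R -> R) (a b e : R) : Prop :=
  exists phi psi : StepFun a b, (forall t, a <= t <= b -> Rabs (f t - phi t) <= psi t) /\
    0 <= RiemannInt_SF psi <= e.

Lemma step_approximable_const f a b om : a <= b -> 0 <= om -> (forall y, a <= y <= b -> Rabs (f y - f a) <= om) ->
  step_approximable f a b (om * (b - a)).
Proof.
  intros Hab H0 H. exists (mkStepFun (StepFun_P4 a b (f a))), (mkStepFun (StepFun_P4 a b om)).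
  split; [intros t Ht; simpl; unfold fct_cte; now apply H|]. rewrite StepFun_P18. split; [nra|lra].
Qed.

Lemma step_approximable_glue f a b c e1 e2 : a <= b -> b <= c ->
  step_approximable f a b e1 -> step_approximable f b c e2 -> step_approximable f a c (e1 + e2).
Proof.
  intros Hab Hbc [p1 [q1 [A1 A2]]] [p2 [q2 [B1 B2]]].
  set (gl := fun (u v : R -> R) x => if Rle_dec x b then u x else v x).
  assert (Hl : forall u v x, a < x < b -> u x = gl u v x) by (intros u v x Hx; unfold gl; destruct (Rle_dec x b); [reflexivity|lra]).
  assert (Hr : forall u v x, b < x < c -> v x = gl u v x) by (intros u v x Hx; unfold gl; destruct (Rle_dec x b); [lra|reflexivity]).
  assert (P1 : IsStepFun (gl p1 p2) a b) by (apply (IsStepFun_ext p1); auto; apply pre).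
  assert (P2 : IsStepFun (gl p1 p2) b c) by (apply (IsStepFun_ext p2); auto; apply pre).
  assert (Q1 : IsStepFun (gl q1 q2) a b) by (apply (IsStepFun_ext q1); auto; apply pre).
  assert (Q2 : IsStepFun (gl q1 q2) b c) by (apply (IsStepFun_ext q2); auto; apply pre).
  exists (mkStepFun (StepFun_P46 P1 P2)), (mkStepFun (StepFun_P46 Q1 Q2)). split.
  - intros t Ht. simpl. unfold gl. destruct (Rle_dec t b); [apply A1|apply B1]; lra.
  - rewrite <- (StepFun_P43 Q1 Q2 (StepFun_P46 Q1 Q2)).
    assert (E1 : RiemannInt_SF (mkStepFun Q1) = RiemannInt_SF q1).
    { apply Rle_antisym; apply StepFun_P37; try assumption; intros x Hx; simpl; rewrite <- (Hl q1 q2 x Hx); lra. }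
    assert (E2 : RiemannInt_SF (mkStepFun Q2) = RiemannInt_SF q2).
    { apply Rle_antisym; apply StepFun_P37; try assumption; intros x Hx; simpl; rewrite <- (Hr q1 q2 x Hx); lra. }
    lra.
Qed.

Lemma bv_step_approximable f V K : var_le f V -> (0 < K)%nat -> step_approximable f 0 1 (2 * V / INR K).
Proof.
  intros HV HK. assert (HK' : 0 < INR K) by now apply lt_0_INR.
  destruct (osc_exists f V K HV HK) as [om [O1 [O2 O3]]].
  assert (H : forall k, (k <= K)%nat -> step_approximable f 0 (INR k / INR K) (sumN k (fun s => om s * / INR K))).
  { induction k as [|k IH]; intros Hk.
    - assert (A := step_approximable_const f 0 0 0 ltac:(lra) ltac:(lra)). replace (INR 0 / INR K) with 0 by (simpl; field; lra).
      simpl. replace 0 with (0 * (0 - 0)) at 3 by ring. apply A. intros y Hy. replace y with 0 by lra.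
      rewrite Rminus_diag, Rabs_R0. lra.
    - cbn [sumN]. assert (A : INR k / INR K <= INR (S k) / INR K).
      { apply Rmult_le_compat_r; [left; now apply Rinv_0_lt_compat|]. rewrite S_INR. lra. }
      apply step_approximable_glue with (INR k / INR K); [|assumption|apply IH; lia|].
      + apply Rdiv_le_0_compat; [apply pos_INR|assumption].
      + replace (om k * / INR K) with (om k * (INR (S k) / INR K - INR k / INR K)) by (rewrite S_INR; field; lra).
        apply step_approximable_const; [assumption|apply O1|]. intros y Hy. apply O2; [lia|assumption]. }
  specialize (H K (le_n K)). replace (INR K / INR K) with 1 in H by (field; lra).
  destruct H as [p [q [A1 [A2 A3]]]]. exists p, q. split; [assumption|]. split; [assumption|].
  rewrite sumN_scal_r in A3. eapply Rle_trans; [apply A3|]. apply Rmult_le_compat_r; [left; now apply Rinv_0_lt_compat|assumption].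
Qed.

Lemma bv_integrable f V : var_le f V -> Riemann_integrable f 0 1.
Proof.
  intros HV eps.
  (* [Riemann_integrable] asks for data, so the pair of step functions is first shown to exist and
     then chosen. *)
  assert (H : exists pq : StepFun 0 1 * StepFun 0 1,
    (forall t, Rmin 0 1 <= t <= Rmax 0 1 -> Rabs (f t - fst pq t) <= snd pq t) /\
    Rabs (RiemannInt_SF (snd pq)) < eps).
  { destruct (nat_above (2 * V / eps)) as [K HK]. specialize (HK (S K) ltac:(lia)).
    assert (He := cond_pos eps).
    destruct (bv_step_approximable f V (S K) HV ltac:(lia)) as [p [q [A1 [A2 A3]]]]. exists (p, q). simpl fst. simpl snd. split.
    - rewrite Rmin_left, Rmax_right by lra. exact A1.
    - rewrite Rabs_pos_eq by assumption. eapply Rle_lt_trans; [apply A3|].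
      apply Rlt_div_l in HK; [|assumption]. apply Rlt_div_l; [apply lt_0_INR; lia|lra]. }
  apply constructive_indefinite_description in H. destruct H as [[p q] H]. exists p, q. exact H.
Qed.

(** The value picked by [epsilon] is the integral as soon as one proof of integrability exists. *)
Lemma RInt01_eq f V : var_le f V -> ex_RInt f 0 1 /\ RInt01 f = RInt f 0 1.
Proof.
  intros HV. assert (pr := bv_integrable f V HV).
  split; [now apply ex_RInt_Reals_1|].
  assert (E : exists v, exists pr : Riemann_integrable f 0 1, RiemannInt pr = v) by (exists (RiemannInt pr), pr; reflexivity).
  assert (S := epsilon_spec (inhabits 0) _ E). destruct S as [pr' Hpr'].
  unfold RInt01. rewrite <- Hpr'. symmetry. apply RInt_Reals.
Qed.

(** The error of a left Riemann sum is at most the average of the oscillations over the cells. *)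
Lemma mean_grid_RInt f V h : var_le f V -> ex_RInt f 0 1 ->
  Rabs (RInt f 0 1 - mean (2 ^ h) (grid f h)) <= 2 * V * / INR (2 ^ h).
Proof.
  intros HV Hex. set (K := (2 ^ h)%nat). assert (HK : (0 < K)%nat) by apply pow2_nat_pos.
  assert (HK' : 0 < INR K) by now apply lt_0_INR. assert (HiK : 0 < / INR K) by now apply Rinv_0_lt_compat.
  destruct (osc_exists f V K HV HK) as [om [O1 [O2 O3]]].
  assert (Hin : forall k, (k <= K)%nat -> 0 <= INR k / INR K <= 1).
  { intros k Hk. split; [apply Rdiv_le_0_compat; [apply pos_INR|assumption]|].
    apply (proj2 (Rle_div_l (INR k) 1 (INR K) HK')). rewrite Rmult_1_l. now apply le_INR. }
  assert (Hsub : forall u v, 0 <= u -> u <= v -> v <= 1 -> ex_RInt f u v).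
  { intros u v H0 H1 H2. apply (ex_RInt_Chasles_1 f u v 1); [lra|]. apply (ex_RInt_Chasles_2 f 0 u 1); [lra|assumption]. }
  assert (H : forall k, (k <= K)%nat ->
    Rabs (RInt f 0 (INR k / INR K) - sumN k (fun s => f (INR s / INR K) * / INR K)) <= sumN k (fun s => om s * / INR K)).
  { induction k as [|k IH]; intros Hk.
    - replace (INR 0 / INR K) with 0 by (simpl; field; lra). rewrite RInt_point. simpl.
      unfold zero; simpl. rewrite Rminus_diag, Rabs_R0. lra.
    - cbn [sumN]. specialize (IH ltac:(lia)).
      assert (B1 := Hin k ltac:(lia)). assert (B2 := Hin (S k) Hk).
      assert (A : INR k / INR K <= INR (S k) / INR K).
      { apply Rmult_le_compat_r; [lra|]. rewrite S_INR. lra. }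
      set (u := INR k / INR K) in *. set (v := INR (S k) / INR K) in *.
      assert (Huv : v - u = / INR K) by (unfold u, v; rewrite S_INR; field; lra).
      assert (X1 : ex_RInt f 0 u) by (apply Hsub; lra). assert (X2 : ex_RInt f u v) by (apply Hsub; lra).
      rewrite <- (RInt_Chasles f 0 u v X1 X2). unfold plus; simpl.
      assert (C : Rabs (RInt f u v - f u * / INR K) <= om k * / INR K).
      { assert (E : RInt f u v - f u * / INR K = RInt (fun t => f t - f u) u v).
        { assert (EE := RInt_minus f (fun _ => f u) u v X2 (ex_RInt_const u v (f u))).
          unfold minus, plus, opp in EE; simpl in EE. unfold Rminus. rewrite EE.
          rewrite RInt_const. unfold scal; simpl; unfold mult; simpl. rewrite Huv. ring. }
        rewrite E. eapply Rle_trans; [apply (abs_RInt_le_const (fun t => f t - f u) u v (om k))|].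
        - assumption.
        - apply (ex_RInt_minus f (fun _ => f u)); [assumption|apply ex_RInt_const].
        - intros t Ht. apply O2; [lia|assumption].
        - rewrite Huv. lra. }
      replace (RInt f 0 u + RInt f u v - (sumN k (fun s => f (INR s / INR K) * / INR K) + f u * / INR K)) with
        ((RInt f 0 u - sumN k (fun s => f (INR s / INR K) * / INR K)) + (RInt f u v - f u * / INR K)) by ring.
      eapply Rle_trans; [apply Rabs_triang|]. lra. }
  specialize (H K (le_n K)). replace (INR K / INR K) with 1 in H by (field; lra).
  rewrite !sumN_scal_r in H. unfold mean, grid. fold K. unfold Rdiv at 1.
  eapply Rle_trans; [apply H|]. apply Rmult_le_compat_r; lra.
Qed.

Lemma var_le_bound f V y : var_le f V -> 0 <= y <= 1 -> Rabs (f y) <= Rabs (f 0) + V.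
Proof.
  intros HV Hy. assert (H := HV 1%nat (fun i => match i with O => 0 | _ => y end)).
  simpl in H. rewrite Rplus_0_l in H. specialize (H ltac:(lra) ltac:(lra) ltac:(intros [|i]; [lra|lia])).
  replace (f y) with ((f y - f 0) + f 0) by ring. eapply Rle_trans; [apply Rabs_triang|]. lra.
Qed.

Lemma partition_range (m : nat) (t : nat -> R) : 0 <= t O -> t m <= 1 ->
  (forall i, (i < m)%nat -> t i <= t (S i)) -> forall i, (i <= m)%nat -> 0 <= t i <= 1.
Proof.
  intros H0 H1 Hm.
  assert (Hup : forall d i, (i + d <= m)%nat -> t i <= t (i + d)%nat).
  { induction d as [|d IH]; intros i Hi; [rewrite Nat.add_0_r; lra|].
    rewrite Nat.add_succ_r. specialize (IH i ltac:(lia)). specialize (Hm (i + d)%nat ltac:(lia)). lra. }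
  intros i Hi. assert (A := Hup i O ltac:(lia)). assert (B := Hup (m - i)%nat i ltac:(lia)).
  replace (i + (m - i))%nat with m in B by lia. simpl in A. lra.
Qed.

Lemma var_le_sqr f V : var_le f V -> var_le (fun x => f x * f x) (2 * (Rabs (f 0) + V) * V).
Proof.
  intros HV m t H0 H1 Hm. assert (HR := partition_range m t H0 H1 Hm).
  assert (HV0 := var_le_nonneg f V HV). set (M := Rabs (f 0) + V).
  assert (HM : 0 <= M) by (unfold M; assert (A := Rabs_pos (f 0)); lra).
  apply Rle_trans with (sumN m (fun i => 2 * M * Rabs (f (t (S i)) - f (t i)))).
  - apply sumN_le. intros i Hi.
    assert (A := var_le_bound f V (t i) HV (HR i ltac:(lia))). assert (B := var_le_bound f V (t (S i)) HV (HR (S i) ltac:(lia))).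
    fold M in A, B.
    replace (f (t (S i)) * f (t (S i)) - f (t i) * f (t i)) with ((f (t (S i)) + f (t i)) * (f (t (S i)) - f (t i))) by ring.
    rewrite Rabs_mult. apply Rmult_le_compat_r; [apply Rabs_pos|]. eapply Rle_trans; [apply Rabs_triang|]. lra.
  - rewrite sumN_scal. apply Rmult_le_compat_l; [lra|]. now apply HV.
Qed.

Lemma var_le_plus f g V V' : var_le f V -> var_le g V' -> var_le (fun x => f x + g x) (V + V').
Proof.
  intros HV HV' m t H0 H1 Hm. eapply Rle_trans; [|apply Rplus_le_compat; [apply (HV m t H0 H1 Hm)|apply (HV' m t H0 H1 Hm)]].
  rewrite <- sumN_plus. apply sumN_le. intros i _.
  replace (f (t (S i)) + g (t (S i)) - (f (t i) + g (t i))) with ((f (t (S i)) - f (t i)) + (g (t (S i)) - g (t i))) by ring.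
  apply Rabs_triang.
Qed.

Lemma var_le_opp f V : var_le f V -> var_le (fun x => - f x) V.
Proof.
  intros HV m t H0 H1 Hm. eapply Rle_trans; [|apply (HV m t H0 H1 Hm)].
  apply sumN_le. intros i _. right. rewrite <- Rabs_Ropp. f_equal. ring.
Qed.

Lemma var_le_ext f g V : (forall x, 0 <= x <= 1 -> f x = g x) -> var_le f V -> var_le g V.
Proof.
  intros Hfg HV m t H0 H1 Hm. assert (HR := partition_range m t H0 H1 Hm).
  eapply Rle_trans; [|apply (HV m t H0 H1 Hm)]. apply sumN_le. intros i Hi. right.
  now rewrite !Hfg by (apply HR; lia).
Qed.

Definition unit_step (a y : R) : R := if Rle_dec a y then 1 else 0.

Lemma var_le_unit_step a : var_le (unit_step a) 1.
Proof.
  intros m t H0 H1 Hm.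
  assert (E : sumN m (fun i => Rabs (unit_step a (t (S i)) - unit_step a (t i))) = unit_step a (t m) - unit_step a (t O)).
  { clear H0 H1. induction m as [|m IH]; [simpl; ring|]. cbn [sumN]. rewrite IH by (intros; apply Hm; lia).
    specialize (Hm m ltac:(lia)). rewrite Rabs_pos_eq; [ring|].
    unfold unit_step. destruct (Rle_dec a (t (S m))), (Rle_dec a (t m)); lra. }
  rewrite E. unfold unit_step. destruct (Rle_dec a (t m)), (Rle_dec a (t O)); lra.
Qed.

Lemma lil_norm_pos N : (8 <= N)%nat -> 0 < lil_norm N.
Proof.
  intros HN. eapply Rlt_le_trans; [|apply (lil_scale_le 3 N); simpl; lia].
  apply sqrt_lt_R0. assert (A := ln_ge_1 3 (le_n 3)). assert (0 < 2 ^ 3) by (apply pow_lt; lra). nra.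
Qed.

Lemma limsup_of_bounds (S : nat -> R) L :
  (forall eps, 0 < eps -> exists N0, forall N, (N0 <= N)%nat -> S N <= (L + eps) * lil_norm N) ->
  (forall eps, 0 < eps -> forall N0, exists N, (N0 <= N)%nat /\ (L - eps) * lil_norm N <= S N) ->
  limsup_eq (fun N => S N / lil_norm N) L.
Proof.
  intros H1 H2. split.
  - intros eps He. destruct (H1 (eps / 2) ltac:(lra)) as [N0 HN0]. exists (N0 + 8)%nat. intros N HN.
    specialize (HN0 N ltac:(lia)). assert (A := lil_norm_pos N ltac:(lia)).
    apply Rle_lt_trans with (L + eps / 2); [|lra]. apply (proj2 (Rle_div_l _ _ _ A)). assumption.
  - intros eps He N0. destruct (H2 (eps / 2) ltac:(lra) (N0 + 8)%nat) as [N [HN HS]]. exists N. split; [lia|].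
    assert (A := lil_norm_pos N ltac:(lia)). apply Rlt_gt. apply Rlt_le_trans with (L - eps / 2); [lra|].
    apply (proj1 (Rle_div_r _ _ _ A)). assumption.
Qed.

Lemma large_gaps_of_cv (n : nat -> nat) : (forall k, (0 < n k)%nat) ->
  cv_infty (fun k => INR (n (S k)) / INR (n k)) -> large_gaps n.
Proof.
  intros Hn Hc q. destruct (Hc q) as [K0 HK0]. exists K0. intros k Hk. specialize (HK0 k Hk).
  assert (A : 0 < INR (n k)) by (apply lt_0_INR, Hn). left. apply (proj2 (Rlt_div_r _ _ _ A)). assumption.
Qed.

Lemma mean_ext K c c' : (forall s, (s < K)%nat -> c s = c' s) -> mean K c = mean K c'.
Proof. intros H. unfold mean. now rewrite (sumN_ext K c c'). Qed.

Lemma mean_abs K c B : (0 < K)%nat -> (forall s, (s < K)%nat -> Rabs (c s) <= B) -> Rabs (mean K c) <= B.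
Proof.
  intros HK H. assert (A : 0 < INR K) by now apply lt_0_INR. unfold mean, Rdiv.
  rewrite Rabs_mult, (Rabs_pos_eq (/ INR K)) by (left; now apply Rinv_0_lt_compat).
  apply (proj2 (Rle_div_l _ _ _ A)). rewrite Rmult_comm. now apply sumN_abs_le.
Qed.

Lemma centered_sum K c : (0 < K)%nat -> sumN K (centered K c) = 0.
Proof.
  intros HK. unfold centered. rewrite (sumN_minus K c), sumN_const. unfold mean. field. apply not_0_INR. lia.
Qed.

Lemma centered_sqr K c : (0 < K)%nat ->
  sumN K (fun s => centered K c s ^ 2) = INR K * (mean K (fun s => c s * c s) - mean K c ^ 2).
Proof.
  intros HK. unfold centered. set (mu := mean K c).
  rewrite (sumN_ext K _ (fun s => c s * c s - 2 * mu * c s + mu ^ 2)) by (intros; ring).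
  rewrite sumN_plus, sumN_minus, sumN_scal, sumN_const. unfold mu, mean. field. apply not_0_INR. lia.
Qed.

Lemma centered_abs K c B s : (0 < K)%nat -> (forall s, (s < K)%nat -> Rabs (c s) <= B) -> (s < K)%nat ->
  Rabs (centered K c s) <= 2 * B.
Proof.
  intros HK H Hs. unfold centered. assert (A := mean_abs K c B HK H). specialize (H s Hs).
  apply Rabs_le_between in A, H. apply Rabs_le. lra.
Qed.

Lemma cell_sum_ext n sigma h c c' u v x : (forall s, (s < 2 ^ h)%nat -> c s = c' s) ->
  cell_sum n sigma h c u v x = cell_sum n sigma h c' u v x.
Proof. intros H. apply sumN_ext. intros j _. apply H, cell_index_lt. Qed.

Lemma grid_point_range h s : (s < 2 ^ h)%nat -> 0 <= INR s / INR (2 ^ h) < 1.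
Proof.
  intros Hs. assert (A : 0 < INR (2 ^ h)) by apply lt_0_INR, pow2_nat_pos. split.
  - apply Rdiv_le_0_compat; [apply pos_INR|assumption].
  - apply (proj2 (Rlt_div_l _ _ _ A)). rewrite Rmult_1_l. now apply lt_INR.
Qed.

Lemma sqrt_le_shift x y e : 0 <= e -> x <= y + e ^ 2 -> sqrt x <= sqrt y + e.
Proof.
  intros He H. assert (A := sqrt_pos y).
  rewrite <- (sqrt_square (sqrt y + e)) by lra. apply sqrt_le_1_alt.
  destruct (Rle_dec 0 y) as [Hy|Hy].
  - assert (B := sqrt_sqrt y Hy). nra.
  - nra.
Qed.

Lemma inv_pow2_small C eps : 0 <= C -> 0 < eps -> exists m0, forall m, (m0 <= m)%nat -> C * / INR (2 ^ m) <= eps.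
Proof.
  intros HC He. destruct (nat_above (C / eps)) as [m0 H]. exists m0. intros m Hm. specialize (H m Hm).
  assert (A : (m < 2 ^ m)%nat) by (apply Nat.pow_gt_lin_r; lia). apply lt_INR in A.
  assert (B : 0 < INR (2 ^ m)) by apply lt_0_INR, pow2_nat_pos.
  apply (proj2 (Rle_div_l _ _ _ B)). apply (proj1 (Rlt_div_l _ _ _ He)) in H. nra.
Qed.

Lemma exp_level_small c V eps : 0 <= c -> 0 <= V -> 0 < eps ->
  exists m0, forall m, (m0 <= m)%nat -> V * (c * exp (- (INR m / 8))) <= eps.
Proof.
  intros Hc HV He. destruct (exp_neg_small (eps / (V * c + 1))) as [m0 H].
  { apply Rdiv_lt_0_compat; [assumption|nra]. }
  exists m0. intros m Hm. specialize (H m Hm). assert (B : 0 < V * c + 1) by nra.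
  apply (proj2 (Rle_div_r _ _ _ B)) in H. assert (0 < exp (- (INR m / 8))) by apply exp_pos. nra.
Qed.

(** One null set serves all levels m. Off it the step function of level m differs from [f] by a
    small multiple of [lil_norm N], and its standard deviation tends to [L2norm f]. *)
Lemma lil_bv (n sigma : nat -> nat) (f : R -> R) V :
  (forall k, (0 < n k)%nat) -> large_gaps n -> (forall i j, sigma i = sigma j -> i = j) ->
  (forall x, f (x + 1) = f x) -> RInt01 f = 0 -> var_le f V ->
  ae01 (fun x => limsup_eq (fun N => sumN N (fun k => f (INR (n (sigma k)) * x)) / lil_norm N) (L2norm f)).
Proof.
  intros Hn Hgaps Hinj Hf HI HV.
  assert (HV0 := var_le_nonneg f V HV).
  set (M := Rabs (f 0) + V). assert (HM : 0 <= M) by (unfold M; assert (A := Rabs_pos (f 0)); lra).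
  set (c := fun m => centered (2 ^ m) (grid f m)).
  assert (Hgb : forall m s, (s < 2 ^ m)%nat -> Rabs (grid f m s) <= M).
  { intros m s Hs. apply var_le_bound; [assumption|]. assert (A := grid_point_range m s Hs). lra. }
  set (s2 := fun m => mean (2 ^ m) (fun s => grid f m s * grid f m s) - mean (2 ^ m) (grid f m) ^ 2).
  assert (Hs2 : forall m, 0 <= s2 m).
  { intros m. assert (A := centered_sqr (2 ^ m) (grid f m) (pow2_nat_pos m)). fold (s2 m) in A.
    assert (B : 0 <= sumN (2 ^ m) (fun s => centered (2 ^ m) (grid f m) s ^ 2)) by (apply sumN_nonneg; intros; apply pow2_ge_0).
    rewrite A in B. assert (0 < INR (2 ^ m)) by apply lt_0_INR, pow2_nat_pos.
    apply Rmult_le_reg_l with (INR (2 ^ m)); lra. }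
  destruct (RInt01_eq f V HV) as [Hex E1].
  assert (Hmean : forall h, Rabs (0 - mean (2 ^ h) (grid f h)) <= 2 * V * / INR (2 ^ h)).
  { intros h. rewrite <- HI, E1. now apply mean_grid_RInt. }
  set (V2 := 2 * M * V). assert (HV2 : var_le (fun x => f x * f x) V2) by now apply var_le_sqr.
  assert (HV20 := var_le_nonneg _ _ HV2).
  destruct (RInt01_eq _ V2 HV2) as [Hex2 E2].
  set (I2 := RInt01 (fun x => f x * f x)) in *.
  assert (Hmean2 : forall h, Rabs (I2 - mean (2 ^ h) (fun s => grid f h s * grid f h s)) <= 2 * V2 * / INR (2 ^ h)).
  { intros h. rewrite E2. now apply (mean_grid_RInt (fun x => f x * f x) V2). }
  assert (Hsig : forall eps, 0 < eps -> exists m0, forall m, (m0 <= m)%nat ->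
     L2norm f <= sqrt (s2 m) + eps /\ sqrt (s2 m) <= L2norm f + eps).
  { intros eps He. assert (He2 : 0 < eps ^ 2) by (apply pow_lt; assumption).
    (* The variance of the grid values differs from the integral of f^2 by a Riemann sum error and
       by the square of a mean that is nearly 0. *)
    destruct (inv_pow2_small (2 * V2 + 2 * V * M) (eps ^ 2)) as [m0 Hm0]; [nra|assumption|].
    exists m0. intros m Hm. specialize (Hm0 m Hm).
    assert (A1 := Hmean2 m). assert (A2 := Hmean m). assert (A3 := mean_abs (2 ^ m) (grid f m) M (pow2_nat_pos m) (Hgb m)).
    assert (A4 : mean (2 ^ m) (grid f m) ^ 2 <= 2 * V * M * / INR (2 ^ m)).
    { rewrite <- pow2_abs. replace (Rabs (0 - mean (2 ^ m) (grid f m))) with (Rabs (mean (2 ^ m) (grid f m))) in A2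
        by (rewrite <- Rabs_Ropp; f_equal; ring).
      assert (0 <= Rabs (mean (2 ^ m) (grid f m))) by apply Rabs_pos.
      replace (2 * V * M * / INR (2 ^ m)) with ((2 * V * / INR (2 ^ m)) * M) by ring.
      simpl. rewrite Rmult_1_r. apply Rmult_le_compat; assumption. }
    assert (A5 : 0 <= mean (2 ^ m) (grid f m) ^ 2) by apply pow2_ge_0.
    apply Rabs_le_between in A1. unfold L2norm. fold I2.
    split; apply sqrt_le_shift; try lra; unfold s2; lra. }
  assert (Hlil : ae01 (fun x => forall m,
    (forall eps, 0 < eps -> exists N0, forall N, (N0 <= N)%nat -> cell_sum n sigma m (c m) 0 N x <= (sqrt (s2 m) + eps) * lil_norm N) /\
    (forall eps, 0 < eps -> forall N0, exists N, (N0 <= N)%nat /\ (sqrt (s2 m) - eps) * lil_norm N <= cell_sum n sigma m (c m) 0 N x))).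
  { apply ae_forall. intros m. apply (step_lil n sigma m (c m) (2 * M)); auto.
    - intros s Hs. apply centered_abs; auto. apply pow2_nat_pos.
    - apply centered_sum, pow2_nat_pos.
    - apply sqrt_pos.
    - rewrite pow2_sqrt by apply Hs2. apply centered_sqr, pow2_nat_pos. }
  destruct (Hgaps 32) as [K0 HK0].
  eapply ae_impl; [apply (ae_and _ _ Hlil (dyadic_bounded_ae n sigma K0 Hn Hinj HK0))|].
  intros x Hx [HL [J HG]].
  assert (Happ : forall eps, 0 < eps -> exists m0, forall m, (m0 <= m)%nat -> exists N0, forall N, (N0 <= N)%nat ->
     Rabs (sumN N (fun k => f (INR (n (sigma k)) * x)) - cell_sum n sigma m (c m) 0 N x) <= eps * lil_norm N).
  { intros eps He. destruct (exp_level_small 1080 V (eps / 2) ltac:(lra) HV0 ltac:(lra)) as [m0 Hm0].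
    exists m0. intros m Hm. specialize (Hm0 m Hm). set (eta := eps / (2 * (V + 1))).
    assert (Heta : 0 < eta) by (unfold eta; apply Rdiv_lt_0_compat; lra).
    assert (HVe : V * eta <= eps / 2).
    { assert (A : eta * (2 * (V + 1)) = eps) by (unfold eta; field; lra). nra. }
    destruct (dyadic_approx K0 m eta Heta) as [j0 Hj0].
    destruct (log2_large (j0 + J + 3)) as [N0 HN0]. exists (N0 + 1)%nat. intros N HN. specialize (HN0 N ltac:(lia)).
    set (j := Nat.log2 N) in *. assert (Hb := log2_bounds N ltac:(lia)). fold j in Hb.
    assert (A := Hj0 n sigma f V x j N 0 ltac:(lia) Hx Hf HV (HG j ltac:(lia)) Hb Hmean).
    replace (sumN N (fun k => f (INR (n (sigma k)) * x)) - cell_sum n sigma m (c m) 0 N x) with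
      (sumN N (fun k => f (INR (n (sigma k)) * x)) - INR N * 0 - cell_sum n sigma m (c m) 0 N x) by ring.
    eapply Rle_trans; [apply A|].
    assert (HW := lil_scale_le j N ltac:(lia) (proj1 Hb)). assert (HW0 := lil_scale_nonneg j).
    apply Rle_trans with (eps * lil_scale j); [|apply Rmult_le_compat_l; lra].
    rewrite <- Rmult_assoc. apply Rmult_le_compat_r; [assumption|]. lra. }
  apply limsup_of_bounds.
  - intros eps He. destruct (Happ (eps / 3) ltac:(lra)) as [m1 Hm1]. destruct (Hsig (eps / 3) ltac:(lra)) as [m2 Hm2].
    set (m := (m1 + m2)%nat). destruct (Hm1 m ltac:(lia)) as [N1 HN1]. destruct (Hm2 m ltac:(lia)) as [_ S1].
    destruct (proj1 (HL m) (eps / 3) ltac:(lra)) as [N2 HN2].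
    exists (N1 + N2)%nat. intros N HN. specialize (HN1 N ltac:(lia)). specialize (HN2 N ltac:(lia)).
    apply Rabs_le_between in HN1. assert (T := lil_norm_nonneg N).
    assert (sqrt (s2 m) * lil_norm N <= (L2norm f + eps / 3) * lil_norm N) by (apply Rmult_le_compat_r; lra). lra.
  - intros eps He N0. destruct (Happ (eps / 3) ltac:(lra)) as [m1 Hm1]. destruct (Hsig (eps / 3) ltac:(lra)) as [m2 Hm2].
    set (m := (m1 + m2)%nat). destruct (Hm1 m ltac:(lia)) as [N1 HN1]. destruct (Hm2 m ltac:(lia)) as [S1 _].
    destruct (proj2 (HL m) (eps / 3) ltac:(lra) (N0 + N1)%nat) as [N [HN HN2]].
    exists N. split; [lia|]. specialize (HN1 N ltac:(lia)).
    apply Rabs_le_between in HN1. assert (T := lil_norm_nonneg N).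
    assert (L2norm f * lil_norm N <= (sqrt (s2 m) + eps / 3) * lil_norm N) by (apply Rmult_le_compat_r; lra). lra.
Qed.

(** * Discrepancy *)

Lemma frac_part_succ y : frac_part (y + 1) = frac_part y.
Proof.
  destruct (base_fp (y + 1)) as [A1 A2]. destruct (base_fp y) as [B1 B2].
  assert (E : frac_part (y + 1) - frac_part y = IZR (1 + Int_part y - Int_part (y + 1))).
  { unfold frac_part. rewrite minus_IZR, plus_IZR. ring. }
  set (z := (1 + Int_part y - Int_part (y + 1))%Z) in *.
  assert (z = 0%Z).
  { assert (H1 : IZR z < IZR 1) by lra. assert (H2 : IZR (-1) < IZR z) by lra.
    apply lt_IZR in H1, H2. lia. }
  rewrite H in E. lra.
Qed.

Lemma frac_part_id y : 0 <= y < 1 -> frac_part y = y.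
Proof.
  intros Hy. assert (A := frac_part_nat_floor y ltac:(lra)). rewrite (nat_floor_unique y 0) in A by (simpl; lra). simpl in A. lra.
Qed.

Definition arc (a b y : R) : R := Defs.ind a b (frac_part y).

Lemma arc_var a b : 0 <= a -> a < b -> b < 1 -> var_le (arc a b) 3.
Proof.
  intros Ha Hab Hb.
  (* At y = 1 the fractional part returns to 0, which lies in the arc exactly when a = 0; this jump
     is the third unit of variation. *)
  set (g := fun y => if Rle_dec a 0 then unit_step 1 y else 0).
  assert (Hg : var_le g 1).
  { unfold g. destruct (Rle_dec a 0); [apply var_le_unit_step|].
    intros m t _ _ _. rewrite sumN_zero; [lra|]. intros. rewrite Rminus_diag. apply Rabs_R0. }
  replace 3 with (1 + 1 + 1) by ring.
  apply (var_le_ext (fun y => unit_step a y + - unit_step b y + g y)).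
  - intros y Hy. unfold arc, Defs.ind, unit_step, g, unit_step. destruct (Req_dec y 1) as [->|Hn].
    + replace (frac_part 1) with 0.
      2:{ replace 1 with (0 + 1) by ring. rewrite frac_part_succ. symmetry. apply frac_part_id. lra. }
      destruct (Rle_dec a 1), (Rle_dec b 1), (Rle_dec a 0), (Rle_dec 1 1), (Rlt_dec 0 b); lra.
    + rewrite frac_part_id by lra.
      destruct (Rle_dec a y), (Rle_dec b y), (Rle_dec a 0), (Rle_dec 1 y), (Rlt_dec y b); lra.
  - apply (var_le_plus _ g); [|assumption]. apply (var_le_plus (unit_step a)); [apply var_le_unit_step|].
    apply var_le_opp, var_le_unit_step.
Qed.

Lemma arc_RInt a b : 0 <= a -> a < b -> b < 1 -> RInt (arc a b) 0 1 = b - a.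
Proof.
  intros Ha Hab Hb. apply is_RInt_unique.
  assert (Hc : forall u v k, 0 <= u -> u <= v -> v <= 1 -> (forall y, u < y < v -> arc a b y = k) ->
     is_RInt (arc a b) u v ((v - u) * k)).
  { intros u v k Hu Huv Hv Hk. apply (is_RInt_ext (fun _ => k)).
    - intros y Hy. rewrite Rmin_left, Rmax_right in Hy by assumption. symmetry. now apply Hk.
    - exact (is_RInt_const u v k). }
  assert (A1 := Hc 0 a 0 ltac:(lra) ltac:(lra) ltac:(lra)). assert (A2 := Hc a b 1 ltac:(lra) ltac:(lra) ltac:(lra)).
  assert (A3 := Hc b 1 0 ltac:(lra) ltac:(lra) ltac:(lra)).
  assert (A : is_RInt (arc a b) 0 1 (plus (plus ((a - 0) * 0) ((b - a) * 1)) ((1 - b) * 0))).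
  { apply (is_RInt_Chasles (arc a b) 0 b 1); [apply (is_RInt_Chasles (arc a b) 0 a b)|];
      [apply A1|apply A2|apply A3];
      intros y Hy; unfold arc, Defs.ind; rewrite frac_part_id by lra;
      destruct (Rle_dec a y), (Rlt_dec y b); lra. }
  refine (eq_ind _ (is_RInt (arc a b) 0 1) A _ _). unfold plus; simpl; ring.
Qed.

Definition index_ind (i1 i2 s : nat) : R := if andb (Nat.leb i1 s) (Nat.ltb s i2) then 1 else 0.

Lemma threshold_index (a : R) h : exists i, (i <= 2 ^ h)%nat /\
  forall s, (s < 2 ^ h)%nat -> (a <= INR s / INR (2 ^ h) <-> (i <= s)%nat).
Proof.
  assert (HA : 0 < INR (2 ^ h)) by apply lt_0_INR, pow2_nat_pos.
  assert (H : forall K, exists i, (i <= K)%nat /\ forall s, (s < K)%nat -> (a <= INR s / INR (2 ^ h) <-> (i <= s)%nat)).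
  { induction K as [|K [i [Hi H]]]; [exists O; split; [lia|intros; lia]|].
    destruct (Nat.eq_dec i K) as [->|Hn].
    - destruct (Rle_dec a (INR K / INR (2 ^ h))) as [Hk|Hk].
      + exists K. split; [lia|]. intros s Hs. destruct (Nat.eq_dec s K) as [->|]; [tauto|]. apply H. lia.
      + exists (S K). split; [lia|]. intros s Hs. split; [|lia]. intros Hl.
        destruct (Nat.eq_dec s K) as [->|]; [contradiction|]. apply H in Hl; lia.
    - exists i. split; [lia|]. intros s Hs. destruct (Nat.eq_dec s K) as [->|]; [|apply H; lia].
      split; [lia|]. intros _. assert (A : a <= INR i / INR (2 ^ h)) by (apply H; lia).
      eapply Rle_trans; [apply A|]. apply Rmult_le_compat_r; [left; now apply Rinv_0_lt_compat|]. apply le_INR. lia. }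
  apply H.
Qed.

(** At a given level only finitely many step functions arise from arcs, so a single null set and a
    single N0 serve them all. *)
Lemma arc_grid a b h : 0 <= a -> a < b -> b < 1 -> exists i1 i2, (i1 <= 2 ^ h)%nat /\ (i2 <= 2 ^ h)%nat /\
  forall s, (s < 2 ^ h)%nat -> grid (arc a b) h s = index_ind i1 i2 s.
Proof.
  intros Ha Hab Hb. destruct (threshold_index a h) as [i1 [H1 T1]]. destruct (threshold_index b h) as [i2 [H2 T2]].
  exists i1, i2. split; [assumption|]. split; [assumption|]. intros s Hs.
  unfold grid, arc, Defs.ind, index_ind. rewrite frac_part_id by now apply grid_point_range.
  specialize (T1 s Hs). specialize (T2 s Hs).
  destruct (Rle_dec a (INR s / INR (2 ^ h))) as [P|P], (Rlt_dec (INR s / INR (2 ^ h)) b) as [P'|P'],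
    (Nat.leb_spec i1 s) as [Q|Q], (Nat.ltb_spec s i2) as [Q'|Q']; simpl; try reflexivity; exfalso.
  all: first [assert (b <= INR s / INR (2 ^ h)) by (apply T2; lia); lra
     | assert (i2 <= s)%nat by (apply T2; lra); lia
     | assert (i1 <= s)%nat by (apply T1; lra); lia
     | assert (a <= INR s / INR (2 ^ h)) by (apply T1; lia); lra].
Qed.

Lemma index_ind_abs i1 i2 s : Rabs (index_ind i1 i2 s) <= 1.
Proof. unfold index_ind. destruct (andb _ _); apply Rabs_le; lra. Qed.

(** The variance of an indicator is mu (1 - mu) <= 1/4; this is the origin of the constant 1/2 in
    the limit. *)
Lemma index_ind_centered_sqr K i1 i2 : (0 < K)%nat ->
  sumN K (fun s => centered K (index_ind i1 i2) s ^ 2) <= INR K * (1 / 2) ^ 2.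
Proof.
  intros HK. rewrite centered_sqr by assumption.
  rewrite (mean_ext K (fun s => index_ind i1 i2 s * index_ind i1 i2 s) (index_ind i1 i2)).
  - set (mu := mean K (index_ind i1 i2)). apply Rmult_le_compat_l; [apply pos_INR|].
    assert (0 <= (mu - 1 / 2) ^ 2) by apply pow2_ge_0. lra.
  - intros s _. unfold index_ind. destruct (andb _ _); ring.
Qed.

Lemma finite_max2 (P : nat -> nat -> nat -> Prop) M :
  (forall i1 i2, exists N0, forall N, (N0 <= N)%nat -> P i1 i2 N) ->
  exists N0, forall i1 i2 N, (i1 < M)%nat -> (i2 < M)%nat -> (N0 <= N)%nat -> P i1 i2 N.
Proof.
  intros H.
  assert (H1 : forall i1 m, exists N0, forall i2 N, (i2 < m)%nat -> (N0 <= N)%nat -> P i1 i2 N).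
  { intros i1. induction m as [|m [N0 IH]]; [exists O; intros; lia|].
    destruct (H i1 m) as [N1 HN1]. exists (N0 + N1)%nat. intros i2 N Hi HN.
    destruct (Nat.eq_dec i2 m) as [->|]; [apply HN1; lia|apply IH; lia]. }
  assert (H2 : forall m, exists N0, forall i1 i2 N, (i1 < m)%nat -> (i2 < M)%nat -> (N0 <= N)%nat -> P i1 i2 N).
  { induction m as [|m [N0 IH]]; [exists O; intros; lia|].
    destruct (H1 m M) as [N1 HN1]. exists (N0 + N1)%nat. intros i1 i2 N Hi Hi2 HN.
    destruct (Nat.eq_dec i1 m) as [->|]; [apply HN1; lia|apply IH; lia]. }
  apply H2.
Qed.

(** [Rsup] is meaningful only for a set that has a supremum: the values are bounded by 2, and the
    arc [0, 1/2) provides one. *)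
Lemma discrepancy_lub N y : (0 < N)%nat ->
  is_lub (fun v => exists a b, 0 <= a /\ a < b /\ b < 1 /\
        v = Rabs (sumN N (fun k => Defs.ind a b (frac_part (y k))) / INR N - (b - a))) (discrepancy N y).
Proof.
  intros HN. unfold discrepancy, Rsup. apply epsilon_spec.
  assert (HNr : 0 < INR N) by now apply lt_0_INR.
  edestruct (completeness (fun v => exists a b, 0 <= a /\ a < b /\ b < 1 /\
        v = Rabs (sumN N (fun k => Defs.ind a b (frac_part (y k))) / INR N - (b - a)))) as [l Hl]; [| |now exists l].
  - exists 2. intros v [a [b [Ha [Hab [Hb ->]]]]].
    assert (A : 0 <= sumN N (fun k => Defs.ind a b (frac_part (y k))) <= INR N * 1).
    { split; [apply sumN_nonneg|apply sumN_le_const]; intros; unfold Defs.ind;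
        destruct (Rle_dec a (frac_part (y i))), (Rlt_dec (frac_part (y i)) b); lra. }
    assert (A2 : 0 <= sumN N (fun k => Defs.ind a b (frac_part (y k))) / INR N <= 1).
    { split; [apply Rdiv_le_0_compat; lra|]. apply (proj2 (Rle_div_l _ _ _ HNr)). lra. }
    apply Rabs_le. lra.
  - eexists. exists 0, (1 / 2). repeat split; try lra.
Qed.

(** From above, all arcs are compared with the finitely many step functions of one level, uniformly
    by [dyadic_approx]. From below the arc [0, 1/2) is enough: its indicator is a step function of
    level 1 with variance exactly 1/4. *)
Lemma lil_discrepancy (n sigma : nat -> nat) :
  (forall k, (0 < n k)%nat) -> large_gaps n -> (forall i j, sigma i = sigma j -> i = j) ->
  ae01 (fun x => limsup_eq (fun N => INR N * discrepancy N (fun k => INR (n (sigma k)) * x) / lil_norm N) (1 / 2)).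
Proof.
  intros Hn Hgaps Hinj.
  set (c := fun m i1 i2 => centered (2 ^ m) (index_ind i1 i2)).
  assert (Hcb : forall m i1 i2 s, (s < 2 ^ m)%nat -> Rabs (c m i1 i2 s) <= 2).
  { intros m i1 i2 s Hs. replace 2 with (2 * 1) by ring. apply centered_abs; [apply pow2_nat_pos|intros; apply index_ind_abs|assumption]. }
  assert (Hc0 : forall m i1 i2, sumN (2 ^ m) (c m i1 i2) = 0) by (intros; apply centered_sum, pow2_nat_pos).
  assert (Hpos : forall r, 0 < / (INR r + 1)) by (intros r; apply Rinv_0_lt_compat; assert (A := pos_INR r); lra).
  assert (Hup : ae01 (fun x => forall m i1 i2 r, exists N0, forall N, (N0 <= N)%nat ->
     Rabs (cell_sum n sigma m (c m i1 i2) 0 N x) <= (1 / 2 + / (INR r + 1)) * lil_norm N)).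
  { apply ae_forall; intros m. apply ae_forall; intros i1. apply ae_forall; intros i2. apply ae_forall; intros r.
    assert (A1 := step_upper n sigma m (c m i1 i2) 2 (1 / 2) (/ (INR r + 1)) Hn Hgaps Hinj (Hcb m i1 i2) (Hc0 m i1 i2)
      ltac:(lra) (index_ind_centered_sqr _ i1 i2 (pow2_nat_pos m)) (Hpos r)).
    assert (A2 := step_upper n sigma m (fun s => - c m i1 i2 s) 2 (1 / 2) (/ (INR r + 1)) Hn Hgaps Hinj
      ltac:(intros s Hs; cbv beta; rewrite Rabs_Ropp; now apply Hcb)
      ltac:(rewrite (sumN_opp _ (c m i1 i2)), Hc0; ring) ltac:(lra)
      ltac:(rewrite (sumN_ext _ _ (fun s => c m i1 i2 s ^ 2)) by (intros; ring);
            apply (index_ind_centered_sqr _ i1 i2 (pow2_nat_pos m))) (Hpos r)).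
    eapply ae_impl; [apply (ae_and _ _ A1 A2)|]. intros x Hx [[N1 B1] [N2 B2]]. exists (N1 + N2)%nat. intros N HN.
    specialize (B1 N ltac:(lia)). specialize (B2 N ltac:(lia)).
    assert (E : cell_sum n sigma m (fun s => - c m i1 i2 s) 0 N x = - cell_sum n sigma m (c m i1 i2) 0 N x)
      by (unfold cell_sum; apply sumN_opp).
    rewrite E in B2. apply Rabs_le. lra. }
  assert (Hlow : ae01 (fun x => forall r, forall N0, exists N, (N0 <= N)%nat /\
     (1 / 2 - / (INR r + 1)) * lil_norm N <= cell_sum n sigma 1 (c 1%nat O 1%nat) 0 N x)).
  { apply ae_forall; intros r. apply (step_lower n sigma 1 (c 1%nat O 1%nat) 2); auto; try lra.
    unfold c, centered, mean, index_ind. simpl. field. }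
  destruct (Hgaps 32) as [K0 HK0].
  eapply ae_impl; [apply (ae_and _ _ (ae_and _ _ Hup Hlow) (dyadic_bounded_ae n sigma K0 Hn Hinj HK0))|].
  intros x Hx [[HU HLo] [J HG]].
  apply limsup_of_bounds.
  - intros eps He. destruct (exp_level_small 1080 3 (eps / 4) ltac:(lra) ltac:(lra) ltac:(lra)) as [m Hm]. specialize (Hm m (le_n m)).
    (* Arcs have variation at most 3, so eps / 12 costs eps / 4, as much as the term with 1080. *)
    destruct (dyadic_approx K0 m (eps / 12) ltac:(lra)) as [j0 Hj0].
    destruct (log2_large (j0 + J + 3)) as [N0 HN0].
    destruct (inv_S_small (eps / 4) ltac:(lra)) as [r Hr].
    destruct (finite_max2 (fun i1 i2 N => Rabs (cell_sum n sigma m (c m i1 i2) 0 N x) <= (1 / 2 + / (INR r + 1)) * lil_norm N) (S (2 ^ m))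
      (fun i1 i2 => HU m i1 i2 r)) as [N1 HN1].
    exists (N0 + N1 + 8)%nat. intros N HN. specialize (HN0 N ltac:(lia)).
    set (j := Nat.log2 N) in *. assert (Hb := log2_bounds N ltac:(lia)). fold j in Hb.
    assert (HW := lil_scale_le j N ltac:(lia) (proj1 Hb)). assert (HW0 := lil_scale_nonneg j).
    assert (HNr : 0 < INR N) by (apply lt_0_INR; lia). assert (T := lil_norm_pos N ltac:(lia)).
    assert (D : discrepancy N (fun k => INR (n (sigma k)) * x) <= (1 / 2 + eps) * lil_norm N / INR N).
    { apply (discrepancy_lub N (fun k => INR (n (sigma k)) * x) ltac:(lia)).
      intros v [a [b [Ha [Hab [Hb' ->]]]]].
      destruct (arc_grid a b m Ha Hab Hb') as [i1 [i2 [I1 [I2 HGr]]]].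
      specialize (HN1 i1 i2 N ltac:(lia) ltac:(lia) ltac:(lia)).
      assert (HV := arc_var a b Ha Hab Hb').
      assert (Hmean : forall h, Rabs ((b - a) - mean (2 ^ h) (grid (arc a b) h)) <= 2 * 3 * / INR (2 ^ h)).
      { intros h. rewrite <- (arc_RInt a b Ha Hab Hb'). apply mean_grid_RInt; [assumption|apply (RInt01_eq _ 3 HV)]. }
      assert (A := Hj0 n sigma (arc a b) 3 x j N (b - a) ltac:(lia) Hx
         ltac:(intros y; unfold arc; now rewrite frac_part_succ) HV (HG j ltac:(lia)) Hb Hmean).
      rewrite (cell_sum_ext n sigma m (centered (2 ^ m) (grid (arc a b) m)) (c m i1 i2)) in A.
      2:{ intros s Hs. unfold c, centered. rewrite HGr by assumption. f_equal. now apply mean_ext. }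
      unfold arc in A at 1.
      set (S := sumN N (fun k => Defs.ind a b (frac_part (INR (n (sigma k)) * x)))) in *.
      replace (S / INR N - (b - a)) with ((S - INR N * (b - a)) / INR N) by (field; lra).
      unfold Rdiv. rewrite Rabs_mult, (Rabs_pos_eq (/ INR N)) by (left; now apply Rinv_0_lt_compat).
      apply Rmult_le_compat_r; [left; now apply Rinv_0_lt_compat|].
      replace (S - INR N * (b - a)) with ((S - INR N * (b - a) - cell_sum n sigma m (c m i1 i2) 0 N x) + cell_sum n sigma m (c m i1 i2) 0 N x) by ring.
      eapply Rle_trans; [apply Rabs_triang|].
      assert (A' : 3 * ((1080 * exp (- (INR m / 8)) + eps / 12) * lil_scale j) <= eps / 2 * lil_scale j).
      { rewrite <- Rmult_assoc. apply Rmult_le_compat_r; lra. }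
      assert (eps / 2 * lil_scale j <= eps / 2 * lil_norm N) by (apply Rmult_le_compat_l; lra).
      assert ((1 / 2 + / (INR r + 1)) * lil_norm N <= (1 / 2 + eps / 4) * lil_norm N) by (apply Rmult_le_compat_r; lra).
      assert (0 <= eps * lil_norm N) by nra. lra. }
    apply (proj2 (Rle_div_r _ _ _ HNr)) in D. lra.
  - intros eps He N0. destruct (inv_S_small eps He) as [r Hr].
    destruct (HLo r (N0 + 1)%nat) as [N [HN HN2]]. exists N. split; [lia|].
    assert (HNr : 0 < INR N) by (apply lt_0_INR; lia). assert (T := lil_norm_nonneg N).
    assert (D : Rabs (sumN N (fun k => Defs.ind 0 (1 / 2) (frac_part (INR (n (sigma k)) * x))) / INR N - (1 / 2 - 0))
       <= discrepancy N (fun k => INR (n (sigma k)) * x)).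
    { apply (discrepancy_lub N (fun k => INR (n (sigma k)) * x) ltac:(lia)). exists 0, (1 / 2). repeat split; lra. }
    assert (E : cell_sum n sigma 1 (c 1%nat O 1%nat) 0 N x =
      sumN N (fun k => Defs.ind 0 (1 / 2) (frac_part (INR (n (sigma k)) * x))) - INR N * (1 / 2)).
    { rewrite <- sumN_const, <- sumN_minus. unfold cell_sum. apply sumN_ext. intros k _. rewrite Nat.add_0_l.
      assert (B := cell_index_bounds 1 (n (sigma k)) x ltac:(lra)). assert (B' := cell_index_lt 1 (n (sigma k)) x).
      set (y := frac_part (INR (n (sigma k)) * x)) in *. destruct (cell_index 1 (n (sigma k)) x) as [|[|d]]; [| |simpl in B'; lia].
      - replace (c 1%nat O 1%nat 0%nat) with (1 / 2) by (unfold c, centered, mean, index_ind; simpl; field).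
        simpl in B. unfold Defs.ind. destruct (Rle_dec 0 y), (Rlt_dec y (1 / 2)); lra.
      - replace (c 1%nat O 1%nat 1%nat) with (- (1 / 2)) by (unfold c, centered, mean, index_ind; simpl; field).
        simpl in B. unfold Defs.ind. destruct (Rle_dec 0 y), (Rlt_dec y (1 / 2)); lra. }
    rewrite E in HN2.
    set (S := sumN N (fun k => Defs.ind 0 (1 / 2) (frac_part (INR (n (sigma k)) * x)))) in *.
    assert (D2 : S - INR N * (1 / 2) <= INR N * discrepancy N (fun k => INR (n (sigma k)) * x)).
    { apply Rle_trans with (INR N * Rabs (S / INR N - (1 / 2 - 0))); [|apply Rmult_le_compat_l; lra].
      replace (S - INR N * (1 / 2)) with (INR N * (S / INR N - (1 / 2 - 0))) by (field; lra).
      apply Rmult_le_compat_l; [lra|apply Rle_abs]. }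
    eapply Rle_trans; [|apply D2]. eapply Rle_trans; [|apply HN2]. apply Rmult_le_compat_r; lra.
Qed.

Theorem theorem4 (n : nat -> nat)
  (hpos : forall k, (0 < n k)%nat)
  (hgap : cv_infty (fun k => INR (n (S k)) / INR (n k))) :
  forall (sigma : nat -> nat), bijective_nat sigma ->
  forall (f : R -> R),
    (forall x, f (x + 1) = f x) ->
    RInt01 f = 0 ->
    finite_variation01 f ->
    ae01 (fun x => limsup_eq
      (fun N => sumN N (fun k => f (INR (n (sigma k)) * x))
                / sqrt (2 * INR N * ln (ln (INR N))))
      (L2norm f))
    /\
    ae01 (fun x => limsup_eq
      (fun N => INR N * discrepancy N (fun k => INR (n (sigma k)) * x)
                / sqrt (2 * INR N * ln (ln (INR N))))
      (1/2)).
Proof.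
  intros sigma [Hinj _] f Hf HI [V HV]. assert (Hgaps := large_gaps_of_cv n hpos hgap). split.
  - exact (lil_bv n sigma f V hpos Hgaps Hinj Hf HI HV).
  - exact (lil_discrepancy n sigma hpos Hgaps Hinj).
Qed.
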